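(* The group $V_\tau$ has the presentation with generators $x_n,y_n,\pi_n$ ($n\ge 0$) and $c_n$ ($n\ge 1$) (standing for the elements of $V_\tau$ with these names) and with defining relations, for all indices for which the generators occurring are defined: (1.1) $x_jx_i=x_ix_{j+1}$ if $i<j$; (1.2) $x_jy_i=y_ix_{j+1}$ if $i<j$; (1.3) $y_jx_i=x_iy_{j+1}$ if $i<j$; (1.4) $y_jy_i=y_iy_{j+1}$ if $i<j$; (1.5) $y_n^2=x_nx_{n+1}$; (2.1) $x_kc_{n+1}=c_nx_{k+1}$ if $k<n$; (2.2) $c_nx_0=c_{n+1}^2$; (2.3) $c_n=x_nc_{n+1}$; (2.4) $c_n^{n+2}=1$; (3.1) $y_kc_{n+1}=c_ny_{k+1}$ if $k<n$; (3.2) $c_ny_0=y_{n+1}^{-1}c_{n+1}^2$; (4.1) $\pi_ix_j=x_j\pi_i$ if $j\ge i+2$; (4.2) $\pi_ix_{i+1}=x_i\pi_{i+1}\pi_i$; (4.3) $\pi_ix_i=x_{i+1}\pi_i\pi_{i+1}$; (4.4) $\pi_ix_j=x_j\pi_{i+1}$ if $0\le j<i$; (4.5) $\pi_i^2=1$; (4.6) $(\pi_{i+1}\pi_i)^3=1$; (4.7) $\pi_i\pi_j=\pi_j\pi_i$ if $j\ge i+2$; (5.1) $c_n\pi_k=\pi_{k-1}c_n$ if $1\le k<n$; (5.2) $c_n\pi_0=\pi_0\cdots\pi_{n-1}c_n^2$; (5.3) $c_n^2\pi_0=\pi_{n-1}\cdots\pi_0c_n$; (5.4) $c_n^3\pi_0=\pi_{n-1}c_n^3$;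 (6.1) $\pi_iy_j=y_j\pi_i$ if $j\ge i+2$; (6.2) $\pi_iy_{i+1}=y_i\pi_{i+1}\pi_i$; (6.3) $\pi_iy_i=y_{i+1}\pi_i\pi_{i+1}$; (6.4) $\pi_iy_j=y_j\pi_{i+1}$ if $0\le j<i$.
   Context: Let $\tau=(\sqrt5-1)/2$, so $1=\tau+\tau^2$. $V_\tau$ is the group (under composition, $fg=f\circ g$) of left-continuous piecewise-linear bijections of $(0,1]$ with finitely many breakpoints (including discontinuities), all in $\mathbb Z[\tau]$, and all slopes integer powers of $\tau$. Trees. An $x$-caret subdivides an interval $(a,a+L]$ into $(a,a+\tau^2L]$ and $(a+\tau^2L,a+L]$; a $y$-caret subdivides it into $(a,a+\tau L]$ and $(a+\tau L,a+L]$. A tree is a finite rooted binary tree whose interior nodes (carets) are each of type $x$ or $y$; with root $(0,1]$, its leaves, ordered from left to right, give a subdivision of $(0,1]$. A triple $(T_1,\pi,T_2)$, with $T_1,T_2$ trees with $k$ leaves and $\pi$ a permutation of the $k$ leaf positions, represents the element of $V_\tau$ mapping the interval of leaf $i$ of $T_2$ affinely and increasingly onto the interval of leaf $\pi(i)$ of $T_1$; thus $(T_1,\pi,T_2)(T_2,\pi',T_3)=(T_1,\pi\circ\pi',T_3)$. Generators. The spine $S_m$ is the tree with $m$ $x$-carets, each one after the first attached to the right leg of the previous one; its leaves are numbered $0,1,\dots,m$ from left to right. For $n\ge0$, $x_n$ (resp. $y_n$) is the element $(T,\mathrm{id},S_{n+2})$, where $T$ is obtained from $S_{n+1}$ by attaching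 an $x$-caret (resp. a $y$-caret) to its leaf number $n$. For $n\ge1$, $c_n=(S_{n+1},\gamma,S_{n+1})$, where $\gamma$ is the cyclic permutation sending leaf $0$ to leaf $n+1$ and leaf $i$ to leaf $i-1$ for $1\le i\le n+1$. For $n\ge 0$, $\pi_n=(S_{n+2},\sigma,S_{n+2})$, where $\sigma$ is the transposition exchanging leaves $n$ and $n+1$ and fixing the other leaves. *)

(* Defs.v *)
From HB Require Import structures.
From mathcomp Require Import all_boot all_order all_algebra all_fingroup.
From mathcomp Require Import boolp reals.
From mathcomp Require Import ring lra.

Set Implicit Arguments.
Unset Strict Implicit.
Unset Printing Implicit Defensive.

Import Order.TTheory GRing.Theory Num.Theory.

Local Open Scope ring_scope.

Section GroupPresentation.
Variable X : Type.

(* A letter (x, false) is the generator x, and (x, true) its formal inverse. *)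
Definition word := seq (X * bool).

Definition word_val (G : groupType) (phi : X -> G) (w : word) : G :=
  (\prod_(l <- w) (if l.2 then (phi l.1)^-1 else phi l.1))%g.

(* Equality of words in the quotient of the free group on X by the normal
   closure of the relators u v^-1, for u and v related by rel. *)
Inductive pres_eq (rel : word -> word -> Prop) : word -> word -> Prop :=
| pres_refl w : pres_eq rel w w
| pres_sym u v : pres_eq rel u v -> pres_eq rel v u
| pres_trans u v w : pres_eq rel u v -> pres_eq rel v w -> pres_eq rel u w
| pres_cat u u' v v' :
    pres_eq rel u u' -> pres_eq rel v v' -> pres_eq rel (u ++ v) (u' ++ v')
| pres_cancel x e : pres_eq rel [:: (x, e); (x, ~~ e)] [::]
| pres_rel u v : rel u v -> pres_eq rel u v.

Definition has_presentation (G : groupType) (phi : X -> G)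
    (rel : word -> word -> Prop) : Prop :=
  (forall g : G, exists w : word, word_val phi w = g) /\
  (forall u v : word, word_val phi u = word_val phi v <-> pres_eq rel u v).

End GroupPresentation.

Section Numbers.
Variable R : realType.
Implicit Types x y : R.

Definition tau : R := (Num.sqrt 5 - 1) / 2.

Definition Ztau x : Prop := exists a b : int, x = a%:~R + b%:~R * tau.

Lemma tauE : tau ^+ 2 = 1 - tau.
Proof.
have h : Num.sqrt 5 ^+ 2 = 5 :> R by rewrite sqr_sqrtr.
rewrite /tau; move: (Num.sqrt 5) h => z h; nra.
Qed.

Lemma tau_gt0 : 0 < tau.
Proof.
have h : Num.sqrt 5 ^+ 2 = 5 :> R by rewrite sqr_sqrtr.
have h0 : 0 <= Num.sqrt 5 :> R by rewrite sqrtr_ge0.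
rewrite /tau; move: (Num.sqrt 5) h h0 => z h h0; nra.
Qed.

Lemma tau_lt1 : tau < 1.
Proof. have := tauE; have := tau_gt0; move: tau => t; nra. Qed.

Lemma tauX_gt0 (k : int) : 0 < tau ^ k.
Proof. exact: exprz_gt0 tau_gt0. Qed.

Lemma tau_neq0 : tau != 0.
Proof. by rewrite gt_eqF // tau_gt0. Qed.

Lemma ZtauD x y : Ztau x -> Ztau y -> Ztau (x + y).
Proof.
move=> [a [b ->]] [c [d ->]]; exists (a + c), (b + d); rewrite !rmorphD /=; ring.
Qed.

Lemma ZtauN x : Ztau x -> Ztau (- x).
Proof. by move=> [a [b ->]]; exists (- a), (- b); rewrite !rmorphN /=; ring. Qed.

Lemma ZtauB x y : Ztau x -> Ztau y -> Ztau (x - y).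
Proof. by move=> hx /ZtauN; apply: ZtauD. Qed.

Lemma ZtauM x y : Ztau x -> Ztau y -> Ztau (x * y).
Proof.
move=> [a [b ->]] [c [d ->]]; exists (a * c + b * d), (a * d + b * c - b * d).
rewrite !rmorphB !rmorphD !rmorphM /=.
have := tauE; move: tau => t ht.
transitivity (a%:~R * c%:~R + (a%:~R * d%:~R + b%:~R * c%:~R) * t
  + b%:~R * d%:~R * t ^+ 2); first by ring.
by rewrite ht; ring.
Qed.

Lemma Ztau0 : Ztau 0. Proof. by exists 0, 0; rewrite mul0r addr0. Qed.
Lemma Ztau1 : Ztau 1. Proof. by exists 1, 0; rewrite mul0r addr0. Qed.
Lemma Ztaut : Ztau tau. Proof. by exists 0, 1; rewrite add0r mul1r. Qed.

Lemma tauV : tau^-1 = 1 + tau.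
Proof.
apply: (mulfI tau_neq0); rewrite divff ?tau_neq0 //.
by have := tauE; rewrite expr2 mulrDr mulr1 => ->; ring.
Qed.

Lemma ZtauX (k : int) : Ztau (tau ^ k).
Proof.
have hn x (n : nat) : Ztau x -> Ztau (x ^+ n).
  by move=> hx; elim: n => [|n IH]; [exact: Ztau1 | rewrite exprS; exact: ZtauM].
case: k => n; first by rewrite -exprnP; apply: hn; exact: Ztaut.
rewrite NegzE -exprnN -exprVn; apply: (hn); rewrite tauV.
exact: ZtauD Ztau1 Ztaut.
Qed.

End Numbers.

Arguments tau {R}.

Variant caret := xcaret | ycaret.

Inductive tree := Leaf | Node of caret & tree & tree.

Fixpoint nleaves (t : tree) : nat :=
  if t is Node _ l r then (nleaves l + nleaves r)%N else 1.

(* Leaves are numbered from 0, from left to right. *)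
Fixpoint attach (d : caret) (t : tree) (i : nat) : tree :=
  match t with
  | Leaf => if i == 0 then Node d Leaf Leaf else Leaf
  | Node e l r => if (i < nleaves l)%N then Node e (attach d l i) r
                  else Node e l (attach d r (i - nleaves l))
  end.

Fixpoint spine (m : nat) : tree :=
  if m is m'.+1 then Node xcaret Leaf (spine m') else Leaf.

Lemma nleaves_attach d t i :
  (i < nleaves t)%N -> nleaves (attach d t i) = (nleaves t).+1.
Proof.
elim: t i => [|e l IHl r IHr] i /=; first by case: i.
case: (ltnP i (nleaves l)) => h hi /=; first by rewrite IHl.
by rewrite IHr ?addnS // ltn_subLR.
Qed.

Lemma nleaves_spine m : nleaves (spine m) = m.+1.
Proof. by elim: m => //= m ->; rewrite add1n. Qed.

Section Vtau.
Variable R : realType.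

Definition ioc01 := {x : R | 0 < x <= 1}.

Definition left_continuous (f : ioc01 -> ioc01) : Prop :=
  forall (a : ioc01) (e : R), 0 < e -> exists2 d : R, 0 < d &
    forall x : ioc01, val a - d < val x <= val a ->
      `|val (f x) - val (f a)| < e.

(* The list s contains all breakpoints of f. *)
Definition tau_piecewise_linear (f : ioc01 -> ioc01) : Prop :=
  exists s : seq R, {in s, forall b, Ztau b} /\
    forall u v : R, {in s, forall b, ~~ (u < b < v)} ->
      exists (k : int) (c : R), forall x : ioc01, u < val x < v ->
        val (f x) = tau ^ k * val x + c.

Definition vtau_map (f : ioc01 -> ioc01) : Prop :=
  [/\ bijective f, left_continuous f & tau_piecewise_linear f].

Record Vtau := MkVtau { vtau_fun :> ioc01 -> ioc01; vtauP : vtau_map vtau_fun }.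

Lemma vtau_eqP (f g : Vtau) : vtau_fun f =1 vtau_fun g -> f = g.
Proof.
case: f g => [f hf] [g hg] /= /funext e; case: _ / e hg => hg.
by rewrite (Prop_irrelevance hf hg).
Qed.

Lemma tau_cancel (k : int) (x : R) : tau ^ (- k) * (tau ^ k * x) = x.
Proof. by rewrite mulrA -expfzDr ?tau_neq0 // addNr expr0z mul1r. Qed.

Lemma seq_extremum (le : rel R) (P : pred R) (s : seq R) :
  transitive le -> total le -> has P s ->
  exists m, [/\ m \in s, P m & {in s, forall r, P r -> le r m}].
Proof.
move=> tr tot; elim: s => //= a s IH; case: (boolP (has P s)) => [/IH|hs].
  move=> [m [ms Pm hm]] _; case: (boolP (P a && le m a)) => [/andP[Pa lma]|].
    exists a; split=> //; first by rewrite mem_head.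
    move=> r; rewrite inE => /orP[/eqP-> _|rs Pr]; first by case/orP: (tot a a).
    exact: tr (hm _ rs Pr) lma.
  rewrite negb_and => h; exists m; split=> //; first by rewrite inE ms orbT.
  move=> r; rewrite inE => /orP[/eqP-> Pa|]; last exact: hm.
  by move: h; rewrite Pa /= => /negPf h; have := tot a m; rewrite h orbF.
rewrite orbF => Pa; exists a; split=> //; first by rewrite mem_head.
move=> r; rewrite inE => /orP[/eqP-> _|rs Pr]; first by case/orP: (tot a a).
by case/hasP: hs; exists r.
Qed.

Section Pieces.
Variable f : ioc01 -> ioc01.
Hypothesis hf : vtau_map f.

Definition piece (Q : seq R) (p q : R) (k : int) (c : R) : Prop :=
  [/\ p \in 0 :: Q, q \in Q, p < q, {in Q, forall r, ~~ (p < r < q)} &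
    forall x : ioc01, p < val x <= q -> val (f x) = tau ^ k * val x + c].

Lemma vtau_pieces : exists Q : seq R,
  {in Q, forall b, 0 < b <= 1 /\ Ztau b} /\
  forall x : ioc01, exists p q k c, p < val x <= q /\ piece Q p q k c.
Proof.
have [_ lc [s [sZ sP]]] := hf.
pose Q := 1 :: [seq b <- s | 0 < b <= 1]; exists Q; split.
  move=> b; rewrite inE => /orP[/eqP->|]; first by rewrite ltr01 lexx; split=> //; exact: Ztau1.
  by rewrite mem_filter => /andP[-> /sZ].
move=> x; have /andP[x0 x1] := valP x.
have [|||p [pQ px pmax]] := @seq_extremum (fun a b => a <= b) (fun r => r < val x) (0 :: Q).
- by move=> ? ? ?; exact: le_trans.
- exact: le_total.
- by rewrite /= x0.
have [|||q [qQ xq qmin]] := @seq_extremum (fun a b => b <= a) (fun r => val x <= r) Q.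
- by move=> a b c h1 h2; exact: le_trans h2 h1.
- by move=> a b; exact: le_total.
- by rewrite /= x1.
have pq : p < q := lt_le_trans px xq.
have freeQ : {in Q, forall r, ~~ (p < r < q)}.
  move=> r rQ; apply/negP => /andP[pr rq].
  case: (ltP r (val x)) => h.
    have rQ0 : r \in 0 :: Q by rewrite inE rQ orbT.
    by have := pmax r rQ0 h; rewrite leNgt pr.
  by have := qmin r rQ h; rewrite leNgt rq.
have p0 : 0 <= p by apply: (pmax 0); rewrite ?mem_head.
have q1 : q <= 1 by apply: (qmin 1); rewrite ?mem_head.
have q01 : 0 < q <= 1 by rewrite q1 (le_lt_trans p0 pq).
have [|k [c kc]] := sP p q.
  move=> r rs; apply/negP => /andP[pr rq].
  have := freeQ r; rewrite inE mem_filter rs pr rq (le_lt_trans p0 pr) /=.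
  by rewrite (le_trans (ltW rq) q1) orbT => /(_ isT).
exists p, q, k, c; rewrite px xq; split=> //; split=> //.
move=> y /andP[py]; rewrite le_eqVlt => /orP[/eqP yq|yq]; last by apply: kc; rewrite py.
apply/eqP/negPn/negP => ne.
pose t : R := tau ^ k; have t0 : 0 < t := tauX_gt0 _ k.
pose e := `|val (f y) - (t * val y + c)|.
have e0 : 0 < e by rewrite normr_gt0 subr_eq0.
have [d d0 hd] := lc y (e / 2) (divr_gt0 e0 (ltr0Sn _ 1)).
pose m := Num.min d (Num.min (e / 2 / t) (q - p)) / 2.
have m0 : 0 < m.
  by rewrite divr_gt0 // !lt_min d0 !divr_gt0 //= subr_gt0.
have md : m < d.
  apply: lt_le_trans (_ : Num.min d (Num.min (e / 2 / t) (q - p)) <= d);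
    last by rewrite ge_min lexx.
  by rewrite /m in m0 *; lra.
have me : m < e / 2 / t.
  apply: lt_le_trans (_ : Num.min d (Num.min (e / 2 / t) (q - p)) <= _);
    last by rewrite !ge_min lexx orbT.
  by rewrite /m in m0 *; lra.
have mq : m < q - p.
  apply: lt_le_trans (_ : Num.min d (Num.min (e / 2 / t) (q - p)) <= _);
    last by rewrite !ge_min lexx !orbT.
  by rewrite /m in m0 *; lra.
have z01 : 0 < q - m <= 1 by clear - p0 q1 m0 mq; apply/andP; split; lra.
pose z : ioc01 := exist _ (q - m) z01.
have hz : val (f z) = t * (q - m) + c.
  by apply: kc; rewrite -[val z]/(q - m); clear - m0 mq; apply/andP; split; lra.
have := hd z; rewrite hz yq /= => h.
have {}h : `|t * (q - m) + c - val (f y)| < e / 2 by apply: h; clear - m0 md; apply/andP; split; lra.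
have tm : t * m < e / 2 by rewrite mulrC -ltr_pdivlMr.
have tm0 : 0 < t * m by exact: mulr_gt0.
have : e < e.
  rewrite {1}/e yq.
  have -> : val (f y) - (t * q + c) = - (t * (q - m) + c - val (f y)) - t * m by ring.
  apply: le_lt_trans (ler_normB _ _) _; rewrite normrN (gtr0_norm tm0).
  by clear - h tm; lra.
by rewrite ltxx.
Qed.

Lemma piece_bounds Q p q k c : {in Q, forall b : R, 0 < b <= 1 /\ Ztau b} ->
  piece Q p q k c -> [/\ 0 <= p, 0 < q, q <= 1, Ztau p & Ztau q].
Proof.
move=> hQ [pQ qQ pq _ _]; have [/andP[q0 q1] qZ] := hQ _ qQ.
have [p0 pZ] : 0 <= p /\ Ztau p.
  move: pQ; rewrite inE => /orP[/eqP->|/hQ[/andP[/ltW]]//]; split=> //; exact: Ztau0.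
by split.
Qed.

Lemma piece_uniq Q p q k c p' q' k' c' (x : R) :
  {in Q, forall b : R, 0 < b <= 1 /\ Ztau b} ->
  piece Q p q k c -> piece Q p' q' k' c' -> p < x <= q -> p' < x <= q' ->
  p = p' /\ q = q'.
Proof.
move=> hQ h h' /andP[px xq] /andP[px' xq'].
have [p0 _ _ _ _] := piece_bounds hQ h; have [p0' _ _ _ _] := piece_bounds hQ h'.
case: h => pQ qQ pq fr _; case: h' => pQ' qQ' pq' fr' _.
have aux a b a' b' : a \in 0 :: Q -> 0 <= a' -> {in Q, forall r, ~~ (a' < r < b')} ->
    a < x -> x <= b' -> a' < a -> a' < b -> False.
  move=> aQ a'0 fr1 ax xb lt _; move: aQ; rewrite inE => /orP[/eqP a0|/fr1].
    by move: lt; rewrite a0 ltNge a'0.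
  by rewrite lt (lt_le_trans ax xb).
split.
  case: (ltgtP p p') => // lt.
    by case: (aux p' q p q pQ' p0 fr px' xq lt pq).
  by case: (aux p q' p' q' pQ p0' fr' px xq' lt pq').
case: (ltgtP q q') => // lt.
  by have := fr' q qQ; rewrite lt (lt_le_trans px' xq).
by have := fr q' qQ'; rewrite lt (lt_le_trans px xq').
Qed.

Lemma vtau_inj : injective f.
Proof. by case: hf => /bij_inj. Qed.

(* The left end of the image of a piece lies outside the image of the other
   pieces, except as a right end. *)
Lemma piece_left Q p q k c p' q' k' c' (x : ioc01) :
  {in Q, forall b : R, 0 < b <= 1 /\ Ztau b} ->
  piece Q p q k c -> piece Q p' q' k' c' -> p' < val x <= q' ->
  val (f x) = tau ^ k * p + c -> val x = q'.
Proof.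
move=> hQ h h' /andP[px' xq'] fx; apply/eqP; move: xq'.
rewrite le_eqVlt => /orP[//|xq']; exfalso.
have [p0 _ q1 _ _] := piece_bounds hQ h; have [p0' _ q1' _ _] := piece_bounds hQ h'.
have pqh := h; have pqh' := h'.
case: pqh => _ _ pq _ hk; case: pqh' => _ _ pq' _ hk'.
have t0 := tauX_gt0 R k; have t0' := tauX_gt0 R k'.
have fx' : val (f x) = tau ^ k' * val x + c' by apply: hk'; rewrite px' ltW.
pose t : R := tau ^ k; pose t' : R := tau ^ k'.
pose e := Num.min (t * (q - p)) (t' * (q' - val x)).
have e0 : 0 < e by rewrite lt_min !mulr_gt0 // subr_gt0.
have e1 : e <= t * (q - p) by rewrite ge_min lexx.
have e2 : e <= t' * (q' - val x) by rewrite ge_min lexx orbT.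
have d1 : 0 < e / t by exact: divr_gt0.
have d2 : 0 < e / t' by exact: divr_gt0.
have d1' : e / t <= q - p by rewrite ler_pdivrMr // mulrC.
have d2' : e / t' <= q' - val x by rewrite ler_pdivrMr // mulrC.
have z1P : 0 < p + e / t <= 1 by clear - p0 q1 d1 d1'; apply/andP; split; lra.
have z2P : 0 < val x + e / t' <= 1 by clear - p0' q1' px' d2 d2'; apply/andP; split; lra.
pose z1 : ioc01 := exist _ (p + e / t) z1P; pose z2 : ioc01 := exist _ (val x + e / t') z2P.
have i1 : p < val z1 <= q by rewrite -[val z1]/(p + e / t); clear - d1 d1'; apply/andP; split; lra.
have i2 : p' < val x + e / t' <= q' by clear - px' d2 d2'; apply/andP; split; lra.
rewrite -[val x + _]/(val z2) in i2.
have ez : z1 = z2.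
  apply: vtau_inj; apply: val_inj; rewrite (hk _ i1) (hk' _ i2).
  rewrite -[val z1]/(p + e / t) -[val z2]/(val x + e / t').
  have a1 : t * (e / t) = e by rewrite mulrC mulfVK // gt_eqF.
  have a2 : t' * (e / t') = e by rewrite mulrC mulfVK // gt_eqF.
  rewrite -/t -/t' !mulrDr a1 a2.
  have : t * p + c = t' * val x + c' by rewrite -fx.
  by move: (t * p) (t' * _) => a b H; clear - H; lra.
have i1' : p < val z2 <= q by rewrite -ez.
have [ep eq] := piece_uniq hQ h h' i1' i2.
have E : val (f x) = tau ^ k * val x + c by apply: hk; rewrite ep eq px' ltW.
have : tau ^ k * p = tau ^ k * val x by apply: (addIr c); rewrite -E fx.
by move/(mulfI (lt0r_neq0 t0)) => px; move: px'; rewrite -ep px ltxx.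
Qed.

Lemma vtau_right_ends Q : {in Q, forall b : R, 0 < b <= 1 /\ Ztau b} ->
  (forall x : ioc01, exists p q k c, p < val x <= q /\ piece Q p q k c) ->
  forall x : ioc01, val x \in Q -> Ztau (val (f x)).
Proof.
move=> hQ hP x; pose F (y : R) := if insub y is Some z then val (f z) else 0.
have FE (y : ioc01) : F (val y) = val (f y) by rewrite /F valK.
have [n] := ubnP (count (fun r => F r < F (val x)) Q).
elim: n x => // n IH x ltn xQ.
have [p [q [k [c [hx h]]]]] := hP x.
have [p0 q0 q1 pZ qZ] := piece_bounds hQ h.
have hh := h; case: hh => pQ qQ pq fr hk.
have /andP[px xq] := hx.
have xe : val x = q.
  apply/eqP; move: xq; rewrite le_eqVlt => /orP[//|lt].
  by have := fr _ xQ; rewrite px lt.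
have t0 := tauX_gt0 R k.
have fx : val (f x) = tau ^ k * p + c + tau ^ k * (q - p).
  by rewrite hk // xe; ring.
have [/andP[fx0 fx1]] := valP (f x).
suff LZ : Ztau (tau ^ k * p + c).
  by rewrite fx; apply: ZtauD => //; apply: ZtauM; [exact: ZtauX | exact: ZtauB].
set L := _ + c in fx *.
have tp : 0 < tau ^ k * (q - p) by rewrite mulr_gt0 // subr_gt0.
have L0 : 0 <= L.
  rewrite leNgt; apply/negP => Lneg.
  pose t : R := tau ^ k.
  pose m := - L / t.
  have m0 : 0 < m by rewrite divr_gt0 // oppr_gt0.
  have mt : t * m = - L by rewrite mulrC mulfVK // gt_eqF.
  have mq : m < q - p.
    by rewrite ltr_pdivrMr // mulrC /t; lra.
  have zP : 0 < p + m <= 1 by clear - p0 m0 mq q1; apply/andP; split; lra.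
  pose z : ioc01 := exist _ (p + m) zP.
  have E : val (f z) = t * (p + m) + c.
    by apply: (hk z); rewrite -[val z]/(p + m); clear - m0 mq; apply/andP; split; lra.
  have /andP[+ _] := valP (f z); rewrite E mulrDr mt /L -/t; lra.
move: L0; rewrite le_eqVlt => /orP[/eqP<-|L0]; first exact: Ztau0.
have LP : 0 < L <= 1 by rewrite L0; lra.
have [[g _ gK] _ _] := hf.
pose y := g (exist _ L LP : ioc01).
have fy : val (f y) = L by rewrite /y gK.
have [p' [q' [k' [c' [hy h']]]]] := hP y.
have yq := piece_left hQ h h' hy fy.
have yQ : val y \in Q by rewrite yq; case: h'.
rewrite -fy; apply: IH => //; rewrite ltnS in ltn; apply: leq_trans ltn.
have lt : F (val y) < F (val x) by rewrite !FE fy fx; lra.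
rewrite -!size_filter.
have -> : [seq r <- Q | F r < F (val y)] =
    [seq r <- [seq r <- Q | F r < F (val x)] | F r < F (val y)].
  rewrite -filter_predI; apply: eq_filter => r /=.
  by case: ltP => //= h0; rewrite (lt_trans h0 lt).
rewrite size_filter -[X in (_ < X)%N](count_predC (fun r => F r < F (val y))).
rewrite -addn1 leq_add2l -has_count; apply/hasP; exists (val y).
  by rewrite mem_filter lt yQ.
by rewrite /= ltxx.
Qed.

Lemma vtau_Ztau x : Ztau (val (f x)) <-> Ztau (val x).
Proof.
have [Q [hQ hP]] := vtau_pieces.
have hE := vtau_right_ends hQ hP.
have [p [q [k [c [hx h]]]]] := hP x.
have [p0 q0 q1 pZ qZ] := piece_bounds hQ h.
case: h => pQ qQ pq fr hk.
have qP : 0 < q <= 1 by rewrite q0.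
pose z : ioc01 := exist _ q qP.
have fz : val (f z) = tau ^ k * q + c by apply: (hk z); rewrite -[val z]/q pq lexx.
have fq : Ztau (tau ^ k * q + c) by rewrite -fz; exact: hE.
have cZ : Ztau c.
  have -> : c = tau ^ k * q + c - tau ^ k * q by rewrite addrC addKr.
  apply: ZtauB => //.
  by apply: ZtauM => //; exact: ZtauX.
rewrite hk //; split=> H; last by apply: ZtauD => //; apply: ZtauM => //; exact: ZtauX.
rewrite -(tau_cancel k (val x)); apply: ZtauM; first exact: ZtauX.
have -> : tau ^ k * val x = tau ^ k * val x + c - c by rewrite addrK.
exact: ZtauB.
Qed.

Lemma vtau_left_affine (a : ioc01) : exists (u : R) (k : int) (c : R), [/\ 0 <= u,
  u < val a & forall x : ioc01, u < val x <= val a -> val (f x) = tau ^ k * val x + c].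
Proof.
have [Q [hQ hP]] := vtau_pieces.
have [p [q [k [c [/andP[pa aq] h]]]]] := hP a.
have [p0 _ _ _ _] := piece_bounds hQ h; case: h => _ _ _ _ hk.
exists p, k, c; split=> // x /andP[px xa]; apply: hk.
by rewrite px (le_trans xa aq).
Qed.

End Pieces.

Lemma left_affine_continuous (f : ioc01 -> ioc01) :
  (forall a : ioc01, exists (u : R) (k : int) (c : R), u < val a /\
    forall x : ioc01, u < val x <= val a -> val (f x) = tau ^ k * val x + c) ->
  left_continuous f.
Proof.
move=> h a e e0; have [u [k [c [ua hk]]]] := h a.
pose t : R := tau ^ k; have t0 : 0 < t := tauX_gt0 _ k.
exists (Num.min (val a - u) (e / t)).
  by rewrite lt_min subr_gt0 ua divr_gt0.
move=> x /andP[ax xa].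
have m1 : val a - val x < val a - u.
  apply: lt_le_trans (_ : Num.min (val a - u) (e / t) <= _);
    [lra | by rewrite ge_min lexx].
have m2 : val a - val x < e / t.
  apply: lt_le_trans (_ : Num.min (val a - u) (e / t) <= _);
    [lra | by rewrite ge_min lexx orbT].
rewrite !hk ?ua ?lexx // ?xa ?andbT; last lra.
have -> : tau ^ k * val x + c - (tau ^ k * val a + c) = - (t * (val a - val x)).
  by rewrite /t; ring.
rewrite normrN ger0_norm; last by rewrite mulr_ge0 ?subr_ge0 // ltW.
by rewrite mulrC -ltr_pdivlMr.
Qed.

Lemma vtau_map_id : vtau_map id.
Proof.
split; first by exists id.
  apply: left_affine_continuous => a; exists 0, 0, 0; split.
    by case/andP: (valP a).
  by move=> x _; rewrite expr0z mul1r addr0.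
by exists [::]; split=> // u v _; exists 0, 0 => x _; rewrite expr0z mul1r addr0.
Qed.

Lemma affine_comp (k l : int) (c d x : R) :
  tau ^ k * (tau ^ l * x + c) + d = tau ^ (k + l) * x + (tau ^ k * c + d).
Proof. by rewrite expfzDr ?tau_neq0 // mulrDr mulrA addrA. Qed.

Lemma vtau_map_comp f g : vtau_map f -> vtau_map g -> vtau_map (f \o g).
Proof.
move=> hf hg; have [bf cf [sf [sfZ sfP]]] := hf; have [bg cg [sg [sgZ sgP]]] := hg.
have [g' gK g'K] := bg.
split; first exact: bij_comp.
  apply: left_affine_continuous => a.
  have [u [k [c [u0 ua hu]]]] := vtau_left_affine hg a.
  have [v [l [d [v0 va hv]]]] := vtau_left_affine hf (g a).
  have t0 := tauX_gt0 R k.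
  have ga : val (g a) = tau ^ k * val a + c by apply: hu; rewrite ua lexx.
  exists (Num.max u ((v - c) / tau ^ k)), (l + k), (tau ^ l * c + d); split.
    by rewrite gt_max ua ltr_pdivrMr // ltrBlDr mulrC -ga.
  move=> x /andP[]; rewrite gt_max => /andP[ux]; rewrite ltr_pdivrMr // ltrBlDr mulrC => vx xa.
  have gx : val (g x) = tau ^ k * val x + c by apply: hu; rewrite ux.
  have h : v < val (g x) <= val (g a) by rewrite gx vx ga lerD2r ler_pM2l.
  by rewrite (hv _ h) gx affine_comp.
pose B : seq R := pmap (fun b => omap (fun z => val (g' z)) (insub b)) sf.
exists (1 :: sg ++ B); split.
  move=> b; rewrite inE mem_cat => /or3P[/eqP->|/sgZ//|]; first exact: Ztau1.
  rewrite mem_pmap => /mapP[r rs].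
  case: insubP => // z _ zr [->]; rewrite -(vtau_Ztau hg) g'K zr; exact: sfZ.
move=> u v free.
case: (leP 1 u) => [u1|u1].
  exists 0, 0 => x /andP[ux _]; have /andP[_ x1] := valP x.
  by have := lt_le_trans (le_lt_trans u1 ux) x1; rewrite ltxx.
have v1 : v <= 1.
  by have := free 1; rewrite mem_head u1 /= -leNgt => ->.
pose u' := Num.max u 0.
have [|k [c kc]] := sgP u' v.
  move=> b bs; apply/negP; rewrite gt_max => /andP[/andP[ub _] bv].
  by have := free b; rewrite inE mem_cat bs ub bv orbT => /(_ isT).
have t0 := tauX_gt0 R k.
have [|l [d ld]] := sfP (tau ^ k * u' + c) (tau ^ k * v + c).
  move=> b bs; apply/negP => /andP[ub bv].
  pose w := (b - c) / tau ^ k.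
  have tw : tau ^ k * w = b - c by rewrite mulrC mulfVK // gt_eqF.
  have uw : u' < w by rewrite -(ltr_pM2l t0) tw ltrBrDr.
  have wv : w < v by rewrite -(ltr_pM2l t0) tw ltrBlDr.
  have uw2 : u < w /\ 0 < w by move: uw; rewrite gt_max => /andP[].
  have w01 : 0 < w <= 1 by case: uw2 => _ ->; rewrite ltW // (lt_le_trans wv).
  pose z : ioc01 := exist _ w w01.
  have gz : val (g z) = b.
    by rewrite (kc z) -[val z]/w ?uw // tw subrK.
  have zB : w \in B.
    rewrite mem_pmap; apply/mapP; exists b => //.
    by rewrite -gz valK /= gK.
  have := free w; rewrite inE mem_cat zB !orbT wv => /(_ isT) /negP; apply.
  by case: uw2 => ->.
exists (l + k), (tau ^ l * c + d) => x /andP[ux xv].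
have ux' : u' < val x by rewrite gt_max ux; case/andP: (valP x).
have gx : val (g x) = tau ^ k * val x + c by apply: kc; rewrite ux'.
have h : tau ^ k * u' + c < val (g x) < tau ^ k * v + c.
  by rewrite gx !ltrD2r !ltr_pM2l // ux'.
by rewrite /= (ld _ h) gx affine_comp.
Qed.

Lemma vtau_map_inv (f g : ioc01 -> ioc01) :
  vtau_map f -> cancel f g -> cancel g f -> vtau_map g.
Proof.
move=> hf fK gK; split; first by exists f.
  apply: left_affine_continuous => y.
  have [u [k [c [u0 ux hk]]]] := vtau_left_affine hf (g y).
  have t0 := tauX_gt0 R k.
  have yE : val y = tau ^ k * val (g y) + c.
    by rewrite -[in LHS](gK y); apply: hk; rewrite ux lexx.
  exists (tau ^ k * u + c), (- k), (tau ^ (- k) * - c); split.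
    by rewrite yE ltrD2r ltr_pM2l.
  move=> z /andP[uz zy].
  pose w := (val z - c) / tau ^ k.
  have tw : tau ^ k * w = val z - c by rewrite mulrC mulfVK // gt_eqF.
  have uw : u < w by rewrite -(ltr_pM2l t0) tw ltrBrDr.
  have wy : w <= val (g y) by rewrite -(ler_pM2l t0) tw lerBlDr -yE.
  have w01 : 0 < w <= 1.
    by rewrite (le_lt_trans u0 uw) (le_trans wy) //; case/andP: (valP (g y)).
  pose a : ioc01 := exist _ w w01.
  have fa : f a = z by apply: val_inj; rewrite (hk a) -[val a]/w ?uw // tw subrK.
  by rewrite -fa fK -[val a]/w fa -mulrDr -tw tau_cancel.
have [Q [hQ hP]] := vtau_pieces hf.
have hE := vtau_right_ends hf hQ hP.
exists (pmap (fun b => omap (fun z => val (f z)) (insub b)) Q); split.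
  move=> b; rewrite mem_pmap => /mapP[r rQ].
  by case: insubP => // z _ zr [->]; apply: hE; rewrite zr.
move=> u v free.
have free' (z : ioc01) : val z \in Q -> ~~ (u < val (f z) < v).
  by move=> zQ; apply: free; rewrite mem_pmap; apply/mapP; exists (val z); rewrite // valK.
have [[y0 /andP[uy0 y0v]]|no] := pselect (exists y : ioc01, u < val y < v); last first.
  by exists 0, 0 => y hy; case: no; exists y.
have [p [q [k [c [hx h]]]]] := hP (g y0).
have [p0 q0 q1 _ _] := piece_bounds hQ h.
have hh := h; case: hh => _ qQ pq _ hk; have /andP[px xq] := hx.
have t0 := tauX_gt0 R k.
have y0E : val y0 = tau ^ k * val (g y0) + c by rewrite -[in LHS](gK y0); apply: hk.
have qP : 0 < q <= 1 by rewrite q0.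
pose zq : ioc01 := exist _ q qP.
have fq : val (f zq) = tau ^ k * q + c by apply: (hk zq); rewrite -[val zq]/q pq lexx.
have vq : v <= tau ^ k * q + c.
  have := free' zq qQ; rewrite fq negb_and -!leNgt => /orP[le|//].
  have : val y0 <= u by apply: le_trans le; rewrite y0E lerD2r ler_pM2l.
  by rewrite leNgt uy0.
have lo (y : ioc01) : u < val y -> tau ^ k * p + c < val y.
  move=> uy; set L := _ + c.
  case: (leP L 0) => [L0|L0]; first by apply: le_lt_trans L0 _; case/andP: (valP y).
  apply: le_lt_trans uy; rewrite leNgt; apply/negP => uL.
  have Ly0 : L < val y0 by rewrite y0E /L ltrD2r ltr_pM2l.
  have LP : 0 < L <= 1.
    by rewrite L0 (le_trans (ltW Ly0)) //; case/andP: (valP y0).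
  pose z : ioc01 := exist _ L LP.
  have fz : val (f (g z)) = L by rewrite gK.
  have [p' [q' [k' [c' [hz h']]]]] := hP (g z).
  have zq' := piece_left hf hQ h h' hz fz.
  have zQ : val (g z) \in Q by rewrite zq'; case: h'.
  by have := free' _ zQ; rewrite fz uL (lt_trans Ly0 y0v).
exists (- k), (tau ^ (- k) * - c) => y /andP[uy yv].
pose w := (val y - c) / tau ^ k.
have tw : tau ^ k * w = val y - c by rewrite mulrC mulfVK // gt_eqF.
have pw : p < w by rewrite -(ltr_pM2l t0) tw ltrBrDr lo.
have wq : w <= q by rewrite -(ler_pM2l t0) tw lerBlDr (le_trans (ltW yv)).
have w01 : 0 < w <= 1 by rewrite (le_lt_trans p0 pw) (le_trans wq).
pose a : ioc01 := exist _ w w01.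
have fa : f a = y by apply: val_inj; rewrite (hk a) -[val a]/w ?pw // tw subrK.
by rewrite -fa fK -[val a]/w fa -mulrDr -tw tau_cancel.
Qed.

Lemma vtau_inverse_subproof (f : Vtau) :
  exists g : Vtau, cancel f g /\ cancel g f.
Proof.
have [[g fK gK] _ _] := vtauP f.
by exists (MkVtau (vtau_map_inv (vtauP f) fK gK)).
Qed.

Definition vtau_one : Vtau := MkVtau vtau_map_id.
Definition vtau_mul (f g : Vtau) : Vtau :=
  MkVtau (vtau_map_comp (vtauP f) (vtauP g)).
Definition vtau_inv (f : Vtau) : Vtau := sval (cid (vtau_inverse_subproof f)).

Lemma vtau_mulA : associative vtau_mul.
Proof. by move=> f g h; apply: vtau_eqP. Qed.
Lemma vtau_mul1 : left_id vtau_one vtau_mul.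
Proof. by move=> f; apply: vtau_eqP. Qed.
Lemma vtau_mulr1 : right_id vtau_one vtau_mul.
Proof. by move=> f; apply: vtau_eqP. Qed.
Lemma vtau_mulV : left_inverse vtau_one vtau_inv vtau_mul.
Proof.
by move=> f; apply: vtau_eqP => x; rewrite /vtau_inv; case: cid => g [/= fK _]; exact: fK.
Qed.
Lemma vtau_mulrV : right_inverse vtau_one vtau_inv vtau_mul.
Proof.
by move=> f; apply: vtau_eqP => x; rewrite /vtau_inv; case: cid => g [/= _ gK]; exact: gK.
Qed.

HB.instance Definition _ := gen_eqMixin Vtau.
HB.instance Definition _ := gen_choiceMixin Vtau.
HB.instance Definition _ := isGroup.Build Vtau
  vtau_mulA vtau_mul1 vtau_mulr1 vtau_mulV vtau_mulrV.

Lemma vtau_mulE (f g : Vtau) (x : ioc01) : (f * g)%g x = f (g x).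
Proof. by []. Qed.

Definition cut (d : caret) : R := if d is xcaret then tau ^+ 2 else tau.

(* The pair (a, b) stands for the interval ]a, b]. *)
Fixpoint leaves (t : tree) (a b : R) : seq (R * R) :=
  if t is Node d l r then
    let m := a + cut d * (b - a) in leaves l a m ++ leaves r m b
  else [:: (a, b)].

Definition leaf (t : tree) (i : nat) : R * R := nth (0, 0) (leaves t 0 1) i.

Lemma size_leaves t a b : size (leaves t a b) = nleaves t.
Proof. by elim: t a b => //= d l IHl r IHr a b; rewrite size_cat IHl IHr. Qed.

Lemma cutP d (a b : R) : a < b ->
  [/\ a < a + cut d * (b - a), a + cut d * (b - a) < b,
      exists k : int, a + cut d * (b - a) - a = tau ^ k * (b - a) &
      exists k : int, b - (a + cut d * (b - a)) = tau ^ k * (b - a)].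
Proof.
move=> ab; have t0 := tau_gt0 R; have t1 := tau_lt1 R; have tE := tauE R.
have d0 : 0 < b - a by rewrite subr_gt0.
have [c0 c1 [k kE] [l lE]] : [/\ 0 < cut d, cut d < 1,
    exists k : int, cut d = tau ^ k & exists k : int, 1 - cut d = tau ^ k].
  case: d => /=; split; try by [lra | rewrite tE; lra].
  - by exists 2%N.
  - by exists 1%N; rewrite tE -exprnP expr1; ring.
  - by exists 1%N; rewrite -exprnP expr1.
  - by exists 2%N; rewrite -exprnP tE.
split.
- by rewrite ltrDl mulr_gt0.
- by rewrite addrC -ltrBrDr gtr_pMl.
- by exists k; rewrite -kE; ring.
- by exists l; rewrite -lE; ring.
Qed.

Lemma leavesP t (a b : R) : a < b -> {in leaves t a b, forall J,
  [/\ a <= J.1, J.1 < J.2, J.2 <= b & exists k : int, J.2 - J.1 = tau ^ k * (b - a)]}.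
Proof.
elim: t a b => [|d l IHl r IHr] a b ab J /=.
  by rewrite inE => /eqP->; split=> //; exists 0; rewrite expr0z mul1r.
have [am mb [k kE] [k' kE']] := cutP d ab.
rewrite mem_cat => /orP[/(IHl _ _ am)|/(IHr _ _ mb)] [h1 h2 h3 [i iE]]; split=> //.
- by rewrite (le_trans h3) // ltW.
- by exists (i + k); rewrite iE kE expfzDr ?tau_neq0 // mulrA.
- by rewrite (le_trans _ h1) // ltW.
- by exists (i + k'); rewrite iE kE' expfzDr ?tau_neq0 // mulrA.
Qed.

Lemma leaves_Ztau t (a b : R) : Ztau a -> Ztau b ->
  {in leaves t a b, forall J, Ztau J.1 /\ Ztau J.2}.
Proof.
elim: t a b => [|d l IHl r IHr] a b Za Zb J /=; first by rewrite inE => /eqP->.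
have Zm : Ztau (a + cut d * (b - a)).
  apply: ZtauD => //; apply: ZtauM; last exact: ZtauB.
  by case: d => /=; [exact: (ZtauX R 2%N) | exact: Ztaut].
by rewrite mem_cat => /orP[/IHl|/IHr]; apply.
Qed.

Lemma leaves_cover t (a b x : R) : a < b -> a < x <= b ->
  exists2 i, (i < nleaves t)%N & let J := nth (0, 0) (leaves t a b) i in J.1 < x <= J.2.
Proof.
elim: t a b => [|d l IHl r IHr] a b ab /= hx; first by exists 0%N.
have [am mb _ _] := cutP d ab; have /andP[ax xb] := hx.
case: (leP x (a + cut d * (b - a))) => h.
  have [|i il hi] := IHl _ _ am; first by rewrite ax.
  by exists i; rewrite ?ltn_addr // nth_cat size_leaves il.
have [|i il hi] := IHr _ _ mb; first by rewrite h.
exists (nleaves l + i)%N; first by rewrite ltn_add2l.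
by rewrite nth_cat size_leaves ltnNge leq_addr /= addKn.
Qed.

Lemma leaves_disjoint t (a b x : R) i j : a < b ->
  (i < nleaves t)%N -> (j < nleaves t)%N ->
  (let J := nth (0, 0) (leaves t a b) i in J.1 < x <= J.2) ->
  (let J := nth (0, 0) (leaves t a b) j in J.1 < x <= J.2) -> i = j.
Proof.
elim: t a b i j => [|d l IHl r IHr] a b i j ab /=; first by case: i j => [|i] [|j].
have [am mb _ _] := cutP d ab.
set m := a + _ in am mb *.
have left i' : (i' < nleaves l)%N ->
    (let J := nth (0, 0) (leaves l a m) i' in J.1 < x <= J.2) -> x <= m.
  move=> hi /andP[_ h]; have := leavesP am (mem_nth (0, 0) _).
  by move/(_ l i'); rewrite size_leaves => /(_ hi) [_ _ + _]; apply: le_trans h.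
have right i' : (i' < nleaves r)%N ->
    (let J := nth (0, 0) (leaves r m b) i' in J.1 < x <= J.2) -> m < x.
  move=> hi /andP[h _]; have := leavesP mb (mem_nth (0, 0) _).
  by move/(_ r i'); rewrite size_leaves => /(_ hi) [+ _ _ _] => h'; apply: le_lt_trans h.
move=> hi hj; rewrite !nth_cat !size_leaves.
have sub n : (n < nleaves l + nleaves r)%N -> (nleaves l <= n)%N -> (n - nleaves l < nleaves r)%N.
  by move=> h1 h2; rewrite ltn_subLR.
case: (ltnP i) => il; case: (ltnP j) => jl.
- exact: IHl.
- by move=> /(left _ il) h1 /(right _ (sub _ hj jl)); rewrite ltNge h1.
- by move=> /(right _ (sub _ hi il)) + /(left _ jl) h1; rewrite ltNge h1.
- move=> h1 h2; rewrite -(subnKC il) -(subnKC jl); congr (_ + _)%N.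
  by apply: (IHr m b) => //; exact: sub.
Qed.

Lemma leaf_cover t (x : ioc01) :
  exists2 i, (i < nleaves t)%N & (leaf t i).1 < val x <= (leaf t i).2.
Proof. exact: leaves_cover ltr01 (valP x). Qed.

Lemma leaf_disjoint t (x : R) i j : (i < nleaves t)%N -> (j < nleaves t)%N ->
  (leaf t i).1 < x <= (leaf t i).2 -> (leaf t j).1 < x <= (leaf t j).2 -> i = j.
Proof. exact: leaves_disjoint ltr01. Qed.

Lemma leafP t i : (i < nleaves t)%N ->
  [/\ 0 <= (leaf t i).1, (leaf t i).1 < (leaf t i).2, (leaf t i).2 <= 1 &
    exists k : int, (leaf t i).2 - (leaf t i).1 = tau ^ k].
Proof.
move=> h; have := leavesP (t := t) (@ltr01 R) (mem_nth (0, 0) _).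
rewrite size_leaves => /(_ i h) [h1 h2 h3 [k kE]]; split=> //.
by exists k; rewrite kE subr0 mulr1.
Qed.

Lemma leaf_Ztau t i : (i < nleaves t)%N -> Ztau (leaf t i).1 /\ Ztau (leaf t i).2.
Proof.
by move=> h; apply: (leaves_Ztau (t := t) (Ztau0 R) (Ztau1 R)); rewrite mem_nth // size_leaves.
Qed.

(* The increasing affine bijection from the interval J onto the interval K. *)
Definition affine_onto (J K : R * R) (x : R) : R :=
  K.1 + (K.2 - K.1) / (J.2 - J.1) * (x - J.1).

Definition tree_pair_fun (k : nat) (T1 : tree) (p : 'S_k) (T2 : tree)
    (x : R) : R :=
  if [pick i : 'I_k | (leaf T2 i).1 < x <= (leaf T2 i).2] is Some i
  then affine_onto (leaf T2 i) (leaf T1 (p i)) x else x.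

Lemma affine_onto_in (J K : R * R) (x : R) : J.1 < J.2 -> K.1 < K.2 ->
  J.1 < x <= J.2 -> K.1 < affine_onto J K x <= K.2.
Proof.
rewrite /affine_onto => hJ hK /andP[x1 x2].
have dJ : 0 < J.2 - J.1 by rewrite subr_gt0.
have dK : 0 < K.2 - K.1 by rewrite subr_gt0.
rewrite -mulrA; set s := _^-1 * _.
have s0 : 0 < s by rewrite /s mulr_gt0 ?invr_gt0 // subr_gt0.
have s1 : s <= 1 by rewrite /s mulrC ler_pdivrMr // mul1r lerD2r.
rewrite ltrDl mulr_gt0 //= -lerBrDl -[leRHS]mulr1 ler_pM2l //.
Qed.

Lemma affine_ontoK (J K : R * R) (x : R) : J.1 < J.2 -> K.1 < K.2 ->
  affine_onto K J (affine_onto J K x) = x.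
Proof.
rewrite /affine_onto => hJ hK.
have dJ : J.2 - J.1 != 0 by rewrite gt_eqF // subr_gt0.
have dK : K.2 - K.1 != 0 by rewrite gt_eqF // subr_gt0.
by field; rewrite dJ dK.
Qed.

Section TreePair.
Variables (k : nat) (T1 : tree) (p : 'S_k) (T2 : tree).
Hypotheses (h1 : nleaves T1 = k) (h2 : nleaves T2 = k).

Lemma tree_pair_funE (i : 'I_k) (x : R) : (leaf T2 i).1 < x <= (leaf T2 i).2 ->
  tree_pair_fun T1 p T2 x = affine_onto (leaf T2 i) (leaf T1 (p i)) x.
Proof.
move=> hi; rewrite /tree_pair_fun; case: pickP => [j hj|/(_ i)]; last by rewrite hi.
suff -> : j = i by [].
by apply: val_inj; apply: (leaf_disjoint _ _ hj hi); rewrite h2.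
Qed.

Lemma tree_pair_cover (x : ioc01) :
  exists i : 'I_k, (leaf T2 i).1 < val x <= (leaf T2 i).2.
Proof. by have [i] := leaf_cover T2 x; rewrite h2 => hi; exists (Ordinal hi). Qed.

Lemma tree_pair_leaf (i : 'I_k) (x : R) : (leaf T2 i).1 < x <= (leaf T2 i).2 ->
  (leaf T1 (p i)).1 < tree_pair_fun T1 p T2 x <= (leaf T1 (p i)).2.
Proof.
move=> hi; rewrite (tree_pair_funE hi).
have [|_ lt1 _ _] := @leafP T1 (p i); first by rewrite h1.
have [|_ lt2 _ _] := @leafP T2 i; first by rewrite h2.
exact: affine_onto_in.
Qed.

Lemma tree_pair_ioc01 (x : ioc01) : 0 < tree_pair_fun T1 p T2 (val x) <= 1.
Proof.
have [i hi] := tree_pair_cover x; have /andP[a b] := tree_pair_leaf hi.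
have [|a0 _ b1 _] := @leafP T1 (p i); first by rewrite h1.
by rewrite (le_lt_trans a0 a) (le_trans b b1).
Qed.

Definition tree_pair_map (x : ioc01) : ioc01 := 
  exist _ (tree_pair_fun T1 p T2 (val x)) (tree_pair_ioc01 x).

Lemma tree_pair_affine (i : 'I_k) : exists (n : int) (c : R), forall x : ioc01,
  (leaf T2 i).1 < val x <= (leaf T2 i).2 -> val (tree_pair_map x) = tau ^ n * val x + c.
Proof.
have [|_ lt1 _ [m mE]] := @leafP T1 (p i); first by rewrite h1.
have [|_ lt2 _ [n nE]] := @leafP T2 i; first by rewrite h2.
exists (m - n), ((leaf T1 (p i)).1 - tau ^ (m - n) * (leaf T2 i).1) => x hx.
rewrite -[val (_ x)]/(tree_pair_fun T1 p T2 (val x)) (tree_pair_funE hx).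
rewrite /affine_onto mE nE invr_expz -expfzDr ?tau_neq0 //.
by move: (tau ^ _) => t; ring.
Qed.

End TreePair.

Lemma tree_pair_mapK k (T1 T2 : tree) (p : 'S_k)
  (h1 : nleaves T1 = k) (h2 : nleaves T2 = k) :
  cancel (tree_pair_map p h1 h2) (tree_pair_map p^-1%g h2 h1).
Proof.
move=> x; apply: val_inj => /=.
have [i hi] := tree_pair_cover h2 x; have hpi := tree_pair_leaf p h1 h2 hi.
rewrite (tree_pair_funE T2 p^-1%g h1 hpi) (tree_pair_funE T1 p h2 hi) permK.
apply: affine_ontoK; [have [] := @leafP T2 i | have [] := @leafP T1 (p i)] => //.
  by rewrite h2.
by rewrite h1.
Qed.

Lemma tree_pairP k (T1 T2 : tree) (p : 'S_k)
  (h1 : nleaves T1 = k) (h2 : nleaves T2 = k) : vtau_map (tree_pair_map p h1 h2).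
Proof.
split.
- exists (tree_pair_map p^-1%g h2 h1); first exact: tree_pair_mapK.
  by have := @tree_pair_mapK k T2 T1 p^-1%g h2 h1; rewrite invgK.
- apply: left_affine_continuous => a.
  have [i /andP[ia ai]] := tree_pair_cover h2 a.
  have [n [c hc]] := tree_pair_affine p h1 h2 i.
  exists (leaf T2 i).1, n, c; split=> // x /andP[ix xa]; apply: hc.
  by rewrite ix (le_trans xa ai).
exists (1 :: [seq (leaf T2 (i : 'I_k)).2 | i <- enum 'I_k]); split.
  move=> b; rewrite inE => /orP[/eqP->|/mapP[i _ ->]]; first exact: Ztau1.
  by have [|_] := @leaf_Ztau T2 i; first by rewrite h2.
move=> u v free.
have [[x0 /andP[ux0 x0v]]|no] := pselect (exists x : ioc01, u < val x < v); last first.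
  by exists 0, 0 => y hy; case: no; exists y.
have [i /andP[ix0 x0i]] := tree_pair_cover h2 x0.
have [n [c hc]] := tree_pair_affine p h1 h2 i.
have right (j : 'I_k) x : u < x -> x <= (leaf T2 j).2 -> v <= (leaf T2 j).2.
  move=> ux xj; rewrite leNgt; apply/negP => jv.
  have /free : (leaf T2 j).2 \in 1 :: [seq (leaf T2 (i : 'I_k)).2 | i <- enum 'I_k].
    by rewrite inE; apply/orP; right; apply/mapP; exists j; rewrite ?mem_enum.
  by rewrite jv (lt_le_trans ux xj).
exists n, c => x /andP[ux xv].
apply: hc; case: (ltP (leaf T2 i).1 (val x)) => ix.
  by rewrite (le_trans (ltW xv)) // (right i (val x0)).
have [j hj] := tree_pair_cover h2 x; have /andP[jx xj] := hj.
have hj0 : (leaf T2 j).1 < val x0 <= (leaf T2 j).2.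
  rewrite (lt_le_trans jx) ?(le_trans ix) ?ltW //=.
  by rewrite (lt_le_trans x0v) // (right j (val x)).
have ij : (i : nat) = j.
  by apply: (@leaf_disjoint T2 (val x0)); rewrite ?h2 // ix0.
by rewrite ij leNgt jx in ix.
Qed.

Definition tree_pair (k : nat) (T1 : tree) (p : 'S_k) (T2 : tree)
    (h1 : nleaves T1 = k) (h2 : nleaves T2 = k) : Vtau :=
  MkVtau (tree_pairP p h1 h2).

Lemma tree_pairE k (T1 T2 : tree) (p : 'S_k) (h1 : nleaves T1 = k)
    (h2 : nleaves T2 = k) (i : 'I_k) (x : ioc01) :
  (leaf T2 i).1 < val x <= (leaf T2 i).2 ->
  val (tree_pair p h1 h2 x) = affine_onto (leaf T2 i) (leaf T1 (p i)) (val x).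
Proof. by move=> hi; apply: (tree_pair_funE T1 p h2). Qed.

(* Products of permutations are composed from left to right. *)
Lemma tree_pairM k (T1 T2 T3 : tree) (p q : 'S_k) (h1 : nleaves T1 = k)
    (h2 : nleaves T2 = k) (h3 : nleaves T3 = k) :
  (tree_pair p h1 h2 * tree_pair q h2 h3 = tree_pair (q * p) h1 h3)%g.
Proof.
apply: vtau_eqP => x; apply: val_inj; rewrite vtau_mulE.
have [i hi] := tree_pair_cover h3 x.
have hqi := tree_pair_leaf q h2 h3 hi.
rewrite (tree_pairE p h1 h2 (i := q i)) // !(tree_pairE _ _ _ hi) permM.
have [|_ l1 _ _] := @leafP T1 (p (q i)); first by rewrite h1.
have [|_ l2 _ _] := @leafP T2 (q i); first by rewrite h2.
have [|_ l3 _ _] := @leafP T3 i; first by rewrite h3.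
rewrite /affine_onto; move: (leaf T1 _) (leaf T2 _) (leaf T3 _) l1 l2 l3 (val x).
move=> [a1 b1] [a2 b2] [a3 b3] /= l1 l2 l3 {hi hqi}y.
have d2 : b2 - a2 != 0 by rewrite gt_eqF // subr_gt0.
have d3 : b3 - a3 != 0 by rewrite gt_eqF // subr_gt0.
by field; rewrite d2 d3.
Qed.

Lemma nleaves_attach_spine d n : nleaves (attach d (spine n.+1) n) = n.+3.
Proof. by rewrite nleaves_attach nleaves_spine. Qed.

Definition vtau_x (n : nat) : Vtau :=
  tree_pair 1 (nleaves_attach_spine xcaret n) (nleaves_spine n.+2).

Definition vtau_y (n : nat) : Vtau :=
  tree_pair 1 (nleaves_attach_spine ycaret n) (nleaves_spine n.+2).

(* ord_pred sends 0 to the last index and i.+1 to i. *)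
Definition vtau_c (n : nat) : Vtau :=
  tree_pair (perm (@ord_pred_inj n.+2))
    (nleaves_spine n.+1) (nleaves_spine n.+1).

Definition vtau_pi (n : nat) : Vtau :=
  tree_pair (tperm (inord n) (inord n.+1) : 'S_n.+3)
    (nleaves_spine n.+2) (nleaves_spine n.+2).

End Vtau.

Inductive generator :=
| gen_x of nat
| gen_y of nat
| gen_pi of nat
| gen_c (n : nat) of (0 < n)%N.

Definition generator_val (R : realType) (g : generator) : Vtau R :=
  match g with
  | gen_x n => vtau_x R n
  | gen_y n => vtau_y R n
  | gen_pi n => vtau_pi R n
  | gen_c n _ => vtau_c R n
  end.

Definition wx n : word generator := [:: (gen_x n, false)].
Definition wy n : word generator := [:: (gen_y n, false)].
Definition wyV n : word generator := [:: (gen_y n, true)].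
Definition wpi n : word generator := [:: (gen_pi n, false)].
Definition wc n (hn : (0 < n)%N) : word generator := [:: (gen_c hn, false)].
(* The letter c_(n+1). *)
Definition wcS n : word generator := wc (ltn0Sn n).
Definition wexp (w : word generator) (m : nat) : word generator :=
  flatten (nseq m w).

Variant vtau_rel : word generator -> word generator -> Prop :=
| rel_xx i j of (i < j)%N : vtau_rel (wx j ++ wx i) (wx i ++ wx j.+1)
| rel_xy i j of (i < j)%N : vtau_rel (wx j ++ wy i) (wy i ++ wx j.+1)
| rel_yx i j of (i < j)%N : vtau_rel (wy j ++ wx i) (wx i ++ wy j.+1)
| rel_yy i j of (i < j)%N : vtau_rel (wy j ++ wy i) (wy i ++ wy j.+1)
| rel_y2 n : vtau_rel (wexp (wy n) 2) (wx n ++ wx n.+1)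

| rel_xc k n (hn : (0 < n)%N) of (k < n)%N :
    vtau_rel (wx k ++ wcS n) (wc hn ++ wx k.+1)
| rel_cx0 n (hn : (0 < n)%N) : vtau_rel (wc hn ++ wx 0) (wexp (wcS n) 2)
| rel_c n (hn : (0 < n)%N) : vtau_rel (wc hn) (wx n ++ wcS n)
| rel_c_order n (hn : (0 < n)%N) : vtau_rel (wexp (wc hn) n.+2) [::]

| rel_yc k n (hn : (0 < n)%N) of (k < n)%N :
    vtau_rel (wy k ++ wcS n) (wc hn ++ wy k.+1)
| rel_cy0 n (hn : (0 < n)%N) :
    vtau_rel (wc hn ++ wy 0) (wyV n.+1 ++ wexp (wcS n) 2)

| rel_pix_gt i j of (i.+2 <= j)%N : vtau_rel (wpi i ++ wx j) (wx j ++ wpi i)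
| rel_pixS i : vtau_rel (wpi i ++ wx i.+1) (wx i ++ wpi i.+1 ++ wpi i)
| rel_pix i : vtau_rel (wpi i ++ wx i) (wx i.+1 ++ wpi i ++ wpi i.+1)
| rel_pix_lt i j of (j < i)%N : vtau_rel (wpi i ++ wx j) (wx j ++ wpi i.+1)
| rel_pi2 i : vtau_rel (wexp (wpi i) 2) [::]
| rel_pi3 i : vtau_rel (wexp (wpi i.+1 ++ wpi i) 3) [::]
| rel_pipi i j of (i.+2 <= j)%N : vtau_rel (wpi i ++ wpi j) (wpi j ++ wpi i)

| rel_cpi k n (hn : (0 < n)%N) of (1 <= k)%N & (k < n)%N :
    vtau_rel (wc hn ++ wpi k) (wpi k.-1 ++ wc hn)
| rel_cpi0 n (hn : (0 < n)%N) :
    vtau_rel (wc hn ++ wpi 0)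
      (flatten [seq wpi i | i <- iota 0 n] ++ wexp (wc hn) 2)
| rel_c2pi0 n (hn : (0 < n)%N) :
    vtau_rel (wexp (wc hn) 2 ++ wpi 0)
      (flatten [seq wpi i | i <- rev (iota 0 n)] ++ wc hn)
| rel_c3pi0 n (hn : (0 < n)%N) :
    vtau_rel (wexp (wc hn) 3 ++ wpi 0) (wpi n.-1 ++ wexp (wc hn) 3)

| rel_piy_gt i j of (i.+2 <= j)%N : vtau_rel (wpi i ++ wy j) (wy j ++ wpi i)
| rel_piyS i : vtau_rel (wpi i ++ wy i.+1) (wy i ++ wpi i.+1 ++ wpi i)
| rel_piy i : vtau_rel (wpi i ++ wy i) (wy i.+1 ++ wpi i ++ wpi i.+1)
| rel_piy_lt i j of (j < i)%N : vtau_rel (wpi i ++ wy j) (wy j ++ wpi i.+1).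

(* Main.v *)
From HB Require Import structures.
From mathcomp Require Import all_boot all_order all_algebra all_fingroup.
From mathcomp Require Import boolp reals.
From mathcomp Require Import ring lra zify.
Require Import Defs.

Set Implicit Arguments.
Unset Strict Implicit.
Unset Printing Implicit Defensive.

Import Order.TTheory GRing.Theory Num.Theory.

Local Open Scope ring_scope.

(** Attaching a caret to leaf [i] of the second tree of a pair and a caret of the
    same type to leaf [p i] of the first does not change the map
    ([tree_pair_expand]). Everything rests on two facts about trees.

    A y-caret with a y-caret on its left leg cuts an interval like an x-caret with
    an x-caret on its right leg. Write [tree_eq] for the congruence generated by
    this. Any tree can be refined to one with a root of prescribed type
    ([reroot]), so two trees have a common refinement up to [tree_eq]
    ([common_refinement]), and trees with the same leaves are [tree_eq]
    ([depths_inj]).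

    Lists of powers of [tau] with the same sum have a common refinement by trees
    ([weight_eq_coterminal]): cut all pieces down to two consecutive powers, whose
    numbers are then determined by the irrationality of [tau], and exchange
    neighbours of different lengths, as both orders cut one interval. Hence a
    subdivision of the unit interval into such pieces refines to that of a tree,
    and every element of the group is given by a tree pair ([vtau_tree_pair]).

    Let S be the spine with as many leaves as T1 and T2. The pair of T1, p, T2 is
    the product of the pairs of T1, 1, S, of S, p, S and of S, 1, T2. Attaching
    a caret to leaf [i] of the spine with [m] carets gives [x_i] or [y_i] when
    [i < m], and 1 or the inverse of [y_m] on the last leaf ([caret_val]). The
    permutations of the leaves of a spine are generated by the [pi_i] and [c_n].
    So the generators generate, and the expansion of tree pairs yields the
    relations ([vtau_relP]).

    Conversely, let [G] be a group with elements satisfying the relations. Those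
    between the [x_i] and [y_i] make the product [tree_val T] of the carets of a
    tree independent of the order of attachment and of the choice of [T] up to
    [tree_eq]. Those between the [pi_i] and [c_n] contain the Coxeter relations,
    where the transposition of the last two leaves is a conjugate of some [pi_i] by
    [c_n] ([transp_coxeter]); this gives the image [sigma p] of a permutation.
    The others say how permutations move past carets ([compatible_all]). Therefore
    [tree_val T1 * sigma p * (tree_val T2)^-1] is invariant under expansion, and
    the elements of [G] and of the group of maps given by the same tree pairs
    correspond compatibly with products ([representsM]). A tree pair giving the
    identity map has [p = 1] and T1, T2 [tree_eq] ([tree_pair_eq1]), so only 1
    corresponds to the identity. Taking for [G] the presented group, a word trivial
    in the group of maps is trivial in [G]. *)

(** * Trees up to refinement *)

Local Open Scope nat_scope.

Inductive tree_eq : tree -> tree -> Prop :=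
| tree_eq_refl T : tree_eq T T
| tree_eq_sym T U : tree_eq T U -> tree_eq U T
| tree_eq_trans T U V : tree_eq T U -> tree_eq U V -> tree_eq T V
| tree_eq_node d l l' r r' :
    tree_eq l l' -> tree_eq r r' -> tree_eq (Node d l r) (Node d l' r')
| tree_eq_swap a b c : tree_eq (Node ycaret (Node ycaret a b) c)
                               (Node xcaret a (Node xcaret b c)).

Lemma nleaves_gt0 T : 0 < nleaves T.
Proof. by elim: T => //= d l IHl r _; rewrite addn_gt0 IHl. Qed.

Lemma tree_eq_nleaves T U : tree_eq T U -> nleaves T = nleaves U.
Proof.
elim=> {T U} [//|T U _ ->//|T U V _ -> _ ->//|d l l' r r' _ /= -> _ ->//|a b c].
by rewrite /= addnA.
Qed.

Lemma attach_tree_eq e T U i : tree_eq T U -> tree_eq (attach e T i) (attach e U i).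
Proof.
move=> h; elim: h i => {T U} [T|T U _ IH|T U V _ IH1 _ IH2|d l l' r r' hl IHl hr IHr|a b c] i.
- exact: tree_eq_refl.
- exact: tree_eq_sym.
- exact: tree_eq_trans (IH1 i) (IH2 i).
- by rewrite /= (tree_eq_nleaves hl); case: ifP => _; exact: tree_eq_node.
rewrite /=; case: (ltnP i (nleaves a)) => ia.
  by rewrite (leq_trans ia) ?leq_addr //; exact: tree_eq_swap.
rewrite ltn_subLR // -subnDA; case: ifP => _; exact: tree_eq_swap.
Qed.

Lemma attach_left e d l r i : i < nleaves l ->
  attach e (Node d l r) i = Node d (attach e l i) r.
Proof. by move=> /= ->. Qed.

Lemma attach_right e d l r i :
  attach e (Node d l r) (nleaves l + i) = Node d l (attach e r i).
Proof. by rewrite /= ltnNge leq_addr /= addKn. Qed.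

Lemma attachC d e T i j : i < j -> j < nleaves T ->
  attach e (attach d T j) i = attach d (attach e T i) j.+1.
Proof.
elim: T i j => [|f l IHl r IHr] i j ij /=; first by case: j ij.
case: (ltnP j (nleaves l)) => jl jT /=.
  have il := ltn_trans ij jl.
  by rewrite il /= !nleaves_attach // (leqW il) ltnS jl IHl.
case: (ltnP i (nleaves l)) => il /=.
  by rewrite nleaves_attach // ifF ?subSS // ltnS ltnNge jl.
rewrite [j.+1 < _]ltnNge (leq_trans jl) //= subSn // IHr //.
  by rewrite ltn_sub2r // (leq_ltn_trans il).
by rewrite ltn_subLR.
Qed.

(** The first tree is obtained from the second by pruning at some carets. *)
Inductive refines : tree -> tree -> Prop :=
| refines_leaf T : refines Leaf T
| refines_node d l l' r r' :
    refines l l' -> refines r r' -> refines (Node d l r) (Node d l' r').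

Lemma refines_refl T : refines T T.
Proof. by elim: T => [|d l IHl r IHr]; constructor. Qed.

Lemma refines_trans T U V : refines T U -> refines U V -> refines T V.
Proof.
move=> h; elim: h V => [U' V _|d l l' r r' _ IHl _ IHr V h]; first by constructor.
by inversion h; subst; constructor; [exact: IHl | exact: IHr].
Qed.

(** A refinement is reached by attaching carets one at a time, from the root
    downwards. *)
Lemma refines_attach_closed (Q : tree -> Prop) T T' :
  (forall d U i, i < nleaves U -> Q U -> Q (attach d U i)) ->
  refines T T' -> Q T -> Q T'.
Proof.
have left (P : tree -> Prop) d r :
    (forall e U i, i < nleaves U -> P U -> P (attach e U i)) ->
    forall e U i, i < nleaves U -> P (Node d U r) -> P (Node d (attach e U i) r).
  by move=> hP e U i iU /(hP e _ i); rewrite attach_left //; apply; rewrite /= ltn_addr.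
have right (P : tree -> Prop) d l :
    (forall e U i, i < nleaves U -> P U -> P (attach e U i)) ->
    forall e U i, i < nleaves U -> P (Node d l U) -> P (Node d l (attach e U i)).
  move=> hP e U i iU /(hP e _ (nleaves l + i)); rewrite attach_right; apply.
  by rewrite ltn_add2l.
move=> hQ h; elim: h Q hQ => {T T'} [T|d l l' r r' _ IHl _ IHr] Q hQ.
  elim: T Q hQ => [//|d l IHl r IHr] Q hQ QL.
  apply: (IHl (fun t => Q (Node d t r))); first exact: left.
  by apply: (IHr (fun t => Q (Node d Leaf t))); [exact: right | exact: (hQ d Leaf 0)].
move=> Qlr; apply: (IHl (fun t => Q (Node d t r'))); first exact: left.
by apply: (IHr (fun t => Q (Node d l t))) => //; exact: right.
Qed.

Lemma refines_attach d T i : refines T (attach d T i).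
Proof.
elim: T i => [|e l IHl r IHr] i /=; first exact: refines_leaf.
by case: ifP => _; constructor => //; exact: refines_refl.
Qed.

Lemma refines_tree_eq T T' U : refines T T' -> tree_eq T U ->
  exists2 U', refines U U' & tree_eq T' U'.
Proof.
move=> h TU; pose Q S := exists2 U', refines U U' & tree_eq S U'.
apply: (@refines_attach_closed Q T) => //; last by exists U => //; exact: refines_refl.
move=> d S i _ [U' UU' SU']; exists (attach d U' i).
  exact: refines_trans UU' (refines_attach _ _ _).
exact: attach_tree_eq.
Qed.

(** The relation between a y-caret with a y-caret on its left leg and an
    x-caret with an x-caret on its right leg lets the root type be chosen. *)
Lemma reroot d T : exists T' l r, refines T T' /\ tree_eq T' (Node d l r).
Proof.
elim: T d => [|e l IHl r IHr] d.
  by exists (Node d Leaf Leaf), Leaf, Leaf; split; constructor.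
case: d; case: e.
- by exists (Node xcaret l r), l, r; split; [exact: refines_refl | constructor].
- have [l' [a [b [ll' l'E]]]] := IHl ycaret.
  exists (Node ycaret l' r), a, (Node xcaret b r); split.
    by constructor => //; exact: refines_refl.
  apply: tree_eq_trans (tree_eq_swap _ _ _); constructor => //; exact: tree_eq_refl.
- have [r' [a [b [rr' r'E]]]] := IHr xcaret.
  exists (Node xcaret l r'), (Node ycaret l a), b; split.
    by constructor => //; exact: refines_refl.
  apply: tree_eq_trans (tree_eq_sym (tree_eq_swap _ _ _)).
  by constructor => //; exact: tree_eq_refl.
- by exists (Node ycaret l r), l, r; split; [exact: refines_refl | constructor].
Qed.

(** Give [T] the root type of [S], then refine both children. *)
Lemma common_refinement S T :
  exists S' T', [/\ refines S S', refines T T' & tree_eq S' T'].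
Proof.
elim: S T => [|d s1 IH1 s2 IH2] T.
  by exists T, T; split; [exact: refines_leaf | exact: refines_refl | exact: tree_eq_refl].
have [T1 [l [r [TT1 T1E]]]] := reroot d T.
have [s1' [l' [h1 h1' e1]]] := IH1 l.
have [s2' [r' [h2 h2' e2]]] := IH2 r.
have hlr : refines (Node d l r) (Node d l' r') by constructor.
have [T2 T1T2 e] := refines_tree_eq hlr (tree_eq_sym T1E).
exists (Node d s1' s2'), T2; split; first by constructor.
  exact: refines_trans TT1 T1T2.
by apply: tree_eq_trans e; constructor.
Qed.

(** * Lengths of leaves *)

(** The exponents of [tau] in the lengths of the leaves of a tree whose root
    has length [tau ^+ k]. *)
Fixpoint depths (T : tree) (k : nat) : seq nat :=
  match T with
  | Leaf => [:: k]
  | Node xcaret l r => depths l k.+2 ++ depths r k.+1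
  | Node ycaret l r => depths l k.+1 ++ depths r k.+2
  end.

Lemma size_depths T k : size (depths T k) = nleaves T.
Proof. by elim: T k => [|[] l IHl r IHr] k //=; rewrite size_cat IHl IHr. Qed.

Lemma tree_eq_depths T U k : tree_eq T U -> depths T k = depths U k.
Proof.
move=> h; elim: h k => {T U} [//|T U _ IH k|T U V _ IH1 _ IH2 k|[] l l' r r' _ IHl _ IHr k|a b c k] /=.
- by rewrite IH.
- by rewrite IH1 IH2.
- by rewrite IHl IHr.
- by rewrite IHl IHr.
- by rewrite catA.
Qed.

(** Cutting each piece of a subdivision by a tree. Only the exponents of the
    lengths are recorded, in their order, since the first left end determines the
    positions. *)
Inductive expansion : seq nat -> seq nat -> Prop :=
| expansion_nil : expansion [::] [::]
| expansion_cons k T D E : expansion D E -> expansion (k :: D) (depths T k ++ E).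

Lemma expansion_refl D : expansion D D.
Proof. by elim: D => [|k D]; [exact: expansion_nil | exact: (@expansion_cons k Leaf)]. Qed.

Lemma expansion_cat D D' E E' :
  expansion D E -> expansion D' E' -> expansion (D ++ D') (E ++ E').
Proof.
by move=> h h'; elim: h => //= k T D0 E0 _; rewrite -catA; exact: expansion_cons.
Qed.

Lemma expansion_cat_inv D1 D2 E : expansion (D1 ++ D2) E ->
  exists E1 E2, [/\ E = E1 ++ E2, expansion D1 E1 & expansion D2 E2].
Proof.
elim: D1 E => [|k D1 IH] E /=; first by exists [::], E; split=> //; constructor.
move=> h; inversion h as [|k' T D' E' h' e1 e2]; subst.
have [E1 [E2 [-> h1 h2]]] := IH _ h'.
by exists (depths T k ++ E1), E2; rewrite catA; split=> //; constructor.
Qed.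

Lemma expansion_seq1 k E : expansion [:: k] E -> exists T, E = depths T k.
Proof.
by move=> h; inversion h as [|k' T D' E' h' e1 e2]; subst; inversion h'; exists T; rewrite cats0.
Qed.

Lemma expansion1 T k : expansion [:: k] (depths T k).
Proof. by rewrite -[depths T k]cats0; constructor; constructor. Qed.

Lemma expansion_depths T k E : expansion (depths T k) E -> exists T', E = depths T' k.
Proof.
elim: T k E => [|[] l IHl r IHr] k E; first exact: expansion_seq1.
- move=> /expansion_cat_inv[E1 [E2 [-> /IHl[l' ->] /IHr[r' ->]]]].
  by exists (Node xcaret l' r').
- move=> /expansion_cat_inv[E1 [E2 [-> /IHl[l' ->] /IHr[r' ->]]]].
  by exists (Node ycaret l' r').
Qed.

Lemma expansion_trans D E F : expansion D E -> expansion E F -> expansion D F.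
Proof.
move=> h; elim: h F => {D E} [F //|k T D E _ IH F].
by move=> /expansion_cat_inv[F1 [F2 [-> /expansion_depths[T' ->] /IH]]]; constructor.
Qed.

Lemma refines_expansion T T' k : refines T T' -> expansion (depths T k) (depths T' k).
Proof.
move=> h; elim: h k => [U|[] l l' r r' _ IHl _ IHr] k /=; first exact: expansion1.
- exact: expansion_cat.
- exact: expansion_cat.
Qed.

(** Two cuttings of one piece are two trees, which have a common refinement. *)
Lemma expansion_confluent D E F : expansion D E -> expansion D F ->
  exists2 G, expansion E G & expansion F G.
Proof.
move=> h; elim: h F => {D E} [F h|k T D E _ IH F h].
  by inversion h; exists [::]; exact: expansion_nil.
inversion h as [|k' U D' F' h' e1 e2]; subst.
have [G EG FG] := IH _ h'.
have [T' [U' [TT' UU' e]]] := common_refinement T U.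
exists (depths T' k ++ G); apply: expansion_cat => //; first exact: refines_expansion.
by rewrite (tree_eq_depths k e); exact: refines_expansion.
Qed.

Definition coterminal D D' := exists2 E, expansion D E & expansion D' E.

Lemma coterminal_refl D : coterminal D D.
Proof. by exists D; exact: expansion_refl. Qed.

Lemma coterminal_sym D D' : coterminal D D' -> coterminal D' D.
Proof. by case=> E h h'; exists E. Qed.

Lemma coterminal_trans D E F : coterminal D E -> coterminal E F -> coterminal D F.
Proof.
move=> [A DA EA] [B EB FB]; have [G AG BG] := expansion_confluent EA EB.
by exists G; [exact: expansion_trans AG | exact: expansion_trans BG].
Qed.

Lemma coterminal_cat D D' E E' :
  coterminal D D' -> coterminal E E' -> coterminal (D ++ E) (D' ++ E').
Proof. by move=> [A h1 h2] [B h3 h4]; exists (A ++ B); exact: expansion_cat. Qed.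

Lemma coterminal_caret d k : coterminal [:: k] (depths (Node d Leaf Leaf) k).
Proof. by exists (depths (Node d Leaf Leaf) k); [exact: expansion1 | exact: expansion_refl]. Qed.

(** The two orders are the leaves of an x-caret and of a y-caret on one interval;
    its subdivision into three pieces refines both. *)
Lemma coterminal_swap n : coterminal [:: n.+1; n] [:: n; n.+1].
Proof.
exists [:: n.+1; n.+2; n.+1].
  apply: (@expansion_cat [:: n.+1] [:: n] [:: n.+1] [:: n.+2; n.+1]).
    exact: expansion_refl.
  exact: (expansion1 (Node xcaret Leaf Leaf)).
apply: (@expansion_cat [:: n] [:: n.+1] [:: n.+1; n.+2] [:: n.+1]).
  exact: (expansion1 (Node ycaret Leaf Leaf)).
exact: expansion_refl.
Qed.

Lemma coterminal_sort_aux n p q :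
  coterminal (nseq q n.+1 ++ nseq p n) (nseq p n ++ nseq q n.+1).
Proof.
have one : forall m, coterminal (nseq m n.+1 ++ [:: n]) (n :: nseq m n.+1).
  elim=> [|m IH]; first exact: coterminal_refl.
  apply: (@coterminal_trans _ ([:: n.+1] ++ (n :: nseq m n.+1))).
    exact: (coterminal_cat (coterminal_refl [:: n.+1]) IH).
  exact: (coterminal_cat (coterminal_swap n) (coterminal_refl (nseq m n.+1))).
elim: p => [|p IH]; first by rewrite cats0; exact: coterminal_refl.
rewrite -[nseq p.+1 n]/([:: n] ++ nseq p n) catA.
apply: coterminal_trans (coterminal_cat (one q) (coterminal_refl _)) _.
exact: (coterminal_cat (coterminal_refl [:: n]) IH).
Qed.

Lemma coterminal_sort_cat n p q p' q' :
  coterminal ((nseq p n ++ nseq q n.+1) ++ (nseq p' n ++ nseq q' n.+1))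
    (nseq (p + p') n ++ nseq (q + q') n.+1).
Proof.
have -> : nseq (p + p') n ++ nseq (q + q') n.+1 =
    nseq p n ++ ((nseq p' n ++ nseq q n.+1) ++ nseq q' n.+1).
  by rewrite !nseqD -!catA.
rewrite -catA; apply: coterminal_cat; first exact: coterminal_refl.
rewrite catA; apply: coterminal_cat; last exact: coterminal_refl.
exact: coterminal_sort_aux.
Qed.

(** Both children of an interval of length [tau ^+ k], [k < n], have length at
    least [tau ^+ n.+1]; cutting as long as [k < n] leaves only these two
    lengths, and adjacent pieces of different lengths can be exchanged because
    both orders cut the same virtual interval. *)
Lemma coterminal_two_lengths1 n k : k <= n.+1 ->
  exists p q, coterminal [:: k] (nseq p n ++ nseq q n.+1).
Proof.
move=> kn; rewrite -(subKn kn); elim/ltn_ind: (_ - k) => j IH.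
case: j IH => [|[|j]] IH.
- by exists 0, 1; rewrite subn0; exact: coterminal_refl.
- by exists 1, 0; rewrite subn1; exact: coterminal_refl.
case: (leqP j.+2 n.+1) => jn; last first.
  by have := IH n.+1 jn; rewrite subnn (_ : n.+1 - j.+2 = 0) //; lia.
have [p [q h]] := IH j.+1 (ltnSn _); have [p' [q' h']] := IH j (ltnW (ltnSn _)).
exists (p + p'), (q + q'); apply: coterminal_trans (coterminal_sort_cat n p q p' q').
apply: coterminal_trans (coterminal_cat h h').
have -> : n.+1 - j = (n.+1 - j.+2).+2 by lia.
have -> : n.+1 - j.+1 = (n.+1 - j.+2).+1 by lia.
exact: (coterminal_caret ycaret).
Qed.

Lemma coterminal_two_lengths n D : all (fun k => k <= n.+1) D ->
  exists p q, coterminal D (nseq p n ++ nseq q n.+1).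
Proof.
elim: D => [|k D IH] /=; first by exists 0, 0; exact: coterminal_refl.
move=> /andP[/coterminal_two_lengths1[p [q h]] /IH[p' [q' h']]].
exists (p + p'), (q + q'); apply: coterminal_trans (coterminal_sort_cat n p q p' q').
exact: (coterminal_cat h h').
Qed.
Local Open Scope ring_scope.

Section Weights.
Variable R : realType.
Implicit Types (D E : seq nat) (T U : tree).

Lemma tauS k : tau ^+ k.+1 + tau ^+ k.+2 = tau ^+ k :> R.
Proof. by rewrite !exprSr -mulrA -mulrDr -expr2 tauE addrC subrK mulr1. Qed.

Definition weight D : R := \sum_(k <- D) tau ^+ k.

Lemma weight_nil : weight [::] = 0. Proof. exact: big_nil. Qed.

Lemma weight_cons k D : weight (k :: D) = tau ^+ k + weight D.
Proof. exact: big_cons. Qed.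

Lemma weight_cat D E : weight (D ++ E) = weight D + weight E.
Proof. exact: big_cat. Qed.

Lemma weight_nseq p n : weight (nseq p n) = p%:R * tau ^+ n.
Proof. by rewrite /weight big_nseq -[iter _ _ _]Monoid.iteropE /= mulr_natl. Qed.

Lemma weight_ge0 D : 0 <= weight D.
Proof. by apply: sumr_ge0 => k _; rewrite exprn_ge0 // ltW // tau_gt0. Qed.

Lemma weight_gt0 D : D != [::] -> 0 < weight D.
Proof.
case: D => // k D _; rewrite weight_cons ltr_pwDl ?weight_ge0 //.
by rewrite exprn_gt0 // tau_gt0.
Qed.

Lemma weight_depths T k : weight (depths T k) = tau ^+ k.
Proof.
elim: T k => [|[] l IHl r IHr] k /=; first by rewrite weight_cons weight_nil addr0.
- by rewrite weight_cat IHl IHr addrC tauS.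
- by rewrite weight_cat IHl IHr tauS.
Qed.

Lemma weight_expansion D E : expansion D E -> weight E = weight D.
Proof.
by elim=> {D E} [//|k T D E _ IH]; rewrite weight_cat weight_cons weight_depths IH.
Qed.

Lemma weight_coterminal D E : coterminal D E -> weight D = weight E.
Proof. by case=> F /weight_expansion <- /weight_expansion. Qed.

Lemma weight_prefix D D' E E' : D ++ D' = E ++ E' -> weight D <= weight E ->
  exists F, E = D ++ F.
Proof.
elim: D E => [|k D IH] [|m E] //=; try by [exists [::] | exists (m :: E)].
  move=> _; rewrite weight_nil => h.
  by have := lt_le_trans (@weight_gt0 (k :: D) isT) h; rewrite ltxx.
by case=> <- /IH h; rewrite !weight_cons lerD2l => /h[F ->]; exists F.
Qed.

Lemma weight_prefix_eq D D' E E' : D ++ D' = E ++ E' -> weight D = weight E ->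
  D = E /\ D' = E'.
Proof.
move=> e h; have [|F EF] := weight_prefix e; first by rewrite h.
move: h e; rewrite EF weight_cat -[X in X = _]addr0 => /addrI; case: F EF => [|k F] EF.
  by rewrite cats0 => _ /eqP; rewrite eqseq_cat // => /andP[_ /eqP].
by move=> h; have := @weight_gt0 (k :: F) isT; rewrite -h ltxx.
Qed.

Definition caret_depth d k : nat := if d is xcaret then k.+2 else k.+1.

(** If the cut point of a caret of type [d] on the root is an endpoint of a
    leaf, the tree can be rewritten to have a root of type [d]: when the root
    has the other type, the cut point sits in one of its children exactly where
    the swap relation needs it. *)
Lemma root_of_cut d T k D D' : depths T k = D ++ D' ->
  weight D = tau ^+ caret_depth d k -> exists l r, tree_eq T (Node d l r).
Proof.
have t0 := tau_gt0 R; have t1 := tau_lt1 R.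
have lt1 n : tau ^+ n.+1 < tau ^+ n :> R by rewrite exprS gtr_pMl // exprn_gt0.
elim: T d k D D' => [|e l IHl r IHr] d k D D' /=.
  have clt : tau ^+ caret_depth d k < tau ^+ k :> R.
    by case: d => /=; [exact: lt_trans (lt1 _) (lt1 _) | exact: lt1].
  case: D => [|m D] [] //.
    by rewrite weight_nil => _ /eqP; rewrite lt_eqF // exprn_gt0.
  move=> <-; case: D => // _; rewrite weight_cons weight_nil addr0 => /eqP.
  by rewrite gt_eqF.
case: d; case: e => /=.
- by exists l, r; exact: tree_eq_refl.
- move=> e h; have [|F lF] := @weight_prefix D D' _ _ (esym e).
    by rewrite weight_depths h ltW.
  have [a [b lE]] := IHl ycaret _ _ _ lF h.
  exists a, (Node xcaret b r); apply: tree_eq_trans (tree_eq_swap _ _ _).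
  by constructor => //; exact: tree_eq_refl.
- move=> e h; have [|F DF] := @weight_prefix _ _ D D' e.
    by rewrite weight_depths h ltW.
  have hF : weight F = tau ^+ k.+3.
    by apply: (addrI (tau ^+ k.+2)); rewrite tauS -h DF weight_cat weight_depths.
  move: e; rewrite DF -catA => /eqP; rewrite eqseq_cat // eqxx /= => /eqP rF.
  have [a [b rE]] := IHr xcaret _ _ _ rF hF.
  exists (Node ycaret l a), b; apply: tree_eq_trans (tree_eq_sym (tree_eq_swap _ _ _)).
  by constructor => //; exact: tree_eq_refl.
- by exists l, r; exact: tree_eq_refl.
Qed.

(** By [root_of_cut] the second tree can be given the root type of the first; the
    weights then separate the leaves of the two children. *)
Lemma depths_inj T U k : depths T k = depths U k -> tree_eq T U.
Proof.
elim: T U k => [|d l IHl r IHr] U k.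
  case: U => [_|d l r /(congr1 size)]; first exact: tree_eq_refl.
  rewrite !size_depths /=; have := nleaves_gt0 l; have := nleaves_gt0 r; lia.
have [k' lrE] : exists k', depths (Node d l r) k =
    depths l (caret_depth d k) ++ depths r k'.
  by case: d; eexists.
rewrite lrE => e.
have [l' [r' UE]] := root_of_cut (esym e) (weight_depths _ _).
 apply: tree_eq_trans (tree_eq_sym UE).
move: e lrE; rewrite (tree_eq_depths k UE); case: {UE}d => /= e lrE.
  have [] := weight_prefix_eq (etrans lrE e); first by rewrite !weight_depths.
  by move=> /IHl h1 /IHr h2; constructor.
have [] := weight_prefix_eq (etrans lrE e); first by rewrite !weight_depths.
by move=> /IHl h1 /IHr h2; constructor.
Qed.

(** ** Elements of Z[tau] as sums of powers of tau *)

(** A relation would give [(2 * a - b) ^+ 2 = 5 * b ^+ 2], where the exponents of 5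
    have different parities. *)
Lemma tau_irrational (a b : int) : a%:~R + b%:~R * tau = 0 :> R -> a = 0 /\ b = 0.
Proof.
move=> h; suff b0 : b = 0.
  by move: h; rewrite b0 mul0r addr0 => /eqP; rewrite intr_eq0 => /eqP.
have /eqP : ((2 * a - b) ^+ 2)%:~R = (5 * b ^+ 2)%:~R :> R.
  rewrite !(rmorphXn, rmorphM, rmorphB) /=.
  have -> : a%:~R = - (b%:~R * tau) :> R by apply/eqP; rewrite -addr_eq0 h.
  have := tauE R; move: tau => t ht.
  transitivity (b%:~R ^+ 2 * (4 * (t ^+ 2) + 4 * t + 1)); first by ring.
  by rewrite ht; ring.
rewrite eqr_int => /eqP /(congr1 absz); rewrite abszM !abszX.
set u := `|_|%N; set v := `|b|%N => e; apply/eqP; rewrite -absz_eq0 -/v.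
apply/negPn/negP; rewrite -lt0n => v0.
have := congr1 (logn 5) e.
rewrite lognM ?expn_gt0 ?v0 // !lognX (@logn_prime 5 5 isT) => {}e; lia.
Qed.

Lemma weight_two_lengths_inj n p q p' q' :
  weight (nseq p n ++ nseq q n.+1) = weight (nseq p' n ++ nseq q' n.+1) ->
  p = p' /\ q = q'.
Proof.
rewrite !weight_cat !weight_nseq => h.
have [|a0 b0] := @tau_irrational (p%:Z - p'%:Z) (q%:Z - q'%:Z); last by split; lia.
have tn : tau ^+ n != 0 :> R by rewrite expf_neq0 // tau_neq0.
apply: (mulIf tn); rewrite mul0r !rmorphB /= -!pmulrn.
move/eqP: h; rewrite exprS -subr_eq0 => /eqP h; rewrite -[RHS]h; ring.
Qed.

(** Two lists of lengths with the same sum refine to lists using only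
    [tau ^+ n] and [tau ^+ n.+1], with the same numbers of each because [tau] is
    irrational. *)
Lemma weight_eq_coterminal D E : weight D = weight E -> coterminal D E.
Proof.
move=> h; pose n := \max_(k <- D ++ E) k.
have hn : all (fun k => k <= n.+1)%N (D ++ E).
  by apply/allP => k kD; apply: leqW; rewrite /n; exact: leq_bigmax_seq.
move: hn; rewrite all_cat => /andP[hD hE].
have [p [q DE]] := coterminal_two_lengths hD.
have [p' [q' EE]] := coterminal_two_lengths hE.
have [] := @weight_two_lengths_inj n p q p' q'.
  by rewrite -(weight_coterminal DE) -(weight_coterminal EE).
by move=> ep eq; rewrite ep eq in DE; exact: coterminal_trans DE (coterminal_sym EE).
Qed.

(** Since [a + b * tau = tau * ((a + b) + a * tau)], coefficients of opposite signs
    can be replaced by smaller ones or by two nonnegative ones. *)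
Lemma Ztau_weight (x : R) : Ztau x -> 0 <= x -> exists D, x = weight D.
Proof.
have t0 := tau_gt0 R.
have tauM D : exists D', tau * weight D = weight D'.
  exists (map S D); rewrite /weight big_map mulr_sumr.
  by apply: eq_bigr => k _; rewrite exprS.
have step (a b : int) : a%:~R + b%:~R * tau = tau * ((a + b)%:~R + a%:~R * tau) :> R.
  have := tauE R; rewrite rmorphD /=; move: tau a%:~R b%:~R => t u v ht.
  by transitivity (u * (t + t ^+ 2) + v * t); [rewrite ht | ]; ring.
have pos (a b : int) : 0 <= a -> 0 <= b -> exists D, a%:~R + b%:~R * tau = weight D.
  case: a b => [p|p] [q|q] // _ _; exists (nseq p 0%N ++ nseq q 1%N).
  by rewrite weight_cat !weight_nseq expr0 mulr1 expr1 !pmulrn.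
have neg (a b : int) : a <= 0 -> b <= 0 -> 0 <= a%:~R + b%:~R * tau :> R ->
    exists D, a%:~R + b%:~R * tau = weight D.
  move=> a0 b0 h; exists [::]; rewrite weight_nil; apply/eqP; rewrite eq_le h andbT.
  by rewrite -[leRHS]addr0 lerD ?lerz0 // mulr_le0_ge0 ?lerz0 // ltW.
move=> [a [b ->]]; have [n] := ubnP (`|a| + `|b|)%N.
elim: n a b => // n IH a b lt h.
have [/andP[a0 b0]|] := boolP ((0 <= a) && (0 <= b)); first exact: pos.
have [/andP[a0 b0] _|nneg npos] := boolP ((a <= 0) && (b <= 0)); first exact: neg.
have h' : 0 <= (a + b)%:~R + a%:~R * tau :> R by rewrite step pmulr_rge0 in h.
suff [D DE] : exists D, (a + b)%:~R + a%:~R * tau = weight D by rewrite step DE.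
have [/andP[a0 b0]|] := boolP ((0 <= a + b) && (0 <= a)); first exact: pos.
have [/andP[a0 b0] _|nneg' npos'] := boolP ((a + b <= 0) && (a <= 0)); first exact: neg.
by apply: IH => //; lia.
Qed.

(** ** Trees containing a given interval *)

Fixpoint tiles (a : R) D : seq (R * R) :=
  if D is k :: D' then (a, a + tau ^+ k) :: tiles (a + tau ^+ k) D' else [::].

Lemma tiles_cat a D E : tiles a (D ++ E) = tiles a D ++ tiles (a + weight D) E.
Proof.
elim: D a => [|k D IH] a /=; first by rewrite weight_nil addr0.
by rewrite IH weight_cons addrA.
Qed.

Lemma leaves_tiles T k a : leaves T a (a + tau ^+ k) = tiles a (depths T k).
Proof.
elim: T a k => [|d l IHl r IHr] a k //=.
rewrite [_ - a]addrC addKr.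
have -> : cut R d * tau ^+ k = tau ^+ caret_depth d k.
  by case: d; rewrite /= -?exprD ?exprS ?addSn ?add0n.
rewrite IHl.
have -> : a + tau ^+ k = a + tau ^+ caret_depth d k
    + tau ^+ caret_depth (if d is xcaret then ycaret else xcaret) k.
  by rewrite -addrA -(tauS k); case: (d) => //=; rewrite [tau ^+ _.+2 + _]addrC.
by rewrite IHr; case: (d) => /=; rewrite tiles_cat weight_depths.
Qed.

Lemma leaves_depths T : leaves T 0 1 = tiles 0 (depths T 0).
Proof. by rewrite -leaves_tiles add0r expr0. Qed.

Lemma tree_eq_leaves T U : tree_eq T U -> leaves T 0 1 = leaves U 0 1 :> seq (R * R).
Proof. by rewrite !leaves_depths => /tree_eq_depths->. Qed.

Lemma tiles_inj a D E : tiles a D = tiles a E -> D = E.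
Proof.
elim: D a E => [|k D IH] a [|m E] //= [/addrI h].
have -> : k = m by apply: (ieexprIn (tau_gt0 R)); rewrite // lt_eqF // tau_lt1.
by move=> /IH ->.
Qed.

Lemma leaves_inj T U : leaves T 0 1 = leaves U 0 1 :> seq (R * R) -> tree_eq T U.
Proof. by rewrite !leaves_depths => /tiles_inj; exact: depths_inj. Qed.

(** Fill the complement of the interval in the unit interval with pieces whose
    lengths are powers of [tau], and refine the resulting subdivision to that of a
    tree. *)
Lemma tree_containing (a b : R) k : 0 <= a -> b <= 1 -> Ztau a -> b = a + tau ^+ k ->
  exists T F pre post, leaves T 0 1 = pre ++ leaves F a b ++ post.
Proof.
move=> a0 b1 aZ bE.
have bZ : Ztau b by rewrite bE; apply: ZtauD => //; exact: (ZtauX R k).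
have [D DE] := Ztau_weight aZ a0.
have [|E EE] := @Ztau_weight (1 - b) (ZtauB (Ztau1 R) bZ); first by rewrite subr_ge0.
have [|A h0 h] := @weight_eq_coterminal [:: 0%N] (D ++ [:: k] ++ E).
  rewrite !weight_cat !weight_cons weight_nil -DE -EE expr0 bE; ring.
have [T AT] := expansion_seq1 h0.
have [D' [B [AD DD' /expansion_cat_inv[K [E' [BE /expansion_seq1[F KF] _]]]]]] :=
  expansion_cat_inv h.
exists T, F, (tiles 0 D'), (tiles (b) E').
rewrite leaves_depths -AT AD BE KF !tiles_cat weight_depths (weight_expansion DD') -DE add0r.
by rewrite bE leaves_tiles.
Qed.

End Weights.
(** * Tree pairs *)

Section TreePairs.
Variable R : realType.
Implicit Types (T U F : tree) (J K : R * R).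

Lemma leaves_attach d T i (a b : R) : (i < nleaves T)%N ->
  let J := nth (0, 0) (leaves T a b) i in
  leaves (attach d T i) a b =
    take i (leaves T a b) ++ leaves (Node d Leaf Leaf) J.1 J.2 ++ drop i.+1 (leaves T a b).
Proof.
elim: T i a b => [|e l IHl r IHr] i a b; first by case: i.
set m : R := a + cut R e * (b - a).
have E (S U : tree) : leaves (Node e S U) a b = leaves S a m ++ leaves U m b by [].
move=> iT J; rewrite {}/J E; case: (ltnP i (nleaves l)) => il.
  rewrite attach_left // E IHl // takel_cat ?size_leaves; last exact: ltnW.
  rewrite nth_cat size_leaves il -!catA; congr (_ ++ (_ ++ _)).
  rewrite drop_cat size_leaves; case: ltnP => // li.
  have -> : i.+1 = nleaves l by apply/eqP; rewrite eqn_leq il.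
  by rewrite subnn drop0 drop_oversize // size_leaves.
rewrite -{1}(subnKC il) attach_right E IHr; last by rewrite ltn_subLR.
rewrite nth_cat take_cat drop_cat !size_leaves !ltnNge il (leqW il) /= subSn //.
by rewrite -!catA.
Qed.

Lemma leaf_attach_left d T i : (i < nleaves T)%N -> let J := leaf R T i in
  leaf R (attach d T i) i = (J.1, J.1 + cut R d * (J.2 - J.1)).
Proof.
move=> iT; rewrite /leaf leaves_attach // nth_cat size_takel ?size_leaves ?(ltnW iT) //.
by rewrite ltnn subnn.
Qed.

Lemma leaf_attach_bump d T i j : (i < nleaves T)%N -> (j < nleaves T)%N ->
  let J := leaf R T i in leaf R (attach d T i) (bump i j) =
    if j == i then (J.1 + cut R d * (J.2 - J.1), J.2) else leaf R T j.
Proof.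
move=> iT jT; rewrite /leaf leaves_attach // /bump /=.
rewrite nth_cat size_takel ?size_leaves ?(ltnW iT) //; case: (ltngtP i j) => ij /=.
- rewrite add1n ltnNge leqW ?(ltnW ij) //= subSn 1?ltnW //.
  rewrite (_ : j - i = (j - i.+1).+1)%N /=; last by lia.
  by rewrite nth_drop; congr nth; lia.
- by rewrite add0n ij nth_take.
- by rewrite ij add1n ltnNge leqnSn subSnn.
Qed.

Lemma leaves_sorted T (a b : R) : a < b -> sorted (fun J K => J.1 < K.1) (leaves T a b).
Proof.
have tr : transitive (fun J K : R * R => J.1 < K.1) by move=> ? ? ?; exact: lt_trans.
rewrite (sorted_pairwise tr); elim: T a b => //= d l IHl r IHr a b ab.
have [am mb _ _] := cutP d ab.
rewrite pairwise_cat IHl // IHr // !andbT; apply/allrelP => J K.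
move=> /(leavesP am)[_ h1 h2 _] /(leavesP mb)[h3 _ _ _].
exact: lt_le_trans h1 (le_trans h2 h3).
Qed.

Lemma mem_leaves T J : J \in leaves T 0 1 ->
  exists2 i, (i < nleaves T)%N & J = leaf R T i.
Proof. by move/(nthP (0, 0)) => [i]; rewrite size_leaves => iT <-; exists i. Qed.

Lemma leaf_mem T i : (i < nleaves T)%N -> leaf R T i \in leaves T 0 1.
Proof. by move=> iT; rewrite mem_nth // size_leaves. Qed.

Lemma leaf_right T i : (i < nleaves T)%N ->
  exists x : ioc01 R, val x = (leaf R T i).2 /\ (leaf R T i).1 < val x <= (leaf R T i).2.
Proof.
move=> /leafP-/(_ R)[h1 h2 h3 _].
have h : 0 < (leaf R T i).2 <= 1 by rewrite h3 (le_lt_trans h1 h2).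
by exists (exist _ (leaf R T i).2 h : ioc01 R); rewrite /= h2 lexx.
Qed.

(** The permutation obtained from [p] when its arrow from [i] to [p i] is
    doubled into two parallel ones. *)
Definition dup k (p : 'S_k) (i : 'I_k) : 'S_k.+1 :=
  lift_perm (widen_ord (leqnSn k) i) (widen_ord (leqnSn k) (p i)) p.

Lemma dup1 k (i : 'I_k) : dup 1 i = 1%g.
Proof. by rewrite /dup perm1 lift_perm1. Qed.

Lemma dupM k (p q : 'S_k) i : dup (p * q) i = (dup p i * dup q (p i))%g.
Proof. by rewrite /dup lift_permM permM. Qed.

Lemma affine_onto_sub (J K M : R * R) (x : R) : J.1 < J.2 -> M.1 < M.2 ->
  affine_onto M (affine_onto J K M.1, affine_onto J K M.2) x = affine_onto J K x.
Proof.
rewrite /affine_onto /= => hJ hM.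
have dJ : J.2 - J.1 != 0 by rewrite gt_eqF // subr_gt0.
have dM : M.2 - M.1 != 0 by rewrite gt_eqF // subr_gt0.
by field; rewrite dJ dM.
Qed.

Lemma affine_onto_cut (J K : R * R) (c : R) : J.1 < J.2 ->
  affine_onto J K (J.1 + c * (J.2 - J.1)) = K.1 + c * (K.2 - K.1).
Proof.
rewrite /affine_onto => hJ; have dJ : J.2 - J.1 != 0 by rewrite gt_eqF // subr_gt0.
by field.
Qed.

Lemma affine_onto_left (J K : R * R) : affine_onto J K J.1 = K.1.
Proof. by rewrite /affine_onto subrr mulr0 addr0. Qed.

Lemma affine_onto_right (J K : R * R) : J.1 < J.2 -> affine_onto J K J.2 = K.2.
Proof. by move=> hJ; rewrite /affine_onto mulfVK ?subrKC // gt_eqF // subr_gt0. Qed.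

Lemma tree_pair_expand k T1 T2 (p : 'S_k) (h1 : nleaves T1 = k) (h2 : nleaves T2 = k)
    d (i : 'I_k) (h1' : nleaves (attach d T1 (p i)) = k.+1)
    (h2' : nleaves (attach d T2 i) = k.+1) :
  tree_pair R p h1 h2 = tree_pair R (dup p i) h1' h2'.
Proof.
apply: vtau_eqP => x; apply: val_inj.
have iT : (i < nleaves T2)%N by rewrite h2.
have piT : (p i < nleaves T1)%N by rewrite h1.
have [_ lt1 _ _] := leafP R piT; have [_ lt2 _ _] := leafP R iT.
have [c1 c2 _ _] := cutP d lt2; have [c3 c4 _ _] := cutP d lt1.
have := fun i0 => @tree_pairE R k T1 T2 p h1 h2 i0 x.
have [j hj] := tree_pair_cover h2' x; rewrite (tree_pairE _ _ _ hj).
move: (val (tree_pair R p h1 h2 x)) => v vE; move: hj; rewrite /dup.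
case: (unliftP (widen_ord (leqnSn k) i) j) => [j0|] ->; last first.
  rewrite lift_perm_id /= !leaf_attach_left //= => /andP[x1 x2].
  rewrite (vE i) ?x1 ?(le_trans x2) ?ltW //.
  rewrite -(affine_onto_sub _ _ lt2 (M := ((leaf R T2 i).1, _)) c1) /=.
  by rewrite affine_onto_left affine_onto_cut.
rewrite lift_perm_lift /= !leaf_attach_bump ?h1 ?h2 //=.
rewrite !val_eqE (inj_eq perm_inj); case: eqP => _ hj; last exact: vE.
move: hj => /= /andP[x1 x2].
rewrite (vE i) ?x2 ?(lt_trans c1) //.
rewrite -(affine_onto_sub _ _ lt2 (M := (_, (leaf R T2 i).2)) c2) /=.
by rewrite affine_onto_cut // affine_onto_right.
Qed.

Lemma affine_onto_id (J K : R * R) : J.1 < J.2 -> 0 <= J.1 -> J.2 <= 1 ->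
  (forall x : ioc01 R, J.1 < val x <= J.2 -> affine_onto J K (val x) = val x) -> K = J.
Proof.
move=> hJ J0 J1 h.
have x2P : 0 < J.2 <= 1 by rewrite J1 (le_lt_trans J0).
have x1P : 0 < J.1 + 2^-1 * (J.2 - J.1) <= 1 by apply/andP; split; lra.
have := h (exist _ J.2 x2P : ioc01 R); rewrite /= hJ lexx affine_onto_right // => /(_ isT) e2.
have := h (exist _ (J.1 + 2^-1 * (J.2 - J.1)) x1P : ioc01 R); rewrite /= affine_onto_cut // => h'.
have {h'} e1 : K.1 + 2^-1 * (K.2 - K.1) = J.1 + 2^-1 * (J.2 - J.1).
  by apply: h'; apply/andP; split; lra.
by case: J K hJ {J0 J1 h x2P x1P} e1 e2 => [a b] [a' b'] /= hJ e1 e2; congr (_, _); lra.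
Qed.

(** The intervals of the leaves of both trees then coincide, and both lists are
    increasing. *)
Lemma tree_pair_eq1 k T1 T2 (p : 'S_k) h1 h2 : @tree_pair R k T1 p T2 h1 h2 = 1%g ->
  p = 1%g /\ tree_eq T1 T2.
Proof.
move=> e.
have lE (i : 'I_k) : leaf R T1 (p i) = leaf R T2 i.
  have [|l0 lt l1 _] := @leafP R T2 i; first by rewrite h2.
  by apply: affine_onto_id => // x hx; rewrite -(tree_pairE p h1 h2 hx) e.
have LE : leaves T1 0 1 = leaves T2 0 1 :> seq (R * R).
  apply: (@irr_sorted_eq _ (fun J K => J.1 < K.1)).
  - by move=> ? ? ?; exact: lt_trans.
  - by move=> ?; rewrite /= ltxx.
  - exact: leaves_sorted.
  - exact: leaves_sorted.
  move=> J; apply/idP/idP => /mem_leaves[i]; rewrite ?h1 ?h2 => ik ->.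
    have := lE ((p^-1)%g (Ordinal ik)); rewrite permKV /= => ->.
    by rewrite leaf_mem // h2.
  by have /= <- := lE (Ordinal ik); rewrite leaf_mem // h1.
split; last exact: leaves_inj LE.
apply/permP => i; rewrite perm1; apply: val_inj.
have i1 : (i < nleaves T1)%N by rewrite h1.
have [x [_ hx]] := leaf_right i1.
have xp : (leaf R T1 (p i)).1 < val x <= (leaf R T1 (p i)).2 by rewrite lE /leaf -LE.
by apply: leaf_disjoint xp hx; rewrite h1.
Qed.

Lemma tree_eq_pair k T1 T2 (h1 : nleaves T1 = k) (h2 : nleaves T2 = k) :
  tree_eq T1 T2 -> tree_pair R 1 h1 h2 = 1%g.
Proof.
move=> e; apply: vtau_eqP => x; apply: val_inj.
have [i hi] := tree_pair_cover h2 x; rewrite (tree_pairE _ _ _ hi) perm1.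
have [|_ lt _ _] := @leafP R T2 i; first by rewrite h2.
rewrite {2}/leaf (tree_eq_leaves R e) -/(leaf R T2 i) /affine_onto divff ?mul1r ?subrKC //.
by rewrite gt_eqF // subr_gt0.
Qed.

Lemma tree_pairV k T1 T2 (p : 'S_k) (h1 : nleaves T1 = k) (h2 : nleaves T2 = k) :
  ((tree_pair R p h1 h2)^-1 = tree_pair R p^-1 h2 h1)%g.
Proof.
apply: (mulgI (tree_pair R p h1 h2)).
by rewrite mulgV tree_pairM mulVg tree_eq_pair //; exact: tree_eq_refl.
Qed.

(** ** Every element is given by a tree pair *)

(** Distinct leaves of [T2] have distinct images and every leaf of [T1] is met, so
    the matching of leaves is a permutation. *)
Lemma tree_pair_of_leaves (f : Vtau R) T1 T2 :
  {in leaves T2 0 1, forall J, exists2 K, K \in leaves T1 0 1 &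
    forall x : ioc01 R, J.1 < val x <= J.2 -> val (f x) = affine_onto J K (val x)} ->
  exists k (p : 'S_k) (h1 : nleaves T1 = k) (h2 : nleaves T2 = k),
    f = tree_pair R p h1 h2.
Proof.
move=> H; have [[g gK fK] _ _] := vtauP f.
have : forall i : 'I_(nleaves T2), exists j : 'I_(nleaves T1), forall x : ioc01 R,
    (leaf R T2 i).1 < val x <= (leaf R T2 i).2 ->
    val (f x) = affine_onto (leaf R T2 i) (leaf R T1 j) (val x).
  move=> i; have [K /mem_leaves[j jT ->] h] := H _ (leaf_mem (ltn_ord i)).
  by exists (Ordinal jT).
move/choice => [q qE].
have q_in (i : 'I_(nleaves T2)) (x : ioc01 R) : (leaf R T2 i).1 < val x <= (leaf R T2 i).2 ->
    (leaf R T1 (q i)).1 < val (f x) <= (leaf R T1 (q i)).2.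
  move=> hx; rewrite (qE _ _ hx); apply: affine_onto_in => //.
    by have [] := leafP R (ltn_ord i).
  by have [] := leafP R (ltn_ord (q i)).
have q_inj : injective q.
  move=> i i' ii'.
  have [x [xE hx]] := leaf_right (ltn_ord i); have [x' [xE' hx']] := leaf_right (ltn_ord i').
  have [_ lt _ _] := leafP R (ltn_ord i); have [_ lt' _ _] := leafP R (ltn_ord i').
  have ff : f x = f x'.
    by apply: val_inj; rewrite (qE _ _ hx) (qE _ _ hx') xE xE' !affine_onto_right // ii'.
  rewrite -(can_inj gK ff) in hx'.
  by apply: val_inj; apply: leaf_disjoint hx hx'.
have q_surj (j : 'I_(nleaves T1)) : exists i, q i = j.
  have [y [_ hy]] := leaf_right (ltn_ord j).
  have [i iT hi] := leaf_cover T2 (g y).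
  have := q_in (Ordinal iT) (g y) hi; rewrite fK => hq.
  by exists (Ordinal iT); apply: val_inj; apply: leaf_disjoint hq hy.
have [r rK] := choice q_surj.
have e : nleaves T1 = nleaves T2.
  have := leq_card _ q_inj; have := leq_card _ (can_inj rK).
  by rewrite !card_ord => h1 h2; apply/eqP; rewrite eqn_leq h1.
have q'_inj : injective (cast_ord e \o q) by apply: inj_comp => //; exact: cast_ord_inj.
exists (nleaves T2), (perm q'_inj), e, erefl; apply: vtau_eqP => x; apply: val_inj.
have [i hi] := tree_pair_cover (erefl (nleaves T2)) x.
by rewrite (tree_pairE _ _ _ hi) permE (qE _ _ hi).
Qed.

Lemma graft_leaves (P : R * R -> Prop) T (a b : R) :
  {in leaves T a b, forall J, exists F, {in leaves F J.1 J.2, forall K, P K}} ->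
  exists T', {in leaves T' a b, forall K, P K}.
Proof.
elim: T a b => [|d l IHl r IHr] a b /= h.
  by have [|F hF] := h (a, b); [rewrite mem_seq1 | exists F].
have [J hJ|l' hl] := IHl a (a + cut R d * (b - a)).
  by apply: h; rewrite mem_cat hJ.
have [J hJ|r' hr] := IHr (a + cut R d * (b - a)) b.
  by apply: h; rewrite mem_cat hJ orbT.
by exists (Node d l' r') => K /=; rewrite mem_cat => /orP[/hl|/hr].
Qed.

Lemma refines_leaves T T' (a b : R) : refines T T' ->
  {in leaves T a b, forall J, exists F, {subset leaves F J.1 J.2 <= leaves T' a b}}.
Proof.
move=> h; elim: h a b => {T T'} [T|d l l' r r' _ IHl _ IHr] a b J /=.
  by rewrite mem_seq1 => /eqP->; exists T.
rewrite mem_cat => /orP[/IHl|/IHr] [F hF]; exists F => K /hF hK; rewrite mem_cat hK //.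
exact: orbT.
Qed.

(** The leaves of [T] inside [J] form a tree on [J]. *)
Definition contains T J := exists F, {subset leaves F J.1 J.2 <= leaves T 0 1}.

Lemma contains_refines T T' J : refines T T' -> contains T J -> contains T' J.
Proof.
move=> h [F hF]; apply: (@graft_leaves (fun K => K \in leaves T' 0 1) F) => K /hF.
exact: refines_leaves.
Qed.

Lemma contains_tree_eq T T' J : tree_eq T T' -> contains T J -> contains T' J.
Proof. by move=> h [F hF]; exists F => K /hF; rewrite (tree_eq_leaves R h). Qed.

(** A tree containing each of several intervals is a common refinement of trees
    containing one of them. *)
Lemma contains_all (s : seq (R * R)) :
  {in s, forall J, [/\ 0 <= J.1, J.2 <= 1, Ztau J.1 & exists k, J.2 = J.1 + tau ^+ k]} ->
  exists T, {in s, forall J, contains T J}.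
Proof.
elim: s => [|J s IH] h; first by exists Leaf.
have [K Ks|T hT] := IH; first by apply: h; rewrite inE Ks orbT.
have [J0 J1 JZ [k JE]] := h J (mem_head _ _).
have [U [F [pre [post UE]]]] := tree_containing J0 J1 JZ JE.
have [T' [U' [TT' UU' e]]] := common_refinement T U.
exists T' => K; rewrite inE => /orP[/eqP->|/hT]; last exact: contains_refines.
apply: (contains_tree_eq (tree_eq_sym e)); apply: contains_refines UU' _.
by exists F => M hM; rewrite UE !mem_cat hM orbT.
Qed.

Lemma leaves_affine (u v : R) T (a b : R) :
  leaves T (u * a + v) (u * b + v) =
  [seq (u * J.1 + v, u * J.2 + v) | J <- leaves T a b].
Proof.
elim: T a b => [|d l IHl r IHr] a b //=; rewrite map_cat -IHl -IHr.
suff -> : u * a + v + cut R d * (u * b + v - (u * a + v)) =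
  u * (a + cut R d * (b - a)) + v by [].
ring.
Qed.

Lemma leaves_right_end T (a b : R) : exists2 J, J \in leaves T a b & J.2 = b.
Proof.
elim: T a b => [|d l IHl r IHr] a b /=; first by exists (a, b); rewrite ?mem_seq1.
have [J Jr Jb] := IHr (a + cut R d * (b - a)) b.
by exists J => //; rewrite mem_cat Jr orbT.
Qed.

(** A tree containing some interval that ends at [q] has [q] as the right end of a
    leaf. *)
Lemma tree_avoiding (Q : seq R) : {in Q, forall q, 0 < q <= 1 /\ Ztau q} ->
  exists T, {in Q & leaves T 0 1, forall q J, ~~ (J.1 < q < J.2)}.
Proof.
move=> hQ.
have : forall q : R, exists a : R, q \in Q -> 0 <= a /\ exists k, q = a + tau ^+ k.
  move=> q; case: (boolP (q \in Q)) => [|_]; last by exists 0.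
  move=> /hQ[/andP[q0 q1] qZ]; have [D DE] := Ztau_weight qZ (ltW q0).
  case: D DE => [|k D]; first by rewrite weight_nil => h; rewrite h ltxx in q0.
  rewrite weight_cons addrC => DE; exists (weight R D) => _.
  by split; [exact: weight_ge0 | exists k].
move=> /choice[a ha].
have [J /mapP[q qQ ->] /=|T hT] := @contains_all [seq (a q, q) | q <- Q].
  have [a0 [k qE]] := ha _ qQ; have [/andP[_ q1] qZ] := hQ _ qQ.
  split=> //; last by exists k.
  have -> : a q = q - tau ^+ k by rewrite {2}qE addrK.
  by apply: ZtauB => //; exact: (ZtauX R k).
exists T => q J qQ JT; apply/negP => /andP[Jq qJ].
have [F hF] := hT (a q, q) (map_f (fun q => (a q, q)) qQ).
have [K /hF /mem_leaves[i iT KE] Kq] := leaves_right_end F (a q) q.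
have {}KE : (leaf R T i).2 = q by rewrite -KE.
have [j jT JE] := mem_leaves JT; rewrite JE in Jq qJ.
have ij : i = j.
  apply: (@leaf_disjoint R T q) => //; last by rewrite Jq ltW.
  by have [_ lt _ _] := leafP R iT; rewrite -KE lt lexx.
by rewrite -ij KE ltxx in qJ.
Qed.

Lemma tauX_le1 (k : int) : tau ^ k <= 1 :> R -> exists n : nat, k = n.
Proof.
case: k => n h; first by exists n.
move: h; rewrite NegzE -exprnN invf_le1 ?exprn_gt0 ?tau_gt0 // leNgt exprn_ilt1 ?tau_lt1 //.
by rewrite ltW // tau_gt0.
Qed.

(** Choose a tree whose leaves avoid the breakpoints of [f]; the image of each of
    its leaves is an interval as in [contains_all], and refining these images as in
    a single tree refines the leaves in the same way. *)
Lemma vtau_tree_pair (f : Vtau R) : exists k T1 T2 (p : 'S_k)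
  (h1 : nleaves T1 = k) (h2 : nleaves T2 = k), f = tree_pair R p h1 h2.
Proof.
have hf := vtauP f; have [Q [hQ hP]] := vtau_pieces hf.
have [T hT] := tree_avoiding hQ.
have : forall J : R * R, exists uv : R * R, J \in leaves T 0 1 ->
    [/\ 0 <= uv.1 * J.1 + uv.2, uv.1 * J.2 + uv.2 <= 1, Ztau (uv.1 * J.1 + uv.2),
      exists k : nat, uv.1 * J.2 + uv.2 = uv.1 * J.1 + uv.2 + tau ^+ k &
      forall x : ioc01 R, J.1 < val x <= J.2 -> val (f x) = uv.1 * val x + uv.2].
  move=> J; case: (boolP (J \in leaves T 0 1)) => [JT|_]; last by exists (0, 0).
  have [i iT JE] := mem_leaves JT.
  have [x [xE hx]] := leaf_right iT; have [q [r [k [c [/andP[qx xr] hp]]]]] := hP x.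
  have [_ rQ qr _ hk] := hp; rewrite -JE in hx xE; case/andP: hx => Jx xJ.
  have [J0 J12 J1 [j jE]] := leafP R iT; rewrite -JE in J0 J12 J1 jE.
  have qJ : q <= J.1.
    have [+ _ _ _ _] := hp; rewrite inE => /orP[/eqP->//|qQ].
    by have := hT _ _ qQ JT; rewrite -xE qx andbT -leNgt.
  have hfx (y : ioc01 R) : J.1 < val y <= J.2 -> val (f y) = tau ^ k * val y + c.
    move=> /andP[y1 y2]; apply: hk; rewrite (le_lt_trans qJ y1).
    by rewrite (le_trans y2) // -xE.
  have t0 := tauX_gt0 R k.
  have fxE : val (f x) = tau ^ k * J.2 + c by rewrite hfx ?xE // J12 lexx.
  have /andP[fx0 fx1] := valP (f x); rewrite fxE in fx0 fx1.
  have L0 : 0 <= tau ^ k * J.1 + c.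
    rewrite leNgt; apply/negP => L0; set z := - c / tau ^ k.
    have zE : tau ^ k * z = - c by rewrite mulrC divfK // gt_eqF.
    have z1 : J.1 < z by rewrite -(ltr_pM2l t0) zE; lra.
    have z2 : z < J.2 by rewrite -(ltr_pM2l t0) zE; lra.
    have z01 : 0 < z <= 1 by rewrite (le_lt_trans J0 z1) (le_trans (ltW z2)).
    have /andP[+ _] := valP (f (exist _ z z01 : ioc01 R)).
    by rewrite hfx /= ?z1 ?(ltW z2) // zE addNr ltxx.
  have LE : tau ^ k * J.2 + c = tau ^ k * J.1 + c + tau ^ (k + j).
    by rewrite expfzDr ?tau_neq0 // -jE; ring.
  have [|n nE] := @tauX_le1 (k + j); first by rewrite LE in fx1; lra.
  exists (tau ^ k, c); split=> //=; last by exists n; rewrite LE nE.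
  have -> : tau ^ k * J.1 + c = val (f x) - tau ^ (k + j) by rewrite fxE LE; ring.
  apply: ZtauB; last exact: ZtauX.
  by apply/(vtau_Ztau hf); rewrite xE JE; have [] := leaf_Ztau R iT.
move=> /choice[uv huv].
pose im J : R * R := ((uv J).1 * J.1 + (uv J).2, (uv J).1 * J.2 + (uv J).2).
have [K /mapP[J /huv[h1 h2 h3 h4 _] ->]//|U hU] := @contains_all (map im (leaves T 0 1)).
pose P M := exists2 N, N \in leaves U 0 1 &
  forall x : ioc01 R, M.1 < val x <= M.2 -> val (f x) = affine_onto M N (val x).
have [J JT|T' hT'] := @graft_leaves P T 0 1; last first.
  by have [k [p [h1 [h2 fE]]]] := tree_pair_of_leaves hT'; exists k, U, T', p, h1, h2.
have [F hF] := hU _ (map_f im JT); exists F => M MF.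
have [i iT JE] := mem_leaves JT; have [_ J12 _ _] := leafP R iT; rewrite -JE in J12.
have [m1 m2 m3 _] := leavesP J12 MF.
have [_ _ _ _ hx] := huv _ JT.
exists ((uv J).1 * M.1 + (uv J).2, (uv J).1 * M.2 + (uv J).2).
  by apply: hF; rewrite leaves_affine map_f.
move=> x /andP[x1 x2]; rewrite hx ?(le_lt_trans m1) ?(le_trans x2) //.
rewrite /affine_onto /=; field.
by rewrite subr_eq0 gt_eqF.
Qed.

End TreePairs.
(** * Permutations *)

(** The spine with [m] carets has [m.+1] leaves. *)
Definition adj m j : 'S_m.+1 := tperm (inord j) (inord j.+1).
Definition cyc m : 'S_m.+1 := perm (@ord_pred_inj m.+1).

Lemma adjE m j (i : 'I_m.+1) : (j < m)%N ->
  adj m j i = (if i == j :> nat then j.+1 else if i == j.+1 :> nat then j else i) :> nat.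
Proof.
move=> jm; have j1 : (j < m.+1)%N by exact: ltnW.
have e k : (k < m.+1)%N -> (i == inord k) = (i == k :> nat).
  by move=> km; rewrite -val_eqE /= inordK.
rewrite /adj permE /= !e //.
by case: eqP => _; [rewrite inordK | case: eqP => _; rewrite ?inordK].
Qed.

Lemma cycE m (i : 'I_m.+1) : cyc m i = (if i == 0%N :> nat then m else i.-1) :> nat.
Proof.
rewrite permE /=; case: i => [[|i] im] /=; first by rewrite modn_small.
by rewrite modnDr modn_small // ltnW.
Qed.

Lemma dup_diag k (p : 'S_k) (i : 'I_k) : dup p i (widen_ord (leqnSn k) i) = p i :> nat.
Proof. by rewrite /dup lift_perm_id. Qed.

Lemma dup_lift k (p : 'S_k) (i j : 'I_k) :
  dup p i (lift (widen_ord (leqnSn k) i) j) = bump (p i) (p j) :> nat.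
Proof. by rewrite /dup lift_perm_lift. Qed.

(* Innermost conditions first: the outer ones compare conditional values. *)
Ltac perm_nat :=
  repeat match goal with
  | |- context [if ?b then _ else _] =>
    lazymatch b with context [if _ then _ else _] => fail | _ => case: (boolP b) => ? end
  end; try lia.

Ltac perm_bump e := try lia; rewrite ?e /bump; perm_nat.

Lemma dup_permP k (p : 'S_k) (i : 'I_k) (q : 'S_k.+1) :
  (forall x : 'I_k.+1, x = i :> nat -> q x = p i :> nat) ->
  (forall (x : 'I_k.+1) (j : 'I_k), x = bump i j :> nat -> q x = bump (p i) (p j) :> nat) ->
  dup p i = q.
Proof.
move=> h1 h2; apply/permP => x; apply: val_inj.
case: (unliftP (widen_ord (leqnSn k) i) x) => [j|] ->.
  by rewrite /= dup_lift (h2 _ j).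
by rewrite /= dup_diag h1.
Qed.

Lemma dup_adj_lt m j (i : 'I_m.+1) : (j < m)%N -> (i < j)%N ->
  dup (adj m j) i = adj m.+1 j.+1.
Proof.
move=> jm ij; apply: dup_permP => [x e|x y e]; rewrite !adjE; perm_bump e.
Qed.

Lemma dup_adj_gt m j (i : 'I_m.+1) : (j < m)%N -> (j.+1 < i)%N ->
  dup (adj m j) i = adj m.+1 j.
Proof.
move=> jm ij; apply: dup_permP => [x e|x y e]; rewrite !adjE; perm_bump e.
Qed.

Lemma dup_adj_eq m j (i : 'I_m.+1) : (j < m)%N -> i = j :> nat ->
  dup (adj m j) i = (adj m.+1 j.+1 * adj m.+1 j)%g.
Proof.
move=> jm ij; apply: dup_permP => [x e|x y e]; rewrite permM !adjE; perm_bump e.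
Qed.

Lemma dup_adj_eqS m j (i : 'I_m.+1) : (j < m)%N -> i = j.+1 :> nat ->
  dup (adj m j) i = (adj m.+1 j * adj m.+1 j.+1)%g.
Proof.
move=> jm ij; apply: dup_permP => [x e|x y e]; rewrite permM !adjE; perm_bump e.
Qed.

Lemma dup_cyc0 m (i : 'I_m.+1) : i = 0%N :> nat -> dup (cyc m) i = (cyc m.+1 * cyc m.+1)%g.
Proof.
move=> i0; apply: dup_permP => [x e|x y e]; have := ltn_ord x; have := ltn_ord i; rewrite ?permM !cycE; perm_bump e.
Qed.

Lemma dup_cyc m (i : 'I_m.+1) : (0 < i)%N -> dup (cyc m) i = cyc m.+1.
Proof.
move=> i0; apply: dup_permP => [x e|x y e]; have := ltn_ord x; have := ltn_ord i; rewrite ?permM !cycE; perm_bump e.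
Qed.

Lemma adj_cyc m k : (0 < k < m)%N -> (adj m k * cyc m = cyc m * adj m k.-1)%g.
Proof.
move=> km; apply/permP => i; apply: val_inj.
rewrite /= !permM !(cycE, adjE) //; perm_nat.
Qed.

Lemma adj0_cyc2 m : (1 < m)%N ->
  (adj m 0 * (cyc m * cyc m) = cyc m * cyc m * adj m m.-1)%g.
Proof.
move=> m1; apply/permP => i; apply: val_inj; have im := ltn_ord i.
rewrite /= !permM !(cycE, adjE); perm_nat.
Qed.

Lemma cyc_prod m : cyc m = (\prod_(0 <= j < m) adj m j)%g.
Proof.
suff h n (i : 'I_m.+1) : (n <= m)%N -> (\prod_(0 <= j < n) adj m j)%g i =
    (if i == 0%N :> nat then n else if (i <= n)%N then i.-1 else i) :> nat.
  apply/permP => i; apply: val_inj; rewrite /= h // cycE; have := ltn_ord i.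
  by rewrite ltnS => ->.
elim: n => [|n IH] nm; first by rewrite big_geq // perm1; perm_nat.
rewrite big_nat_recr //= permM adjE // IH; last exact: ltnW.
perm_nat.
Qed.

Lemma cyc_order m : (cyc m ^+ m.+1 = 1)%g.
Proof.
suff h n (i : 'I_m.+1) : (n <= m.+1)%N ->
    (cyc m ^+ n)%g i = (if (i < n)%N then i + m.+1 - n else i - n)%N :> nat.
  by apply/permP => i; apply: val_inj; rewrite /= h // perm1 ltn_ord addnK.
elim: n => [|n IH] nm; first by rewrite expg0 perm1; perm_nat.
rewrite expgSr permM cycE IH; last exact: ltnW.
have := ltn_ord i; perm_nat.
Qed.

(** * The Coxeter presentation of the symmetric group *)

Section Coxeter.
Local Open Scope group_scope.

Definition coxeter (G : groupType) (s : nat -> G) N :=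
  [/\ forall j, (j < N)%N -> s j * s j = 1,
      forall j, (j.+1 < N)%N -> s j * s j.+1 * s j = s j.+1 * s j * s j.+1 &
      forall i j, (i.+1 < j)%N -> (j < N)%N -> s i * s j = s j * s i].

Lemma coxeterW (G : groupType) (s : nat -> G) M N :
  (M <= N)%N -> coxeter s N -> coxeter s M.
Proof.
move=> MN [h1 h2 h3]; split=> [j jM|j jM|i j ij jM].
- by apply: h1; exact: leq_trans MN.
- by apply: h2; exact: leq_trans MN.
- by apply: h3; last exact: leq_trans MN.
Qed.

Lemma coxeter_adj m : coxeter (adj m) m.
Proof.
split=> [j jm|j jm|i j ij jm]; apply/permP => x; apply: val_inj.
- by rewrite /adj tperm2.
- rewrite /= !permM !adjE //; try lia; perm_nat.
- rewrite /= !permM !adjE //; try lia; perm_nat.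
Qed.

Definition cox_val (G : groupType) (s : nat -> G) (w : seq nat) : G := \prod_(j <- w) s j.

Lemma cox_val_cat (G : groupType) (s : nat -> G) u v :
  cox_val s (u ++ v) = cox_val s u * cox_val s v.
Proof. exact: big_cat. Qed.

Lemma cox_val1 (G : groupType) (s : nat -> G) j : cox_val s [:: j] = s j.
Proof. exact: big_seq1. Qed.

Lemma cox_val_cons (G : groupType) (s : nat -> G) j w :
  cox_val s (j :: w) = s j * cox_val s w.
Proof. exact: big_cons. Qed.

Lemma cox_val_nil (G : groupType) (s : nat -> G) : cox_val s [::] = 1.
Proof. exact: big_nil. Qed.

(** The word [j + d - 1, ..., j + 1, j]; the corresponding permutation moves
    [j + d] down to [j]. *)
Fixpoint descent j d := if d is d'.+1 then (j + d')%N :: descent j d' else [::].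

Lemma descentSr j d : descent j d.+1 = descent j.+1 d ++ [:: j].
Proof. by elim: d => [|d IH] /=; rewrite ?addn0 // addSnnS -IH. Qed.

Lemma cox_val_comm (G : groupType) (s : nat -> G) N k w : coxeter s N ->
  (k < N)%N -> all (fun j => (j.+1 < k) || (k.+1 < j < N))%N w ->
  cox_val s w * s k = s k * cox_val s w.
Proof.
move=> [_ _ h] kN; elim: w => [|j w IH] /=; first by rewrite cox_val_nil mulg1 mul1g.
move=> /andP[hj hw]; rewrite cox_val_cons -mulgA IH // !mulgA.
by case/orP: hj => [jk|/andP[kj jN]]; [rewrite h | rewrite (h k j)].
Qed.

Lemma descent_mem j d k : k \in descent j d -> (j <= k < j + d)%N.
Proof. by elim: d => //= d IH; rewrite inE => /orP[/eqP->|/IH]; lia. Qed.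

(** The product of a descent is a cycle, which shifts the transpositions inside its
    support. *)
Lemma descent_shift (G : groupType) (s : nat -> G) N k j d : coxeter s N ->
  (j <= k)%N -> (k.+1 < j + d)%N -> (j + d <= N)%N ->
  cox_val s (descent j d) * s k.+1 = s k * cox_val s (descent j d).
Proof.
move=> hs jk kd dN; have [_ h2 h3] := hs.
elim: d kd dN => [|d IH] kd dN; first by lia.
move: kd; rewrite addnS ltnS leq_eqVlt => /orP[/eqP kE|kd]; last first.
  rewrite /= !cox_val_cons -mulgA IH //; last by lia.
  by rewrite !mulgA (h3 k (j + d)%N) //; lia.
case: d IH kE dN => [|d] _ kE dN; first by lia.
have {}kE : k = (j + d)%N by lia.
rewrite /= !cox_val_cons addnS -kE -!mulgA (cox_val_comm hs).
- by rewrite !mulgA h2 //; lia.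
- by lia.
by apply/allP => i /descent_mem; lia.
Qed.

(** Reading the word from the left, a letter [k] met after a descent from [N] to
    [j] lengthens it ([k + 1 = j]), shortens it ([k = j]), or is moved across it,
    which leaves a letter smaller than [N]. *)
Lemma cox_normal_form N w : all (fun j => j < N.+1)%N w ->
  exists w' j d, [/\ all (fun j => j < N)%N w', (j + d)%N = N.+1 &
    forall (G : groupType) (s : nat -> G), coxeter s N.+1 ->
      cox_val s w = cox_val s w' * cox_val s (descent j d)].
Proof.
elim/last_ind: w => [|w k IH].
  move=> _; exists [::], N.+1, 0%N; split; rewrite ?addn0 // => G s _.
  by rewrite /= !cox_val_nil mulg1.
rewrite all_rcons => /andP[kN /IH[w' [j [d [hw' jd h]]]]].
have E (G : groupType) (s : nat -> G) : coxeter s N.+1 ->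
    cox_val s (rcons w k) = cox_val s w' * (cox_val s (descent j d) * s k).
  by move=> hs; rewrite -cats1 cox_val_cat cox_val1 (h G s hs) mulgA.
have [kj|kj|kj] := ltngtP k.+1 j.
- exists (rcons w' k), j, d; split=> [|//|G s hs].
    by rewrite all_rcons hw' andbT; lia.
  rewrite E // (cox_val_comm hs) //; last by apply/allP => i /descent_mem; lia.
  by rewrite -cats1 cox_val_cat cox_val1 !mulgA.
- case: (ltngtP j k) => jk; last 1 first.
  + case: d jd h E => [|d] jd h E; first by lia.
    exists w', j.+1, d; split=> // [|G s hs]; first by lia.
    have [h1 _ _] := hs.
    by rewrite E // descentSr cox_val_cat cox_val1 jk -mulgA h1 ?mulg1 //; lia.
  + exists (rcons w' k.-1), j, d; split=> [|//|G s hs].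
      by rewrite all_rcons hw' andbT; lia.
    case: k kN jk {kj IH} E => // k kN jk E.
    rewrite E // (descent_shift hs) //; try lia.
    by rewrite -cats1 cox_val_cat cox_val1 !mulgA.
  + by lia.
- exists w', k, d.+1; split=> // [|G s hs]; first by lia.
  by rewrite E // descentSr kj cox_val_cat cox_val1.
Qed.

Lemma cox_val_adj_fix m N w (i : 'I_m.+1) : all (fun j => j < N)%N w -> (N <= m)%N ->
  (N < i)%N -> cox_val (adj m) w i = i.
Proof.
move=> + Nm Ni; elim: w => [|j w IH] /=; first by rewrite cox_val_nil perm1.
move=> /andP[jN /IH h]; rewrite cox_val_cons permM.
suff -> : adj m j i = i by [].
by apply: val_inj; rewrite /= adjE; [perm_nat | lia].
Qed.

Lemma descent_adj m j d (i : 'I_m.+1) : (j + d <= m)%N -> i = (j + d)%N :> nat ->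
  cox_val (adj m) (descent j d) i = j :> nat.
Proof.
elim: d i => [|d IH] i jd; first by rewrite cox_val_nil perm1 addn0.
move=> iE; rewrite cox_val_cons permM IH //; first by lia.
by rewrite adjE; [perm_nat | lia].
Qed.

(** A word in normal form whose permutation is trivial has an empty descent, as
    the permutation moves [N.+1] to the end of the descent. *)
Lemma cox_val_eq1 m N w (G : groupType) (s : nat -> G) : (N <= m)%N ->
  all (fun j => j < N)%N w -> cox_val (adj m) w = 1 -> coxeter s N -> cox_val s w = 1.
Proof.
elim: N w => [|N IH] w Nm hw e hs.
  by case: w hw {e} => // _; rewrite cox_val_nil.
have [w' [j [d [hw' jd h]]]] := cox_normal_form hw.
have hadj : coxeter (adj m) N.+1 := coxeterW Nm (coxeter_adj m).
move: e; rewrite (h _ _ hadj) (h _ _ hs).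
case: d jd {h} => [|d] jd; rewrite /= ?cox_val_nil ?mulg1 => e.
  by apply: IH => //; [exact: ltnW | exact: coxeterW hs].
have Nm' : (N.+1 < m.+1)%N by [].
have := congr1 (fun p : 'S_m.+1 => val (p (Ordinal Nm'))) e.
rewrite /= permM perm1 (cox_val_adj_fix hw') //; last exact: ltnW.
by rewrite -/(descent j d.+1) descent_adj //=; lia.
Qed.

(** Undo the image of [N.+1] by a descent and continue below. *)
Lemma adj_generate m N (p : 'S_m.+1) : (N <= m)%N ->
  (forall i : 'I_m.+1, (N < i)%N -> p i = i) ->
  exists2 w, all (fun j => j < N)%N w & cox_val (adj m) w = p.
Proof.
elim: N p => [|N IH] p Nm hp.
  exists [::] => //; rewrite cox_val_nil; apply/permP => i; rewrite perm1.
  have [i0|i0] := boolP (0 < i)%N; first by rewrite hp.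
  have [pi0|pi0] := boolP (0 < p i)%N.
    by have /perm_inj pii := hp _ pi0; rewrite pii in pi0; rewrite pi0 in i0.
  by apply: val_inj => /=; lia.
have Nm' : (N.+1 < m.+1)%N by [].
pose top := Ordinal Nm'; have jN : (p top <= N.+1)%N.
  rewrite leqNgt; apply/negP => lt; have /perm_inj e := hp _ lt.
  by rewrite e ltnn in lt.
pose t := descent (p top) (N.+1 - p top).
have jd : (p top + (N.+1 - p top) = N.+1)%N by rewrite subnKC.
have tt : all (fun k => k < N.+1)%N t by apply/allP => k /descent_mem; rewrite jd => /andP[].
have [i Ni|w hw wE] := IH (p * (cox_val (adj m) t)^-1) (ltnW Nm).
  rewrite permM; apply: (canLR (permK _)).
  move: Ni; rewrite leq_eqVlt => /orP[/eqP e|Ni]; last by rewrite hp ?(cox_val_adj_fix tt).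
  have -> : i = top by apply: val_inj.
  by apply: val_inj; rewrite /= descent_adj // jd.
exists (w ++ t); last by rewrite cox_val_cat wE mulgVK.
by rewrite all_cat tt andbT; apply: sub_all hw => k; exact: leqW.
Qed.

Lemma cox_val_rev (G : groupType) (s : nat -> G) N w : coxeter s N ->
  all (fun j => j < N)%N w -> cox_val s (rev w) = (cox_val s w)^-1.
Proof.
move=> [h _ _]; elim: w => [|j w IH] /=; first by rewrite !cox_val_nil invg1.
move=> /andP[jN /IH IHw]; rewrite rev_cons -cats1 cox_val_cat cox_val1 cox_val_cons IHw invgM.
by congr (_ * _); apply: (mulgI (s j)); rewrite h // mulgV.
Qed.

(** Products of permutations are composed from left to right, hence the reversal. *)
Lemma coxeter_presentation (G : groupType) (s : nat -> G) m : coxeter s m ->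
  exists sigma : 'S_m.+1 -> G, {morph sigma : p q / p * q >-> q * p} /\
    forall j, (j < m)%N -> sigma (adj m j) = s j.
Proof.
move=> hs; have hadj := coxeter_adj m.
have uniq u v : all (fun j => j < m)%N u -> all (fun j => j < m)%N v ->
    cox_val (adj m) u = cox_val (adj m) v -> cox_val s u = cox_val s v.
  move=> hu hv e; apply: (mulIg (cox_val s v)^-1).
  rewrite mulgV -(cox_val_rev hs hv) -cox_val_cat; apply: (cox_val_eq1 (m := m)) hs => //; first by rewrite all_cat all_rev hu.
  by rewrite cox_val_cat (cox_val_rev hadj hv) e mulgV.
have : forall p : 'S_m.+1, exists w, all (fun j => j < m)%N w /\ cox_val (adj m) w = p^-1.
  move=> p; have [i im|w hw wE] := @adj_generate m m p^-1 (leqnn m); last by exists w.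
  by have := ltn_ord i; rewrite ltnS leqNgt im.
move/choice => [w wP]; exists (fun p => cox_val s (w p)); split=> [p q|j jm].
  have [hp pE] := wP p; have [hq qE] := wP q; have [h E] := wP (p * q).
  rewrite -cox_val_cat; apply: uniq => //; first by rewrite all_cat hq.
  by rewrite cox_val_cat E pE qE invMg.
rewrite -(cox_val1 s j); have [h E] := wP (adj m j); apply: uniq => //=; first by rewrite jm.
by rewrite E cox_val1 /adj tpermV.
Qed.

End Coxeter.
(** * The relations hold *)

Section WordVal.
Variables (X : Type) (G : groupType) (phi : X -> G).

Lemma word_val_nil : word_val phi [::] = 1%g. Proof. exact: big_nil. Qed.

Lemma word_val_cat u v : word_val phi (u ++ v) = (word_val phi u * word_val phi v)%g.
Proof. exact: big_cat. Qed.

Lemma word_val_cons l u :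
  word_val phi (l :: u) = ((if l.2 then (phi l.1)^-1 else phi l.1) * word_val phi u)%g.
Proof. exact: big_cons. Qed.

Lemma word_val1 x : word_val phi [:: (x, false)] = phi x.
Proof. exact: big_seq1. Qed.

Lemma word_val1V x : word_val phi [:: (x, true)] = (phi x)^-1%g.
Proof. exact: big_seq1. Qed.

Lemma word_val_flatten (I : Type) (r : seq I) (w : I -> word X) :
  word_val phi (flatten [seq w i | i <- r]) = (\prod_(i <- r) word_val phi (w i))%g.
Proof.
by elim: r => [|i r IH]; rewrite ?big_nil ?word_val_nil // big_cons /= word_val_cat IH.
Qed.

Definition word_inv (w : word X) : word X := rev [seq (l.1, ~~ l.2) | l <- w].

Lemma word_val_inv w : word_val phi (word_inv w) = (word_val phi w)^-1%g.
Proof.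
elim: w => [|[x e] w IH]; first by rewrite word_val_nil invg1.
rewrite /word_inv map_cons rev_cons -cats1 word_val_cat -/(word_inv w) IH.
rewrite !word_val_cons word_val_nil mulg1 invgM.
by case: e; rewrite /= ?invgK.
Qed.

End WordVal.

Lemma word_val_wexp (G : groupType) (phi : generator -> G) w n :
  word_val phi (wexp w n) = (word_val phi w ^+ n)%g.
Proof.
by elim: n => [|n IH]; rewrite ?word_val_nil // /wexp /= word_val_cat -/(wexp w n) IH expgS.
Qed.

(** For families [x], [y] of elements with the relations of [vtau_x] and [vtau_y],
    attaching a caret to leaf [i] of the spine with [m] carets: on the last leaf,
    an x-caret gives the next spine and a y-caret the inverse of [y m]. *)
Definition caret_val (G : groupType) (x y : nat -> G) m d i : G :=
  if (i < m)%N then (if d is xcaret then x i else y i)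
  else if d is xcaret then 1%g else (y m)^-1%g.

Lemma attach_spine m : attach xcaret (spine m) m = spine m.+1.
Proof. by elim: m => //= m IH; rewrite subn1 /= IH. Qed.

Section Relations.
Variable R : realType.
Local Open Scope group_scope.

Lemma tree_pair_congr k T1 T1' T2 T2' (p p' : 'S_k) (h1 : nleaves T1 = k)
    (h2 : nleaves T2 = k) (h1' : nleaves T1' = k) (h2' : nleaves T2' = k) :
  T1 = T1' -> T2 = T2' -> p = p' -> tree_pair R p h1 h2 = tree_pair R p' h1' h2'.
Proof.
move=> e1 e2 <-; case: _ / e1 h1'; case: _ / e2 h2' => h2' h1'.
by rewrite (eq_irrelevance h1 h1') (eq_irrelevance h2 h2').
Qed.

Lemma nleaves_attach_ord d m (i : 'I_m.+1) T : nleaves T = m.+1 ->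
  nleaves (attach d T i) = m.+2.
Proof. by move=> h; rewrite nleaves_attach h. Qed.

Definition spine_perm m (p : 'S_m.+1) : Vtau R :=
  tree_pair R p (nleaves_spine m) (nleaves_spine m).

Definition spine_caret m d (i : 'I_m.+1) : Vtau R :=
  tree_pair R 1 (nleaves_attach_ord d i (nleaves_spine m)) (nleaves_spine m.+1).

Lemma spine_permM m : {morph @spine_perm m : p q / p * q >-> q * p}.
Proof. by move=> p q; rewrite /spine_perm tree_pairM. Qed.

Lemma spine_perm1 m : spine_perm (1 : 'S_m.+1) = 1.
Proof. exact: (tree_eq_pair _ _ _ (tree_eq_refl _)). Qed.

Lemma spine_permX m (p : 'S_m.+1) n : spine_perm (p ^+ n) = spine_perm p ^+ n.
Proof.
elim: n => [|n IH]; first by rewrite !expg0 spine_perm1.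
by rewrite expgSr spine_permM IH expgS.
Qed.

(** Expand the tree pair of the permutation at leaf [i]; the factors on both sides
    can then be composed tree by tree. *)
Lemma spine_perm_caret m (p : 'S_m.+1) d (i : 'I_m.+1) :
  spine_perm p * spine_caret d i = spine_caret d (p i) * spine_perm (dup p i).
Proof.
rewrite /spine_perm (tree_pair_expand _ _ _ (nleaves_attach_ord d (p i) (nleaves_spine m))
  (nleaves_attach_ord d i (nleaves_spine m))).
by rewrite !tree_pairM mul1g mulg1.
Qed.

Lemma tree_pair_caret m T (h : nleaves T = m.+1) d (i : 'I_m.+1) :
  tree_pair R 1 h (nleaves_spine m) * spine_caret d i =
  tree_pair R 1 (nleaves_attach_ord d i h) (nleaves_spine m.+1).
Proof.
have h' : nleaves (attach d T ((1%g : 'S_m.+1) i)) = m.+2 by exact: nleaves_attach_ord.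
rewrite (tree_pair_expand _ _ _ h' (nleaves_attach_ord d i (nleaves_spine m))).
rewrite tree_pairM; apply: tree_pair_congr => //; first by rewrite perm1.
by rewrite dup1 mulg1.
Qed.

(** Attaching an x-caret to the last leaf of both trees lengthens the spine. *)
Lemma spine_caret_widen m d (i : 'I_m.+1) (i' : 'I_m.+2) : (i < m)%N -> i' = i :> nat ->
  spine_caret d i = spine_caret d i'.
Proof.
move=> im ii'; rewrite /spine_caret.
have h1 : nleaves (attach xcaret (attach d (spine m) i) ((1%g : 'S_m.+2) ord_max)) = m.+3.
  exact/nleaves_attach_ord/nleaves_attach_ord/nleaves_spine.
have h2 : nleaves (attach xcaret (spine m.+1) (@ord_max m.+1)) = m.+3.
  exact/nleaves_attach_ord/nleaves_spine.
rewrite (tree_pair_expand _ _ _ h1 h2); apply: tree_pair_congr.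
- by rewrite perm1 ii' -attach_spine -attachC ?nleaves_spine.
- exact: attach_spine.
- by rewrite dup1.
Qed.

Lemma spine_caret_gen n d (i : 'I_n.+2) : i = n :> nat ->
  spine_caret d i = (if d is xcaret then vtau_x R n else vtau_y R n).
Proof. by move=> i_n; case: d; apply: tree_pair_congr => //; rewrite i_n. Qed.

Lemma spine_caret_x_last m (i : 'I_m.+1) : i = m :> nat -> spine_caret xcaret i = 1.
Proof.
by move=> i_m; apply: tree_eq_pair; rewrite i_m attach_spine; exact: tree_eq_refl.
Qed.

(** Both sides are given by a tree with two carets on leaf [i] of the spine; these
    trees are related by the swap of carets. *)
Lemma spine_caret_swap m (i : 'I_m.+1) (i0 i1 : 'I_m.+2) : i0 = i :> nat -> i1 = i.+1 :> nat ->
  spine_caret ycaret i * spine_caret ycaret i0 = spine_caret xcaret i * spine_caret xcaret i1.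
Proof.
move=> e0 e1; rewrite !tree_pair_caret.
have h : tree_eq (attach ycaret (attach ycaret (spine m) i) i0)
                 (attach xcaret (attach xcaret (spine m) i) i1).
  have : (i < nleaves (spine m))%N by rewrite nleaves_spine.
  rewrite e0 e1; move: (nat_of_ord i) => {e0 e1 i0 i1 i} i.
  elim: (spine m) i => [|e l IHl r IHr] i iT; first by case: i iT => // _; exact: tree_eq_swap.
  case: (ltnP i (nleaves l)) => il.
    rewrite !attach_left ?nleaves_attach // ?ltnS 1?ltnW //.
    by apply: tree_eq_node; [exact: IHl | exact: tree_eq_refl].
  rewrite -(subnKC il) -addnS !attach_right.
  by apply: tree_eq_node; [exact: tree_eq_refl | apply: IHr; rewrite ltn_subLR].
apply: (mulIg (tree_pair R 1 (nleaves_attach_ord xcaret i1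
  (nleaves_attach_ord xcaret i (nleaves_spine m))) (nleaves_spine m.+2))^-1).
by rewrite mulgV tree_pairV tree_pairM invg1 mulg1; exact: tree_eq_pair.
Qed.

(** The value on the last leaf for a y-caret: attaching two y-carets there amounts
    to attaching two x-carets, which only lengthens the spine. *)
Lemma spine_caretE m d (i : 'I_m.+1) :
  spine_caret d i = caret_val (vtau_x R) (vtau_y R) m d i.
Proof.
have lt n (j : 'I_n.+1) e : (j < n)%N ->
    spine_caret e j = (if e is xcaret then vtau_x R j else vtau_y R j).
  elim: n j => // n IH j; rewrite ltnS leq_eqVlt => /orP[/eqP jn|jn].
    by rewrite (spine_caret_gen _ jn) jn.
  have jn' : (j < n.+1)%N by exact: leqW.
  by rewrite -(@spine_caret_widen n _ (Ordinal jn')) // IH.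
rewrite /caret_val; case: ltnP => im; first exact: lt.
have {}im : i = m :> nat by apply/eqP; rewrite eqn_leq im -ltnS ltn_ord.
case: d; first exact: spine_caret_x_last.
apply: (mulIg (vtau_y R m)); rewrite mulVg.
have im1 : (m < m.+2)%N by exact: ltnW.
have := @spine_caret_swap m i (Ordinal im1) ord_max (esym im) (congr1 S (esym im)).
by rewrite (lt _ (Ordinal im1)) //= (spine_caret_x_last im) spine_caret_x_last // mulg1.
Qed.

Lemma spine_caret_comm m d e (i j : 'I_m.+1) (i' j' : 'I_m.+2) : (i < j)%N ->
  i' = i :> nat -> j' = j.+1 :> nat ->
  spine_caret d j * spine_caret e i' = spine_caret e i * spine_caret d j'.
Proof.
move=> ij ei ej; rewrite !tree_pair_caret; apply: tree_pair_congr => //.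
by rewrite ei ej attachC // nleaves_spine.
Qed.

Local Notation cv := (caret_val (vtau_x R) (vtau_y R)).

Lemma cv_comm m d e i j : (i < j <= m)%N -> cv m d j * cv m.+1 e i = cv m e i * cv m.+1 d j.+1.
Proof.
move=> /andP[ij jm]; have jm' : (j < m.+1)%N by [].
have im : (i < m.+1)%N by exact: ltn_trans ij jm'.
have im' : (i < m.+2)%N by exact: ltnW.
have jm'' : (j.+1 < m.+2)%N by [].
have := @spine_caret_comm m d e (Ordinal im) (Ordinal jm') (Ordinal im') (Ordinal jm'') ij.
by rewrite !spine_caretE /=; apply.
Qed.

Lemma cv_swap m i : (i <= m)%N ->
  cv m ycaret i * cv m.+1 ycaret i = cv m xcaret i * cv m.+1 xcaret i.+1.
Proof.
move=> im; have im0 : (i < m.+1)%N by []; have im1 : (i < m.+2)%N by exact: ltnW.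
have im2 : (i.+1 < m.+2)%N by [].
have := @spine_caret_swap m (Ordinal im0) (Ordinal im1) (Ordinal im2).
by rewrite !spine_caretE /=; apply.
Qed.

Lemma cv_perm m (p : 'S_m.+1) d (i : 'I_m.+1) :
  spine_perm p * cv m d i = cv m d (p i) * spine_perm (dup p i).
Proof. by rewrite -!spine_caretE spine_perm_caret. Qed.

Lemma spine_perm_adjS m i : (i.+1 < m)%N ->
  spine_perm (adj m i) = spine_perm (adj m.+1 i).
Proof.
move=> im; have mm : adj m i ord_max = ord_max.
  by apply: val_inj; rewrite /= adjE /=; [perm_nat | exact: ltnW].
have h : nleaves (attach xcaret (spine m) (@ord_max m)) = m.+2.
  exact/nleaves_attach_ord/nleaves_spine.
rewrite -(@dup_adj_gt m i ord_max) //; last exact: ltnW.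
have h' : nleaves (attach xcaret (spine m) (adj m i ord_max)) = m.+2 by rewrite mm.
rewrite /spine_perm (tree_pair_expand _ _ _ h' h).
by apply: tree_pair_congr => //; rewrite ?mm attach_spine.
Qed.

Lemma spine_perm_pi m i : (i.+1 < m)%N -> spine_perm (adj m i) = vtau_pi R i.
Proof.
elim: m => // m IH; rewrite ltnS leq_eqVlt => /orP[/eqP im|im]; last first.
  by rewrite -spine_perm_adjS // IH.
by case: _ / im; apply: tree_pair_congr.
Qed.

Lemma spine_perm_c n : spine_perm (cyc n.+1) = vtau_c R n.
Proof. by []. Qed.

Local Notation gen d n := (if d is xcaret then vtau_x R n else vtau_y R n).

Lemma cv_lt m d i : (i < m)%N -> cv m d i = gen d i.
Proof. by rewrite /caret_val => ->. Qed.

Lemma gen_comm d e i j : (i < j)%N -> gen d j * gen e i = gen e i * gen d j.+1.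
Proof.
move=> ij; have := @cv_comm j.+1 d e i j; rewrite ij leqnSn => /(_ isT).
by rewrite !cv_lt //; lia.
Qed.

Lemma c_gen d k n : (k < n)%N -> gen d k * vtau_c R n.+1 = vtau_c R n * gen d k.+1.
Proof.
move=> kn; have k1 : (k.+1 < n.+2)%N by lia.
have := @cv_perm n.+1 (cyc n.+1) d (Ordinal k1).
by rewrite dup_cyc // !spine_perm_c cycE /= !cv_lt //; lia.
Qed.

Lemma c_gen0 d n : vtau_c R n * gen d 0 = cv n.+1 d n.+1 * vtau_c R n.+1 ^+ 2.
Proof.
have := @cv_perm n.+1 (cyc n.+1) d ord0.
by rewrite dup_cyc0 // spine_permM !spine_perm_c cycE /= cv_lt.
Qed.

Lemma c_last n : vtau_c R n = vtau_x R n * vtau_c R n.+1.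
Proof.
have := @cv_perm n.+1 (cyc n.+1) xcaret ord_max.
by rewrite dup_cyc // !spine_perm_c cycE /= (@cv_lt _ _ n) // /caret_val ltnn mulg1.
Qed.

Lemma pi_gen_gt d i j : (i.+2 <= j)%N -> vtau_pi R i * gen d j = gen d j * vtau_pi R i.
Proof.
move=> ij; have j2 : (j < j.+2)%N by exact: ltnW.
have := @cv_perm j.+1 (adj j.+1 i) d (Ordinal j2).
rewrite dup_adj_gt //; last by lia.
rewrite !spine_perm_pi ?adjE; try lia.
by rewrite !cv_lt //=; perm_nat.
Qed.

Lemma pi_gen_lt d i j : (j < i)%N -> vtau_pi R i * gen d j = gen d j * vtau_pi R i.+1.
Proof.
move=> ji; have j2 : (j < i.+3)%N by lia.
have := @cv_perm i.+2 (adj i.+2 i) d (Ordinal j2).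
rewrite (@dup_adj_lt i.+2 i (Ordinal j2) (leqW (ltnSn _)) ji).
rewrite !spine_perm_pi ?adjE; try lia.
rewrite /= (ltn_eqF ji) (ltn_eqF (leqW ji)) !cv_lt //; lia.
Qed.

Lemma pi_gen d i :
  vtau_pi R i * gen d i = gen d i.+1 * vtau_pi R i * vtau_pi R i.+1.
Proof.
have i2 : (i < i.+3)%N by lia.
have := @cv_perm i.+2 (adj i.+2 i) d (Ordinal i2).
rewrite (@dup_adj_eq i.+2 i (Ordinal i2) (leqW (ltnSn _)) erefl).
rewrite spine_permM !spine_perm_pi ?adjE; try lia.
by rewrite /= eqxx !cv_lt ?mulgA.
Qed.

Lemma pi_genS d i :
  vtau_pi R i * gen d i.+1 = gen d i * vtau_pi R i.+1 * vtau_pi R i.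
Proof.
have i2 : (i.+1 < i.+3)%N by lia.
have := @cv_perm i.+2 (adj i.+2 i) d (Ordinal i2).
rewrite (@dup_adj_eqS i.+2 i (Ordinal i2) (leqW (ltnSn _)) erefl).
rewrite spine_permM !spine_perm_pi ?adjE; try lia.
by rewrite /= eqxx (gtn_eqF (ltnSn i)) !cv_lt ?mulgA.
Qed.

Lemma pi_coxeter m : coxeter (fun j => spine_perm (adj m j)) m.
Proof.
have [h1 h2 h3] := coxeter_adj m; split=> [j jm|j jm|i j ij jm].
- by rewrite -spine_permM h1 // spine_perm1.
- by rewrite -!spine_permM !mulgA h2.
- by rewrite -!spine_permM (h3 i j).
Qed.

Lemma c_pi n k : (0 < k <= n)%N ->
  vtau_c R n * spine_perm (adj n.+1 k) = spine_perm (adj n.+1 k.-1) * vtau_c R n.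
Proof. by move=> kn; rewrite -spine_perm_c -!spine_permM adj_cyc. Qed.

(** Twice the cycle moves leaves 0 and 1 to the last two leaves. *)
Lemma c2_pi0 n : (0 < n)%N ->
  vtau_c R n ^+ 2 * vtau_pi R 0 = spine_perm (adj n.+1 n) * vtau_c R n ^+ 2.
Proof.
move=> n0; rewrite -spine_perm_c -(@spine_perm_pi n.+1) // -spine_permX -!spine_permM.
by rewrite adj0_cyc2.
Qed.

Lemma c_prod n : vtau_c R n =
  spine_perm (adj n.+1 n) * \prod_(i <- rev (iota 0 n)) vtau_pi R i.
Proof.
suff h k : (k <= n)%N -> spine_perm (\prod_(0 <= j < k) adj n.+1 j) =
    \prod_(i <- rev (iota 0 k)) vtau_pi R i.
  by rewrite -spine_perm_c cyc_prod big_nat_recr //= spine_permM h.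
elim: k => [|k IH] kn; first by rewrite big_geq // big_nil spine_perm1.
have -> : rev (iota 0 k.+1) = k :: rev (iota 0 k) by rewrite -addn1 iotaD rev_cat.
by rewrite big_nat_recr //= spine_permM IH 1?ltnW // spine_perm_pi // big_cons.
Qed.

Lemma pi_rels :
  [/\ forall i, vtau_pi R i * vtau_pi R i = 1,
      forall i, vtau_pi R i.+1 * vtau_pi R i * vtau_pi R i.+1 =
                vtau_pi R i * vtau_pi R i.+1 * vtau_pi R i &
      forall i j, (i.+2 <= j)%N -> vtau_pi R i * vtau_pi R j = vtau_pi R j * vtau_pi R i].
Proof.
split=> [i|i|i j ij].
- by have [+ _ _] := pi_coxeter i.+2 => /(_ i); rewrite spine_perm_pi //; apply.
- have [_ + _] := pi_coxeter i.+3 => /(_ i); rewrite !spine_perm_pi //; try lia.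
  by move=> ->.
- have [_ _] := pi_coxeter j.+2 => /(_ i j); rewrite !spine_perm_pi //; try lia.
  by apply; lia.
Qed.

Lemma prod_pi_inv n : \prod_(i <- iota 0 n) vtau_pi R i =
  (\prod_(i <- rev (iota 0 n)) vtau_pi R i)^-1.
Proof.
have [h _ _] := pi_rels; elim: n => [|n IH]; first by rewrite !big_nil invg1.
rewrite -addn1 iotaD rev_cat big_cat /= big_seq1 big_cons IH invgM; congr (_ * _).
by apply: (mulgI (vtau_pi R n)); rewrite h mulgV.
Qed.

Lemma spine_rho_sq n : spine_perm (adj n.+1 n) * spine_perm (adj n.+1 n) = 1.
Proof. by have [h _ _] := pi_coxeter n.+1; exact: h. Qed.

(** The relations between [c_n] and the [pi_k] follow from [c_prod] and from the
    conjugation formulas [c_pi] and [c2_pi0]. *)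
Lemma vtau_relP u v : vtau_rel u v ->
  word_val (generator_val R) u = word_val (generator_val R) v.
Proof.
have prod_pi r : word_val (generator_val R) (flatten [seq wpi i | i <- r]) =
    \prod_(i <- r) vtau_pi R i.
  by rewrite word_val_flatten; apply: eq_bigr => i _; rewrite word_val1.
pose simp := (prod_pi, word_val_cat, word_val_wexp, word_val1, word_val1V, word_val_nil).
have [p1 p2 p3] := pi_rels.
have c2 n : vtau_c R n ^+ 2 = vtau_c R n * vtau_c R n by rewrite expgS expg1.
have rhoc n : spine_perm (adj n.+1 n) * vtau_c R n = \prod_(i <- rev (iota 0 n)) vtau_pi R i.
  by rewrite c_prod mulgA spine_rho_sq mul1g.
case=> [i j ij|i j ij|i j ij|i j ij|n|k n n0 kn|n n0|n n0|n n0|k n n0 kn|n n0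
  |i j ij|i|i|i j ij|i|i|i j ij|k n n0 k1 kn|n n0|n n0|n n0|i j ij|i|i|i j ij];
  rewrite !simp /=.
- exact: (gen_comm xcaret xcaret).
- exact: (gen_comm xcaret ycaret).
- exact: (gen_comm ycaret xcaret).
- exact: (gen_comm ycaret ycaret).
- by have := @cv_swap n.+1 n (leqnSn n); rewrite !cv_lt // expgS expg1.
- exact: (c_gen xcaret).
- by rewrite (c_gen0 xcaret) /caret_val ltnn mul1g.
- exact: c_last.
- by rewrite -spine_perm_c -spine_permX cyc_order spine_perm1.
- exact: (c_gen ycaret).
- by rewrite (c_gen0 ycaret) /caret_val ltnn.
- exact: (pi_gen_gt xcaret).
- by rewrite (pi_genS xcaret) mulgA.
- by rewrite (pi_gen xcaret) mulgA.
- exact: (pi_gen_lt xcaret).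
- by rewrite expgS expg1.
- have piK k f : f * vtau_pi R k * vtau_pi R k = f by rewrite -mulgA p1 mulg1.
  by rewrite !expgS expg0 mulg1 !mulgA p2 !piK p1.
- exact: p3.
- by have := @c_pi n k; rewrite !spine_perm_pi; try lia; apply; lia.
- rewrite prod_pi_inv -rhoc invgM c2 -mulgA (mulgA _ _ (vtau_c R n)).
  have h := c2_pi0 n0; apply: (mulgI (vtau_c R n)); rewrite !mulgA -c2 h mulgV mul1g.
  by rewrite c2 mulgA; congr (_ * _ * _); apply: (mulgI (spine_perm (adj n.+1 n)));
     rewrite spine_rho_sq mulgV.
- by rewrite c2_pi0 // c2 mulgA rhoc.
- rewrite expgS -mulgA c2_pi0 // mulgA c_pi ?n0 ?leqnn // spine_perm_pi; last by lia.
  by rewrite -mulgA.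
- exact: (pi_gen_gt ycaret).
- by rewrite (pi_genS ycaret) mulgA.
- by rewrite (pi_gen ycaret) mulgA.
- exact: (pi_gen_lt ycaret).
Qed.

Lemma pres_eq_val u v : pres_eq vtau_rel u v ->
  word_val (generator_val R) u = word_val (generator_val R) v.
Proof.
elim=> {u v} [//|u v _ ->//|u v w _ -> _ ->//|u u' v v' _ e1 _ e2|x e|u v]; last exact: vtau_relP.
- by rewrite !word_val_cat e1 e2.
- by rewrite !word_val_cons word_val_nil mulg1; case: e; rewrite /= ?mulgV ?mulVg.
Qed.

(** ** Generation *)

Let generated (f : Vtau R) := exists w, word_val (generator_val R) w = f.

Lemma generated1 : generated 1. Proof. by exists [::]; exact: word_val_nil. Qed.

Lemma generatedM f g : generated f -> generated g -> generated (f * g).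
Proof. by move=> [u <-] [v <-]; exists (u ++ v); rewrite word_val_cat. Qed.

Lemma generatedV f : generated f -> generated f^-1.
Proof. by move=> [u <-]; exists (word_inv u); rewrite word_val_inv. Qed.

Lemma generated_spine_caret m d (i : 'I_m.+1) : generated (spine_caret d i).
Proof.
have gx n : generated (vtau_x R n) by exists (wx n); rewrite word_val1.
have gy n : generated (vtau_y R n) by exists (wy n); rewrite word_val1.
rewrite spine_caretE /caret_val; case: ltnP => _; case: d => //; first exact: generated1.
exact: generatedV.
Qed.

Lemma generated_spine_perm m (p : 'S_m.+1) : (1 < m)%N -> generated (spine_perm p).
Proof.
case: m p => // n p n0; rewrite ltnS in n0.
have gp i : generated (vtau_pi R i) by exists (wpi i); rewrite word_val1.
have gc : generated (vtau_c R n) by exists (wc n0); rewrite word_val1.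
have gadj j : (j < n.+1)%N -> generated (spine_perm (adj n.+1 j)).
  rewrite ltnS leq_eqVlt => /orP[/eqP->|jn]; last by rewrite spine_perm_pi.
  have -> : spine_perm (adj n.+1 n) =
      vtau_c R n * (\prod_(i <- rev (iota 0 n)) vtau_pi R i)^-1.
    by rewrite {1}c_prod mulgK.
  apply: generatedM => //; apply: generatedV.
  by elim: (rev _) => [|i r IH]; rewrite ?big_nil ?big_cons; [exact: generated1 | exact: generatedM].
have [i im|w hw <-] := @adj_generate n.+1 n.+1 p (leqnn _).
  by have := ltn_ord i; rewrite ltnS leqNgt im.
elim: w hw => [|j w IH] /=; first by rewrite cox_val_nil spine_perm1 => _; exact: generated1.
by move=> /andP[jn /IH h]; rewrite cox_val_cons spine_permM; exact: generatedM (gadj _ jn).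
Qed.

Lemma generated_tree m T (h : nleaves T = m.+1) :
  generated (tree_pair R 1 h (nleaves_spine m)).
Proof.
pose Q U := forall m (h : nleaves U = m.+1), generated (tree_pair R 1 h (nleaves_spine m)).
suff : Q T by apply.
apply: (@refines_attach_closed Q Leaf) (refines_leaf T) _ => [d U i iU QU k hk|k hk].
  have kU : nleaves U = k by move: hk; rewrite nleaves_attach // => -[].
  case: k hk kU => [|k] hk kU; first by rewrite kU in iU.
  rewrite kU in iU; have := @tree_pair_caret k U kU d (Ordinal iU).
  rewrite (eq_irrelevance (nleaves_attach_ord d (Ordinal iU) kU) hk) => <-.
  by apply: generatedM; [exact: QU | exact: generated_spine_caret].
case: k hk => // hk; rewrite tree_eq_pair; [exact: generated1 | exact: tree_eq_refl].
Qed.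

(** A tree pair can be expanded until it has at least three leaves. *)
Lemma vtau_large_tree_pair (f : Vtau R) : exists n T1 T2 (p : 'S_n.+3)
  (h1 : nleaves T1 = n.+3) (h2 : nleaves T2 = n.+3), f = tree_pair R p h1 h2.
Proof.
have step k T1 T2 (p : 'S_k.+1) (h1 : nleaves T1 = k.+1) (h2 : nleaves T2 = k.+1) :
    f = tree_pair R p h1 h2 ->
    exists T1 T2 (p : 'S_k.+2) (h1 : nleaves T1 = k.+2) (h2 : nleaves T2 = k.+2),
      f = tree_pair R p h1 h2.
  move=> ->; exists (attach xcaret T1 (p ord0)), (attach xcaret T2 (@ord0 k)), (dup p ord0).
  exists (nleaves_attach_ord xcaret (p ord0) h1), (nleaves_attach_ord xcaret ord0 h2).
  exact: tree_pair_expand.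
have [k [T1 [T2 [p [h1 [h2 e]]]]]] := vtau_tree_pair f.
case: k p h1 h2 e => [|[|[|n]]] p h1 h2 e.
- by have := nleaves_gt0 T1; rewrite h1.
- have [T1' [T2' [p' [h1' [h2' /step]]]]] := step _ _ _ _ _ _ e.
  by exists 0%N.
- by exists 0%N; exact: step e.
- by exists n, T1, T2, p, h1, h2.
Qed.

Lemma vtau_generated (f : Vtau R) : exists w, word_val (generator_val R) w = f.
Proof.
have [n [T1 [T2 [p [h1 [h2 ->]]]]]] := vtau_large_tree_pair f.
have -> : tree_pair R p h1 h2 = tree_pair R 1 h1 (nleaves_spine n.+2) *
    (spine_perm p * (tree_pair R 1 h2 (nleaves_spine n.+2))^-1).
  by rewrite tree_pairV !tree_pairM invg1 mul1g mulg1.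
apply: generatedM; first exact: generated_tree.
apply: generatedM; first exact: generated_spine_perm.
by apply: generatedV; exact: generated_tree.
Qed.

End Relations.
(** * Groups in which the relations hold *)

Section RelationGroup.
Variables (G : groupType) (phi : generator -> G).
Hypothesis phiP : forall u v, vtau_rel u v -> word_val phi u = word_val phi v.
Local Open Scope group_scope.

Local Notation x n := (phi (gen_x n)).
Local Notation y n := (phi (gen_y n)).
Local Notation pi n := (phi (gen_pi n)).
Local Notation c n := (phi (gen_c (ltn0Sn n))).
Local Notation gen d n := (if d is xcaret then x n else y n).
Local Notation cv := (caret_val (fun n => x n) (fun n => y n)).

Let simp := (word_val_cat, word_val_wexp, word_val1, word_val1V, word_val_nil).

Lemma rg_gen_comm d e i j : (i < j)%N -> gen d j * gen e i = gen e i * gen d j.+1.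
Proof.
move=> ij; case: d; case: e.
- by have := phiP (rel_xx ij); rewrite !simp.
- by have := phiP (rel_xy ij); rewrite !simp.
- by have := phiP (rel_yx ij); rewrite !simp.
- by have := phiP (rel_yy ij); rewrite !simp.
Qed.

Lemma rg_y2 n : y n * y n = x n * x n.+1.
Proof. by have := phiP (rel_y2 n); rewrite !simp expgS expg1. Qed.

Lemma rg_c_gen d k n : (k < n.+1)%N -> gen d k * c n.+1 = c n * gen d k.+1.
Proof.
move=> kn; case: d.
- by have := phiP (rel_xc (ltn0Sn n) kn); rewrite !simp.
- by have := phiP (rel_yc (ltn0Sn n) kn); rewrite !simp.
Qed.

Lemma rg_c_last n : c n = x n.+1 * c n.+1.
Proof. by have := phiP (rel_c (ltn0Sn n)); rewrite !simp. Qed.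

(** The counterpart for y-carets of the relation [c_n = x_n c_(n+1)]: replace
    [x_n x_(n+1)] by the square of [y_n]. *)
Lemma rg_c_last_y n : c n = y n.+1 * c n.+1 * y n.+2.
Proof.
have h := rg_c_gen ycaret (ltnSn n.+1).
by rewrite -mulgA -h mulgA rg_y2 -mulgA -rg_c_last -rg_c_last.
Qed.

Lemma rg_pi_gt d i j : (i.+2 <= j)%N -> pi i * gen d j = gen d j * pi i.
Proof.
move=> ij; case: d.
- by have := phiP (rel_pix_gt ij); rewrite !simp.
- by have := phiP (rel_piy_gt ij); rewrite !simp.
Qed.

Lemma rg_pi_lt d i j : (j < i)%N -> pi i * gen d j = gen d j * pi i.+1.
Proof.
move=> ij; case: d.
- by have := phiP (rel_pix_lt ij); rewrite !simp.
- by have := phiP (rel_piy_lt ij); rewrite !simp.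
Qed.

Lemma rg_pi_eq d i : pi i * gen d i = gen d i.+1 * (pi i * pi i.+1).
Proof.
case: d.
- by have := phiP (rel_pix i); rewrite !simp.
- by have := phiP (rel_piy i); rewrite !simp.
Qed.

Lemma rg_pi_eqS d i : pi i * gen d i.+1 = gen d i * (pi i.+1 * pi i).
Proof.
case: d.
- by have := phiP (rel_pixS i); rewrite !simp.
- by have := phiP (rel_piyS i); rewrite !simp.
Qed.

Lemma rg_pi2 i : pi i * pi i = 1.
Proof. by have := phiP (rel_pi2 i); rewrite !simp expgS expg1. Qed.

Lemma braid_of_cube (a b : G) : a * a = 1 -> b * b = 1 -> (a * b) ^+ 3 = 1 -> a * b * a = b * a * b.
Proof.
move=> a2 b2; rewrite !expgS expg0 mulg1 !mulgA => h.
have a2K f : f * a * a = f by rewrite -mulgA a2 mulg1.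
have b2K f : f * b * b = f by rewrite -mulgA b2 mulg1.
by apply: (mulIg (b * a * b)); rewrite !mulgA h b2K a2K b2.
Qed.

Lemma rg_pi_braid i : pi i * pi i.+1 * pi i = pi i.+1 * pi i * pi i.+1.
Proof.
apply/esym/braid_of_cube; rewrite ?rg_pi2 //.
by have := phiP (rel_pi3 i); rewrite !simp.
Qed.

Lemma rg_pi_comm i j : (i.+2 <= j)%N -> pi i * pi j = pi j * pi i.
Proof. by move=> ij; have := phiP (rel_pipi ij); rewrite !simp. Qed.

Lemma rg_c_pi k n : (k <= n)%N -> (0 < k)%N -> c n * pi k = pi k.-1 * c n.
Proof. by move=> kn k0; have := phiP (rel_cpi (ltn0Sn n) k0 kn); rewrite !simp. Qed.

Lemma rg_prod_pi r : word_val phi (flatten [seq wpi i | i <- r]) = \prod_(i <- r) pi i.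
Proof. by rewrite word_val_flatten; apply: eq_bigr => i _; rewrite word_val1. Qed.

(** The transposition of the last two leaves of the spine with [n.+2] carets. It is
    locked because its products must not be unfolded when reassociating. *)
Definition rho n : G := locked ((c n)^-1 * pi n * c n).

Lemma rho_sq n : rho n * rho n = 1.
Proof. by rewrite /rho -lock !mulgA mulgK -(mulgA (c n)^-1) rg_pi2 mulg1 mulVg. Qed.

(** Cancel [c n] between the relations for [c n ^+ 2 * pi 0] and
    [c n ^+ 3 * pi 0]. *)
Lemma rg_rho_c n : rho n * c n = \prod_(i <- rev (iota 0 n.+1)) pi i.
Proof.
have := phiP (rel_c3pi0 (ltn0Sn n)); have := phiP (rel_c2pi0 (ltn0Sn n)).
rewrite !simp rg_prod_pi !expgS !expg0 !mulg1 => h h'.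
apply: (mulgI (c n)); apply: (mulIg (c n)).
by rewrite -(mulgA (c n) (\prod_(i <- _) _)) -h /rho -lock !mulgA mulgV mul1g -!mulgA -h' !mulgA.
Qed.

Lemma rg_c_prod n : c n = rho n * \prod_(i <- rev (iota 0 n.+1)) pi i.
Proof. by rewrite -rg_rho_c mulgA rho_sq mul1g. Qed.

Lemma rg_c2_pi0 n : c n * c n * pi 0 = rho n * c n * c n.
Proof.
have := phiP (rel_c2pi0 (ltn0Sn n)).
by rewrite !simp rg_prod_pi !expgS !expg0 !mulg1 rg_rho_c.
Qed.

Lemma rg_conj_rho n : c n * rho n = pi n * c n.
Proof. by rewrite /rho -lock !mulgA mulgV mul1g. Qed.

(** Candidates for the adjacent transpositions of the leaves of the spine with
    [n.+2] carets; [c n] stands for [c_(n+1)], which permutes these leaves. *)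
Definition transp n j : G := if (j < n.+1)%N then pi j else rho n.

Lemma rho_pi_comm n i : (i < n)%N -> pi i * rho n = rho n * pi i.
Proof.
case: i => [|i] i_n; last first.
  (* Conjugating by [c n] turns these into [pi i] and [pi n]. *)
  have h := rg_c_pi (ltnW i_n) (ltn0Sn i); rewrite /= in h.
  apply: (mulgI (c n)); rewrite !mulgA rg_conj_rho h -!mulgA rg_conj_rho h !mulgA.
  by rewrite rg_pi_comm.
case: n i_n => [//|[|n]] _.
  (* Four leaves: [c = rho * pi 1 * pi 0] in [c * pi 1 = pi 0 * c]. *)
  have := @rg_c_pi 1 1 isT isT; rewrite (rg_c_prod 1) /= !big_cons big_nil mulg1 !mulgA.
  have := congr1 (mulg (rho 1)) (rg_pi_braid 0); rewrite !mulgA => <- h.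
  by apply: (mulIg (pi 1)); apply: (mulIg (pi 0)); rewrite h.
(* Conjugating by the inverse of [c n ^+ 2] turns these into [pi 2] and [pi 0]. *)
have c2 : c n.+2 * c n.+2 * pi 2 = pi 0 * (c n.+2 * c n.+2).
  by rewrite -mulgA !rg_c_pi //= mulgA rg_c_pi //= -mulgA.
apply: (mulIg (c n.+2 * c n.+2)); rewrite -[RHS]mulgA -c2 -[LHS]mulgA.
rewrite (mulgA (rho _)) -rg_c2_pi0 mulgA -c2 -mulgA -(rg_pi_comm (leqnn 2)).
by rewrite !mulgA -rg_c2_pi0.
Qed.

Lemma transp_coxeter n : coxeter (transp n) n.+2.
Proof.
split=> [j jn|j jn|i j ij jn].
- by rewrite /transp; case: ifP => _; [exact: rg_pi2 | exact: rho_sq].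
- rewrite /transp; case: ltnP => j1; case: ltnP => j2; try lia; first exact: rg_pi_braid.
  have {jn j1 j2} -> : j = n by lia.
  case: n => [|n].
    (* Three leaves: [c = rho * pi 0] has order 3. *)
    apply/esym/braid_of_cube; rewrite ?rg_pi2 ?rho_sq //.
    have := phiP (rel_c_order (ltn0Sn 0)).
    by rewrite !simp /= {1}(rg_c_prod 0) /= big_seq1.
  (* Conjugating by [c] turns these into [pi n] and [pi n.+1]. *)
  have h := @rg_c_pi n.+1 n.+1 (leqnn _) (ltn0Sn _); rewrite /= in h.
  have hr := rg_conj_rho n.+1.
  have h' f : f * c n.+1 * pi n.+1 = f * pi n * c n.+1 by rewrite -mulgA h mulgA.
  have hr' f : f * c n.+1 * rho n.+1 = f * pi n.+1 * c n.+1 by rewrite -mulgA hr mulgA.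
  by apply: (mulgI (c n.+1)); rewrite !mulgA h hr' h' hr h' hr' rg_pi_braid.
- rewrite /transp; case: ltnP => i1; case: ltnP => j1; try lia; first exact: rg_pi_comm.
  by apply: rho_pi_comm; lia.
Qed.

(** ** Permutations of the leaves of a spine *)

Definition sigma n : 'S_n.+3 -> G := sval (cid (coxeter_presentation (transp_coxeter n))).

Lemma sigmaM n : {morph @sigma n : p q / p * q >-> q * p}.
Proof. by rewrite /sigma; case: cid => s /= []. Qed.

Lemma sigma_adj n j : (j < n.+2)%N -> sigma (adj n.+2 j) = transp n j.
Proof. by rewrite /sigma; case: cid => s /= [_]; apply. Qed.

Lemma sigma1 n : sigma (1 : 'S_n.+3) = 1.
Proof.
by apply: (mulgI (sigma (1 : 'S_n.+3))); rewrite -sigmaM mulg1 mulg1.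
Qed.

Lemma sigmaV n (p : 'S_n.+3) : sigma p^-1 = (sigma p)^-1.
Proof. by apply: (mulgI (sigma p)); rewrite -sigmaM mulVg sigma1 mulgV. Qed.

Lemma sigma_pi n j : (j < n.+1)%N -> sigma (adj n.+2 j) = pi j.
Proof. by move=> jn; rewrite sigma_adj 1?ltnW // /transp jn. Qed.

Lemma sigma_cyc n : sigma (cyc n.+2) = c n.
Proof.
have h k : (k <= n.+1)%N -> sigma (\prod_(0 <= j < k) adj n.+2 j) =
    \prod_(i <- rev (iota 0 k)) pi i.
  elim: k => [|k IH] kn; first by rewrite big_geq // big_nil sigma1.
  have -> : rev (iota 0 k.+1) = k :: rev (iota 0 k) by rewrite -addn1 iotaD rev_cat.
  by rewrite big_nat_recr //= sigmaM IH 1?ltnW // sigma_pi // big_cons.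
rewrite cyc_prod big_nat_recr //= sigmaM h // sigma_adj // /transp ltnn.
by rewrite -rg_c_prod.
Qed.

(** Attaching a caret before or after permuting the leaves of a spine. The
    permutations for which the formula holds form a group, which contains the
    cycle and the transpositions avoiding the last leaf. *)
Definition compatible n (p : 'S_n.+3) := forall d (i : 'I_n.+3),
  sigma p * cv n.+2 d i = cv n.+2 d (p i) * sigma (dup p i).

Lemma compatibleM n (p q : 'S_n.+3) : compatible p -> compatible q -> compatible (p * q).
Proof.
move=> hp hq d i.
by rewrite sigmaM -mulgA hp mulgA hq -mulgA -sigmaM -dupM permM.
Qed.

Lemma compatibleV n (p : 'S_n.+3) : compatible p -> compatible p^-1.
Proof.
move=> hp d i; have := hp d (p^-1 i); rewrite permKV => h.
have e : dup p^-1 i = (dup p (p^-1 i))^-1.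
  by apply: (mulgI (dup p (p^-1 i))); rewrite mulgV -{2}(permKV p i) -dupM mulgV dup1.
rewrite sigmaV e sigmaV; apply: (mulgI (sigma p)); apply: (mulIg (sigma (dup p (p^-1 i)))).
by rewrite !mulgA mulgV mul1g mulgVK h.
Qed.

Lemma compatible_cyc n : compatible (cyc n.+2).
Proof.
move=> d i; rewrite sigma_cyc cycE; case: (posnP i) => i0.
  rewrite dup_cyc0 // sigmaM sigma_cyc i0 /= /caret_val /= ltnn.
  case: d.
    by have := phiP (rel_cx0 (ltn0Sn n)); rewrite !simp !expgS expg0 mulg1 mul1g.
  by have := phiP (rel_cy0 (ltn0Sn n)); rewrite !simp !expgS expg0 mulg1.
rewrite dup_cyc // sigma_cyc.
case: i i0 => [[//|k] /= kn] _; rewrite /caret_val (kn : (k < n.+2)%N); case: ltnP => kn'.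
  by rewrite rg_c_gen.
have {kn kn'} -> : k = n.+1 by lia.
case: d; first by rewrite mulg1 -rg_c_last.
by rewrite {1}rg_c_last_y mulgK.
Qed.

Lemma compatible_adj_lt n j : (j < n.+1)%N -> compatible (adj n.+2 j).
Proof.
move=> jn d i; have jn2 : (j < n.+2)%N by exact: ltnW.
rewrite sigma_pi // adjE //; case: (ltngtP i j) => ij.
- rewrite (ltn_eqF (leqW ij)) dup_adj_lt // sigma_pi // /caret_val.
  by rewrite (ltn_trans ij jn2) rg_pi_lt.
- case: eqP => [iE|iN].
    rewrite dup_adj_eqS // sigmaM !sigma_pi // 1?ltnW // /caret_val iE jn2 ltnS jn.
    exact: rg_pi_eqS.
  have {ij iN} ij : (j.+1 < i)%N by lia.
  rewrite dup_adj_gt // sigma_pi 1?ltnW // /caret_val.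
  case: ltnP => [_|_]; first exact: rg_pi_gt.
  case: d; first by rewrite mulg1 mul1g.
  apply: (mulgI (y n.+2)); apply: (mulIg (y n.+2)).
  by rewrite !mulgA mulgVK mulgV mul1g (rg_pi_gt ycaret).
- rewrite dup_adj_eq // sigmaM !sigma_pi // 1?ltnW // /caret_val ij jn2 ltnS jn.
  exact: rg_pi_eq.
Qed.

Lemma compatible_all n (p : 'S_n.+3) : compatible p.
Proof.
have hlast : compatible (adj n.+2 n.+1).
  have -> : adj n.+2 n.+1 = cyc n.+2 * adj n.+2 n * (cyc n.+2)^-1.
    by rewrite -(@adj_cyc n.+2 n.+1) ?ltnSn // mulgK.
  apply: compatibleM; last exact/compatibleV/compatible_cyc.
  by apply: compatibleM; [exact: compatible_cyc | exact: compatible_adj_lt].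
have [i im|w hw <-] := @adj_generate n.+2 n.+2 p (leqnn _).
  by have := ltn_ord i; rewrite ltnS leqNgt im.
elim: w hw => [|j w IH] /=; first by rewrite cox_val_nil => _ d i; rewrite dup1 !sigma1 perm1 mulg1 mul1g.
move=> /andP[jn /IH h]; rewrite cox_val_cons; apply: compatibleM => //.
move: jn; rewrite ltnS leq_eqVlt => /orP[/eqP->//|]; exact: compatible_adj_lt.
Qed.

(** ** Trees *)

(** Carets on different leaves can be attached in either order, the number of a leaf
    increasing by one when a caret is attached to its left. *)
Lemma rg_cv_comm m d e i j : (i < j)%N -> (j <= m)%N ->
  cv m d j * cv m.+1 e i = cv m e i * cv m.+1 d j.+1.
Proof.
move=> ij; rewrite leq_eqVlt => /orP[/eqP jm|jm].
  rewrite -jm {jm} /caret_val ltnn ij ltnn (leqW ij).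
  case: d; first by rewrite mulg1 mul1g.
  apply: (mulgI (y j)); apply: (mulIg (y j.+1)).
  by rewrite !mulgA mulgVK mulgV mul1g (rg_gen_comm ycaret).
rewrite /caret_val (leqW (ltn_trans ij jm)) (ltn_trans ij jm) [(j.+1 < _)%N]ltnS jm.
exact: rg_gen_comm.
Qed.

Lemma rg_cv_swap m i : (i <= m)%N ->
  cv m ycaret i * cv m.+1 ycaret i = cv m xcaret i * cv m.+1 xcaret i.+1.
Proof.
rewrite leq_eqVlt => /orP[/eqP<-|im]; rewrite /caret_val.
  by rewrite !ltnn ltnSn mulVg mul1g.
by rewrite (leqW im) [(i.+1 < _)%N]ltnS im rg_y2.
Qed.

Fixpoint ncarets (T : tree) : nat :=
  if T is Node _ l r then (ncarets l + ncarets r).+1 else 0%N.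

Lemma nleavesE T : nleaves T = (ncarets T).+1.
Proof. by elim: T => //= d l -> r ->; rewrite addnS. Qed.

(** The product of the carets of [T] when [T] is attached to leaf [i] of a tree with
    [m] carets, the carets being attached in prefix order. *)
Fixpoint tree_val (T : tree) (i m : nat) : G :=
  if T is Node d l r then
    cv m d i * tree_val l i m.+1 * tree_val r (i + ncarets l).+1 (m.+1 + ncarets l)
  else 1.

(** A caret to the left of a tree can be attached before or after it. *)
Lemma tree_val_right d T a b m : (a < b)%N -> (b <= m)%N ->
  cv m d a * tree_val T b.+1 m.+1 = tree_val T b m * cv (m + ncarets T) d a.
Proof.
elim: T b m => [|e l IHl r IHr] b m ab bm /=; first by rewrite addn0 mulg1 mul1g.
rewrite !mulgA -rg_cv_comm // -(mulgA (cv m e b)) IHl //; last exact: leqW.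
rewrite -!mulgA; congr (_ * (_ * _)).
rewrite !addSn IHr ?addnS ?addnA //; lia.
Qed.

(** The same for a caret to the right of the tree, whose leaf is renumbered. *)
Lemma tree_val_left d T a b m : (b < a)%N -> (a <= m)%N ->
  cv m d a * tree_val T b m.+1 = tree_val T b m * cv (m + ncarets T) d (a + ncarets T).
Proof.
elim: T a b m => [|e l IHl r IHr] a b m ab am /=; first by rewrite !addn0 mulg1 mul1g.
rewrite !mulgA rg_cv_comm // -(mulgA (cv m e b)) IHl //; last exact: leqW.
rewrite -!mulgA; congr (_ * (_ * _)).
by rewrite !addSn IHr ?addSn ?addnS ?addnA //; lia.
Qed.

Lemma tree_val_attach d T i j m : (j < nleaves T)%N -> (i <= m)%N ->
  tree_val (attach d T j) i m = tree_val T i m * cv (m + ncarets T) d (i + j).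
Proof.
elim: T i j m => [|e l IHl r IHr] i j m.
  by case: j => // _ _; rewrite /= !addn0 !mulg1 mul1g.
move=> jT im; case: (ltnP j (nleaves l)) => jl.
  have nE : ncarets (attach d l j) = (ncarets l).+1.
    by apply: succn_inj; rewrite -!nleavesE nleaves_attach.
  rewrite attach_left //= nE IHl //; last exact: leqW.
  rewrite !addnS -!mulgA; congr (_ * (_ * _)).
  rewrite !addSn tree_val_right ?addnA //; rewrite nleavesE in jl; lia.
rewrite -{1}(subnKC jl) attach_right /= IHr; [|by rewrite ltn_subLR|lia].
rewrite !mulgA; congr (_ * cv _ d _); first by lia.
by rewrite nleavesE in jl *; lia.
Qed.

Lemma ncarets_tree_eq T U : tree_eq T U -> ncarets T = ncarets U.
Proof. by move=> /tree_eq_nleaves; rewrite !nleavesE => -[]. Qed.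

Lemma tree_val_eq T U i m : tree_eq T U -> (i <= m)%N -> tree_val T i m = tree_val U i m.
Proof.
move=> h; elim: h i m => {T U} [T|T U _ IH|T U V _ IH1 _ IH2|d l l' r r' hl IHl hr IHr|a b e] i m im //=.
- by rewrite IH.
- by rewrite IH1 ?IH2.
- by rewrite (ncarets_tree_eq hl) IHl ?IHr //; lia.
rewrite !mulgA rg_cv_swap // -(mulgA (cv m xcaret i)) (@tree_val_left _ _ i.+1) //.
rewrite !mulgA; congr (_ * cv _ _ _ * tree_val _ _ _ * tree_val _ _ _); lia.
Qed.

Lemma tree_val_spine m i : tree_val (spine m) i i = 1.
Proof.
elim: m i => //= m IH i.
by rewrite addn0 addn0 IH /caret_val ltnn !mulg1.
Qed.

(** ** Tree pairs *)

Variable R : realType.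

(** The graph of a correspondence between [G] and the group of maps, read off tree
    pairs. At least three leaves are required, since the [pi_n] and [c_n] only
    permute the leaves of spines with two carets or more. *)
Definition represents (g : G) (f : Vtau R) := exists n T1 T2 (p : 'S_n.+3)
  (h1 : nleaves T1 = n.+3) (h2 : nleaves T2 = n.+3),
  f = tree_pair R p h1 h2 /\ g = tree_val T1 0 0 * sigma p * (tree_val T2 0 0)^-1.

Lemma tree_val_attach0 d T n (i : 'I_n.+3) : nleaves T = n.+3 ->
  tree_val (attach d T i) 0 0 = tree_val T 0 0 * cv n.+2 d i.
Proof.
move=> h; have nE : ncarets T = n.+2 by apply: succn_inj; rewrite -nleavesE.
by rewrite tree_val_attach ?h // !add0n nE.
Qed.

(** The second tree is fixed here, so that it can be refined. *)
Definition represents_on (g : G) (f : Vtau R) T := exists n T1 (p : 'S_n.+3)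
  (h1 : nleaves T1 = n.+3) (h2 : nleaves T = n.+3),
  f = tree_pair R p h1 h2 /\ g = tree_val T1 0 0 * sigma p * (tree_val T 0 0)^-1.

Lemma represents_refines g f T T' : refines T T' ->
  represents_on g f T -> represents_on g f T'.
Proof.
apply: refines_attach_closed => d U i iU [n [T1 [p [h1 [h2 [fE gE]]]]]].
rewrite h2 in iU; pose j := Ordinal iU.
exists n.+1, (attach d T1 (p j)), (dup p j), (nleaves_attach_ord d (p j) h1),
  (nleaves_attach_ord d j h2); split; first by rewrite fE; exact: tree_pair_expand.
rewrite -[i]/(nat_of_ord j) !tree_val_attach0 // invgM !mulgA -(mulgA _ (cv _ _ _) (sigma _)).
by rewrite -compatible_all gE !mulgA mulgK.
Qed.

Lemma represents_tree_eq g f T T' : tree_eq T T' ->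
  represents_on g f T -> represents_on g f T'.
Proof.
move=> e [n [T1 [p [h1 [h2 [fE gE]]]]]].
have h2' : nleaves T' = n.+3 by rewrite -(tree_eq_nleaves e).
exists n, T1, p, h1, h2'; rewrite -(tree_val_eq e) //; split=> //.
rewrite fE -[RHS]mulg1 -(tree_eq_pair R h2' h2 (tree_eq_sym e)) tree_pairM.
by rewrite mul1g.
Qed.

Lemma representsV g f : represents g f -> represents g^-1 f^-1.
Proof.
move=> [n [T1 [T2 [p [h1 [h2 [-> ->]]]]]]]; exists n, T2, T1, p^-1, h2, h1.
by rewrite tree_pairV sigmaV !invgM invgK mulgA.
Qed.

(** Refine both pairs until the second tree of one is the first tree of the other. *)
Lemma representsM g g' f f' : represents g f -> represents g' f' -> represents (g * g') (f * f').
Proof.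
move=> [n [T1 [T2 [p [h1 [h2 [fE gE]]]]]]] /representsV[m [U2 [U1 [q [k2 [k1 [fE' gE']]]]]]].
have [S [S' [TS US e]]] := common_refinement T2 U1.
have hS : represents_on g f S by apply: represents_refines TS _; exists n, T1, p, h1, h2.
have hS' : represents_on g'^-1 f'^-1 S.
  apply: (represents_tree_eq (tree_eq_sym e)); apply: represents_refines US _.
  by exists m, U2, q, k2, k1.
case: hS => [k [A [a [A1 [S1 [-> ->]]]]]]; case: hS' => [l [B [b [B1 [S2 [eb gb]]]]]].
have kl : k = l by have := S2; rewrite S1 => -[].
subst l.
exists k, A, B, (b^-1 * a), A1, B1; split.
  by rewrite -(invgK f') eb tree_pairV (eq_irrelevance S2 S1) tree_pairM.
by rewrite -(invgK g') gb !invgM invgK sigmaM sigmaV !mulgA mulgVK.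
Qed.

Lemma represents1 g : represents g 1 -> g = 1.
Proof.
move=> [n [T1 [T2 [p [h1 [h2 [/esym/tree_pair_eq1[-> e] ->]]]]]]].
by rewrite (tree_val_eq e) // sigma1 mulg1 mulgV.
Qed.

Lemma represents_gen a : represents (phi a) (generator_val R a).
Proof.
have hs k : tree_val (spine k) 0 0 = 1 by exact: tree_val_spine.
have hcaret d n : tree_val (attach d (spine n.+1) n) 0 0 = gen d n.
  rewrite tree_val_attach ?nleaves_spine // hs mul1g /caret_val.
  have -> : ncarets (spine n.+1) = n.+1 by apply: succn_inj; rewrite -nleavesE nleaves_spine.
  by rewrite !add0n ltnSn.
case: a => [n|n|n|n n0].
- exists n, (attach xcaret (spine n.+1) n), (spine n.+2), 1.
  exists (nleaves_attach_spine xcaret n), (nleaves_spine n.+2).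
  by split=> //; rewrite (hcaret xcaret) sigma1 hs invg1 !mulg1.
- exists n, (attach ycaret (spine n.+1) n), (spine n.+2), 1.
  exists (nleaves_attach_spine ycaret n), (nleaves_spine n.+2).
  by split=> //; rewrite (hcaret ycaret) sigma1 hs invg1 !mulg1.
- exists n, (spine n.+2), (spine n.+2), (adj n.+2 n), (nleaves_spine n.+2), (nleaves_spine n.+2).
  by split=> //; rewrite hs sigma_pi // mul1g invg1 mulg1.
- case: n n0 => // n n0; rewrite (bool_irrelevance n0 (ltn0Sn n)).
  exists n, (spine n.+2), (spine n.+2), (cyc n.+2), (nleaves_spine n.+2), (nleaves_spine n.+2).
  by split=> //; rewrite hs sigma_cyc mul1g invg1 mulg1.
Qed.

Lemma represents_word w : represents (word_val phi w) (word_val (generator_val R) w).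
Proof.
elim: w => [|[a e] w IH].
  rewrite !word_val_nil -(mulgV (phi (gen_x 0))) -(mulgV (generator_val R (gen_x 0))).
  by apply: representsM; [|apply: representsV]; exact: represents_gen.
rewrite !word_val_cons; apply: representsM => //.
by case: e => /=; [apply: representsV |]; exact: represents_gen.
Qed.

Lemma word_val_trivial w : word_val (generator_val R) w = 1 -> word_val phi w = 1.
Proof. by move=> h; apply: represents1; rewrite -h; exact: represents_word. Qed.

End RelationGroup.
(** * The presented group *)

Section PresentedGroup.
Variables (X : Type) (rel : word X -> word X -> Prop).

(** Elements are the classes of words, encoded as predicates. *)
Record presented := Presented {
  word_class :> word X -> Prop;
  word_classP : exists w, word_class = pres_eq rel w }.

Definition class_of w : presented := Presented (ex_intro _ w erefl).

Definition repr (P : presented) : word X := sval (cid (word_classP P)).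

Lemma class_ofP u v : class_of u = class_of v <-> pres_eq rel u v.
Proof.
split=> [/(congr1 word_class) /= ->|h]; first exact: pres_refl.
have e : pres_eq rel u = pres_eq rel v.
  by apply/funext => w; apply/propext; split; apply: pres_trans => //; exact: pres_sym.
rewrite /class_of; move: (ex_intro _ u _) (ex_intro _ v _); rewrite e => p q.
by rewrite (Prop_irrelevance p q).
Qed.

Lemma reprK P : class_of (repr P) = P.
Proof.
case: P => P hP; rewrite /repr /=; case: cid => w /= e; move: hP.
by rewrite e => hP; rewrite /class_of (Prop_irrelevance hP (ex_intro _ w erefl)).
Qed.

Definition presented_mul P Q := class_of (repr P ++ repr Q).
Definition presented_inv P := class_of (word_inv (repr P)).

Lemma class_of_cat u v : presented_mul (class_of u) (class_of v) = class_of (u ++ v).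
Proof. by apply/class_ofP; apply: pres_cat; apply/class_ofP; exact: reprK. Qed.

Lemma pres_eq_cancel u v w : pres_eq rel v [::] -> pres_eq rel (u ++ v ++ w) (u ++ w).
Proof.
move=> h; apply: pres_cat; first exact: pres_refl.
exact: (pres_cat h (pres_refl _ w)).
Qed.

Lemma pres_eq_inv_r w : pres_eq rel (w ++ word_inv w) [::].
Proof.
elim: w => [|[x e] w IH]; first exact: pres_refl.
rewrite /word_inv map_cons rev_cons -cats1 /= -/(word_inv w) catA.
apply: pres_trans (pres_cancel rel x e).
exact: (@pres_eq_cancel [:: (x, e)]).
Qed.

Lemma word_invK : involutive (@word_inv X).
Proof.
move=> w; rewrite /word_inv map_rev revK -map_comp -[RHS]map_id.
by apply: eq_map => -[x e]; rewrite /= negbK.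
Qed.

Lemma presented_mulA : associative presented_mul.
Proof.
by move=> P Q S; rewrite -(reprK P) -(reprK Q) -(reprK S) !class_of_cat catA.
Qed.

Lemma presented_mul1 : left_id (class_of [::]) presented_mul.
Proof. by move=> P; rewrite -(reprK P) class_of_cat. Qed.

Lemma presented_mulr1 : right_id (class_of [::]) presented_mul.
Proof. by move=> P; rewrite -(reprK P) class_of_cat cats0. Qed.

Lemma presented_mulV : left_inverse (class_of [::]) presented_inv presented_mul.
Proof.
move=> P; rewrite -{2}(reprK P) class_of_cat; apply/class_ofP.
by have := pres_eq_inv_r (word_inv (repr P)); rewrite word_invK.
Qed.

Lemma presented_mulrV : right_inverse (class_of [::]) presented_inv presented_mul.
Proof.
by move=> P; rewrite -{1}(reprK P) class_of_cat; apply/class_ofP; exact: pres_eq_inv_r.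
Qed.

HB.instance Definition _ := gen_eqMixin presented.
HB.instance Definition _ := gen_choiceMixin presented.
HB.instance Definition _ := isGroup.Build presented
  presented_mulA presented_mul1 presented_mulr1 presented_mulV presented_mulrV.

Lemma word_val_class w : word_val (fun x => class_of [:: (x, false)]) w = class_of w.
Proof.
elim: w => [|[x e] w IH]; first by rewrite word_val_nil.
rewrite word_val_cons IH.
have -> : class_of ((x, e) :: w) = (class_of [:: (x, e)] * class_of w)%g.
  exact/esym/(class_of_cat [:: (x, e)]).
congr (_ * _)%g; case: e => //=.
apply: (mulgI (class_of [:: (x, false)])); rewrite mulgV.
by rewrite [RHS]class_of_cat; apply/esym/class_ofP; exact: (pres_cancel rel x false).
Qed.

End PresentedGroup.

Theorem mainTheorem2 (R : realType) :
  has_presentation (generator_val R) vtau_rel.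
Proof.
split; first exact: vtau_generated.
move=> u v; split=> [h|]; last exact: pres_eq_val.
pose phi a := class_of vtau_rel [:: (a, false)].
have phiP u' v' : vtau_rel u' v' -> word_val phi u' = word_val phi v'.
  by move=> uv; rewrite !word_val_class; apply/class_ofP; exact: pres_rel.
have := @word_val_trivial _ phi phiP R (u ++ word_inv v).
rewrite !word_val_cat !word_val_inv h mulgV => /(_ erefl) e.
apply/class_ofP; rewrite -!word_val_class; apply: (mulIg (word_val phi v)^-1%g).
by rewrite mulgV.
Qed.
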